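(* Let $s\in(0,1/2]$, $T>0$ and $v^0\in\dot H^s$. Then the system $$\partial_t v_k=\tfrac12 ik\sum_{k_1+k_2=k}e^{3ikk_1k_2t}v_{k_1}v_{k_2},\qquad k\in\mathbb{Z}_0,\qquad v(0)=v^0,$$ has a solution $v$ on $[0,T]$ (in the sense described in the context) which is the unique solution on $[0,T]$, belongs to $C([0,T];\dot H^s)$, and depends Lipschitz continuously on the initial data: for every $R>0$ there is $C=C(s,T,R)$ such that if $v^0,w^0\in\dot H^s$ with $\|v^0\|_{\dot H^s},\|w^0\|_{\dot H^s}\le R$ and $v,w$ are the corresponding solutions, then $\sup_{t\in[0,T]}\|v(t)-w(t)\|_{\dot H^s}\le C\|v^0-w^0\|_{\dot H^s}$.
   Context: Write $\mathbb{Z}_0=\mathbb{Z}\setminus\{0\}$. For $s\in\mathbb{R}$, $\dot H^s$ denotes the Hilbert space of sequences $v=(v_k)_{k\in\mathbb{Z}_0}$ of complex numbers with $v_{-k}=\overline{v_k}$ and $\|v\|_{\dot H^s}^2=\sum_{k\in\mathbb{Z}_0}|k|^{2s}|v_k|^2<\infty$. The system above is the periodic KdV equation $\partial_tu=u\partial_xu+\partial_x^3u$ written for $v_k(t)=e^{ik^3t}u_k(t)$, $u_k$ the Fourier coefficients of $u$; sums are over $k_1,k_2\in\mathbb{Z}_0$. A function $v$ is a solution on $[0,T]$ with $v(0)=v^0$ if $v\in L_\infty([0,T];\dot H^0)$ and for every $k\in\mathbb{Z}_0$ and $t\in[0,T]$, $$v_k(t)-v^0_k=\tfrac12 ik\int_0^t\sum_{k_1+k_2=k}e^{3ikk_1k_2\tau}v_{k_1}(\tau)v_{k_2}(\tau)\,d\tau.$$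 *)

(* Defs.v *)
(* mathcomp-analysis (Lebesgue integral, esum, limits)
   + mathcomp-real-closed complex numbers R[i]. *)
From HB Require Import structures.
From mathcomp Require Import all_boot all_order all_algebra.
From mathcomp Require Import all_classical all_reals all_analysis.
From mathcomp Require Import complex.
Set Implicit Arguments. Unset Strict Implicit. Unset Printing Implicit Defensive.
Import Order.TTheory GRing.Theory Num.Theory.
Import numFieldNormedType.Exports.
Import ComplexField.

Local Open Scope classical_set_scope.
Local Open Scope ring_scope.
Local Open Scope complex_scope.

Section KdV.
Variable R : realType.

(* sequences (v_k) indexed by int; only the entries k <> 0 are ever used *)
Definition seqC := int -> R[i].

Definition Z0 : set int := [set k | k != 0].

(* |z|^2 *)
Definition abs2 (z : R[i]) : R := complex.Re z ^+ 2 + complex.Im z ^+ 2.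

(* |k|^(2s) *)
Definition hs_weight (s : R) (k : int) : R := ((`|k|%N)%:R : R) `^ (2 * s).

(* ||v||_{\dot H^s}^2 = sum_{k in Z_0} |k|^{2s} |v_k|^2  (in [0, +oo]) *)
Definition hs_norm2 (s : R) (v : seqC) : \bar R :=
  (\esum_(k in Z0) (hs_weight s k * abs2 (v k))%:E)%R.

(* ||v||_{\dot H^s} in [0, +oo] *)
Definition hs_norm (s : R) (v : seqC) : \bar R :=
  match hs_norm2 s v with
  | EFin r => (Num.sqrt r)%:E
  | _ => +oo%E
  end.

(* v in \dot H^s : reality condition v_{-k} = conj v_k and finite norm *)
Definition in_Hs (s : R) (v : seqC) : Prop :=
  (forall k : int, k != 0 -> v (- k) = (v k)^*) /\ (hs_norm2 s v < +oo)%E.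

Definition seqC_sub (v w : seqC) : seqC := fun k => v k - w k.

(* e^{i theta} *)
Definition expi (theta : R) : R[i] := (cos theta) +i* (sin theta).

(* partial sum, over k1 in [-N, N] with k1 <> 0 and k2 := k - k1 <> 0, of
   e^{3 i k k1 k2 tau} u_{k1} u_{k2} *)
Definition conv_partial (u : seqC) (k : int) (tau : R) (N : nat) : R[i] :=
  \sum_(j < (2 * N).+1)
    let k1 : int := (j%:Z - N%:Z)%R in
    if (k1 != 0) && (k - k1 != 0) then
      expi (3 * (k * k1 * (k - k1))%:~R * tau) * u k1 * u (k - k1)
    else 0.

(* sum_{k1 + k2 = k, k1, k2 in Z_0} e^{3 i k k1 k2 tau} u_{k1} u_{k2}
   (limit of the symmetric partial sums; the series converges absolutely
   whenever u is in \dot H^0) *)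
Definition conv (u : seqC) (k : int) (tau : R) : R[i] :=
  (limn (fun N => complex.Re (conv_partial u k tau N)))
    +i* (limn (fun N => complex.Im (conv_partial u k tau N))).

(* Lebesgue integral over [0, t] of a complex valued function *)
Definition cintegral (t : R) (f : R -> R[i]) : R[i] :=
  (\int[lebesgue_measure]_(tau in `[0, t]) complex.Re (f tau))%R
    +i* (\int[lebesgue_measure]_(tau in `[0, t]) complex.Im (f tau))%R.

(* v is a solution on [0,T] with v(0) = v0:
   v in L_oo([0,T]; \dot H^0) (componentwise measurable, and for some M,
   for a.e. t in [0,T], v(t) in \dot H^0 with norm <= M) and the integral
   equation holds for every k in Z_0 and every t in [0,T]. *)
Definition is_solution (T : R) (v0 : seqC) (v : R -> seqC) : Prop :=
  [/\ (forall k : int, measurable_fun `[0, T] (fun t => complex.Re (v t k))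
                    /\ measurable_fun `[0, T] (fun t => complex.Im (v t k))),
      (exists M : R, {ae (@lebesgue_measure R), forall t : R,
          0 <= t <= T -> in_Hs 0 (v t) /\ (hs_norm 0 (v t) <= M%:E)%E}) &
      (forall k : int, k != 0 -> forall t : R, 0 <= t <= T ->
          v t k - v0 k
          = ('i * ((k%:~R / 2 : R)%:C)) * cintegral t (fun tau => conv (v tau) k tau))].

(* v in C([0,T]; \dot H^s) *)
Definition cont_Hs (s T : R) (v : R -> seqC) : Prop :=
  forall t : R, 0 <= t <= T ->
    in_Hs s (v t) /\
    (forall e : R, 0 < e -> exists2 d : R, 0 < d &
       forall t' : R, 0 <= t' <= T -> `|t' - t| < d ->
         (hs_norm s (seqC_sub (v t') (v t)) < e%:E)%E).

End KdV.

(* Main.v *)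
(** Write the system as v' = Q(v, v).  The phase 3 k k1 k2 of Q vanishes only
    for k k1 k2 = 0, so wherever max(|k1|, |k2|) > N one may integrate by parts
    in time: the boundary term is bilinear of size O(1/N), and substituting the
    equation in the remaining integral leaves a trilinear form with phase
    3 (k1 + k2)(k2 + k3)(k3 + k1).  Its nonresonant part with a large pair sum is
    integrated by parts once more, and everything that survives is bounded in l^2
    by Cauchy-Schwarz and Loomis-Whitney.  A nonnegative subadditive weight w can
    be moved onto one factor of each form, so the same bounds hold in weighted
    l^2; the weights used are |k|^s and min(|k|, K)^s.

    The difference z = v - u of two solutions solves z' = Q(v, z) + Q(z, u), and
    the estimate gives sup |w z| <= |w z(a)| + (1/2) sup |w z| on intervals [a, b]
    whose length depends only on the l^2 bounds.  With u = 0 this propagates H^s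
    regularity; in general it yields uniqueness and the Lipschitz estimate.

    Existence is by Galerkin truncation, which conserves the l^2 norm: the uniform
    H^s bound makes the tails of Q uniformly small, so a limit of the truncations
    is again a solution.  Continuity in H^s follows by approximating the initial
    value by trigonometric polynomials, whose solutions lie in H^1. *)

Require Import Defs.
From HB Require Import structures.
From mathcomp Require Import all_boot all_order all_algebra.
From mathcomp Require Import all_classical all_reals all_analysis.
From mathcomp Require Import measurable_realfun.
From mathcomp Require Import complex zify ring lra.
Set Implicit Arguments. Unset Strict Implicit. Unset Printing Implicit Defensive.
Import Order.TTheory GRing.Theory Num.Theory.
Import numFieldNormedType.Exports.
Import ComplexField.
Local Open Scope classical_set_scope.
Local Open Scope ring_scope.
Local Open Scope complex_scope.

(** * Square-summable families and discrete kernels *)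

(** The obstacle is the factor k of Q, a loss of one derivative. The first integration by parts
    turns it into k / (k k1 k2) = 1 / (k1 k2) up to a constant. Substituting the equation for the
    second factor restores that frequency, now a sum k2 + k3, and the remaining 1 / |k1| does not
    bound a trilinear form by three l^2 norms; hence the second integration by parts. Its phase
    vanishes on three planes: on k2 + k3 = 0 the restored factor vanishes too, while on k1 + k2 = 0
    and k1 + k3 = 0 the sum has lost a variable and 1 / |k1| suffices. Where a time derivative falls
    on a factor, only its bound by a multiple of |k| is used.

    Solutions are only Lebesgue primitives in time, and Q is an infinite sum. So every integration
    by parts is done on a finite sum tested against finitely many frequencies, with a bound
    independent of the number of terms, and dominated convergence carries the bound to the infinite
    sums.

    Absorbing half of a supremum presupposes that it is finite, which is why bounded weights and
    compactly supported approximations come before the weight |k|^s. *)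

Lemma ler_of_eq (R : numDomainType) (x y : R) : x = y -> x <= y. Proof. by move=> ->. Qed.

Section L2.
Variable R : realType.
Implicit Types (f g h a x y w : int -> R) (M N A : R) (s : seq int).

(** [M] is a bound rather than the norm: only finite sums over distinct indices occur, so
    summability never has to be discussed. Nonnegativity lets such sums be enlarged freely. *)
Definition L2 f M := [/\ forall k, 0 <= f k, 0 <= M & forall s, uniq s -> \sum_(k <- s) f k ^+ 2 <= M ^+ 2].

Lemma L2_comp f M (r : int -> int) : injective r -> L2 f M -> L2 (f \o r) M.
Proof.
move=> ri [f0 M0 fM]; split=> [k| |s us] //=.
by rewrite -(big_map r predT (fun k => f k ^+ 2)) fM// map_inj_uniq.
Qed.

Lemma L2_le f g M N : (forall k, 0 <= f k <= g k) -> M <= N -> L2 g M -> L2 f N.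
Proof.
move=> fg MN [g0 M0 gM]; split; [by move=> k; case/andP: (fg k)|exact: le_trans MN|].
move=> s us; apply: (@le_trans _ _ (M ^+ 2)); last by rewrite lerXn2r ?nnegrE// (le_trans M0).
apply: le_trans (gM s us); apply: ler_sum => k _.
by case/andP: (fg k) => fk0 fgk; rewrite lerXn2r ?nnegrE.
Qed.

Lemma L2_ge0 f M : L2 f M -> 0 <= M. Proof. by case. Qed.
Lemma L2_fge0 f M k : L2 f M -> 0 <= f k. Proof. by case. Qed.

Lemma L2_pt f M k : L2 f M -> f k <= M.
Proof.
move=> [f0 M0 /(_ [:: k] isT)]; rewrite big_seq1 => h.
by rewrite -(@ler_pXn2r _ 2)// ?nnegrE.
Qed.

(** The inequality between means, with weights (N + e) / (M + e) and its inverse; the shift e avoids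
    a division by 0 when M or N vanishes and is removed at the end. *)
Lemma cauchy_schwarz_seq (I : Type) (s : seq I) (F G : I -> R) M N : 0 <= M -> 0 <= N ->
  \sum_(i <- s) F i ^+ 2 <= M ^+ 2 -> \sum_(i <- s) G i ^+ 2 <= N ^+ 2 ->
  \sum_(i <- s) F i * G i <= M * N.
Proof.
move=> M0 N0 FM GN.
suff H e : 0 < e -> \sum_(i <- s) F i * G i <= (M + e) * (N + e).
  apply/ler_addgt0Pr => e e0.
  have MN1 : 0 < M + N + 1 by lra.
  (* (M + d) (N + d) = M N + d (M + N + d), and d <= 1 bounds the last term by d (M + N + 1) <=
     e. *)
  pose d := Num.min 1 (e / (M + N + 1)).
  have d0 : 0 < d by rewrite lt_min ltr01/= divr_gt0.
  apply: (le_trans (H d d0)).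
  have dle : d * (M + N + 1) <= e.
    by rewrite -ler_pdivlMr// ge_min lexx orbT.
  have : d <= 1 by rewrite ge_min lexx.
  nra.
move=> e0.
have Me : 0 < M + e by lra.
have Ne : 0 < N + e by lra.
have AG i : F i * G i <= 2^-1 * ((N + e) / (M + e) * F i ^+ 2 + (M + e) / (N + e) * G i ^+ 2).
  rewrite -subr_ge0.
  have -> : 2^-1 * ((N + e) / (M + e) * F i ^+ 2 + (M + e) / (N + e) * G i ^+ 2) - F i * G i =
     ((N + e) * F i - (M + e) * G i) ^+ 2 / (2 * (M + e) * (N + e)).
    by field; rewrite !gt_eqF.
  by rewrite divr_ge0 ?sqr_ge0// !mulr_ge0// ltW.
apply: (le_trans (ler_sum _ (fun i _ => AG i))).
rewrite -mulr_sumr big_split/= -!mulr_sumr.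
have H1 : (N + e) / (M + e) * (\sum_(i <- s) F i ^+ 2) <= (N + e) * (M + e).
  apply: (@le_trans _ _ ((N + e) / (M + e) * (M + e) ^+ 2)).
    by rewrite ler_pM2l ?divr_gt0// (le_trans FM)// lerXn2r ?nnegrE; lra.
  by apply: ler_of_eq; field; rewrite gt_eqF.
have H2 : (M + e) / (N + e) * (\sum_(i <- s) G i ^+ 2) <= (N + e) * (M + e).
  apply: (@le_trans _ _ ((M + e) / (N + e) * (N + e) ^+ 2)).
    by rewrite ler_pM2l ?divr_gt0// (le_trans GN)// lerXn2r ?nnegrE; lra.
  by apply: ler_of_eq; field; rewrite gt_eqF.
lra.
Qed.

Lemma L2_cs f g M N s : uniq s -> L2 f M -> L2 g N -> \sum_(k <- s) f k * g k <= M * N.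
Proof. by move=> us [_ M0 fM] [_ N0 gN]; apply: cauchy_schwarz_seq; auto. Qed.

Lemma addzI (c : int) : injective (fun k : int => c + k). Proof. exact: addrI. Qed.
Lemma subzI (c : int) : injective (fun k : int => c - k). Proof. by move=> i j /addrI /oppr_inj. Qed.
Lemma subzrI (c : int) : injective (fun k : int => k - c). Proof. by move=> i j /addIr. Qed.

Lemma L2_add f c M : L2 f M -> L2 (fun k => f (c + k)) M.
Proof. exact: (@L2_comp f M _ (@addzI c)). Qed.
Lemma L2_sub f c M : L2 f M -> L2 (fun k => f (c - k)) M.
Proof. exact: (@L2_comp f M _ (@subzI c)). Qed.
Lemma L2_subr f c M : L2 f M -> L2 (fun k => f (k - c)) M.
Proof. exact: (@L2_comp f M _ (@subzrI c)). Qed.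

(* [inv_abs 0 = 0], so that sums weighted by [inv_abs] skip the resonant indices. *)
Definition inv_abs (k : int) : R := (`|k|%N)%:R^-1.

Lemma inv_abs_ge0 k : 0 <= inv_abs k. Proof. by rewrite invr_ge0. Qed.
Lemma inv_abs_le1 k : inv_abs k <= 1.
Proof.
rewrite /inv_abs; case: (`|k|%N) => [|n]; first by rewrite invr0.
by rewrite invf_le1 ?ltr0n// ler1n.
Qed.
End L2.

Section inverse_squares.
Variable R : realType.

Lemma sum_superset (I : eqType) (s s' : seq I) (F : I -> R) : (forall k, 0 <= F k) -> uniq s ->
  {subset s <= s'} -> \sum_(k <- s) F k <= \sum_(k <- s') F k.
Proof.
move=> F0; elim: s s' => [|i s IH] s' /=.
  by move=> _ _; rewrite big_nil sumr_ge0.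
move=> /andP[iNs us] ss'.
have is1 : i \in s' by apply: ss'; rewrite inE eqxx.
rewrite big_cons (perm_big _ (perm_to_rem is1)) /= big_cons lerD2l.
apply: IH => // j js.
have : j \in s' by apply: ss'; rewrite inE js orbT.
rewrite (perm_mem (perm_to_rem is1)) inE => /orP[/eqP ji|//].
by rewrite -ji js in iNs.
Qed.

Lemma sum_inv_sq (s : seq nat) : uniq s -> \sum_(n <- s) (n%:R^-1 : R) ^+ 2 <= 2.
Proof.
move=> us.
have Hs : {subset s <= iota 0 (\max_(i <- s) i).+1}.
  by move=> i i_s; rewrite mem_iota/= ltnS; apply: leq_bigmax_seq.
apply: le_trans (sum_superset _ us Hs) _; first by move=> k; rewrite sqr_ge0.
set m := _.+1; have -> : iota 0 m = index_iota 0 m by rewrite /index_iota subn0.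
(* Telescoping: 1 / (n + 1)^2 <= 1 / n - 1 / (n + 1). The term n = 0 is 0 since [0^-1 = 0]. *)
suff : \sum_(0 <= n < m.+1) (n%:R^-1 : R) ^+ 2 <= 2 - m%:R^-1.
  move=> H; apply: le_trans (le_trans H _); last by rewrite gerBl invr_ge0.
  by rewrite [leRHS]big_nat_recr//= lerDl sqr_ge0.
rewrite /m; elim: (\max_(i <- s) i) => [|j IH].
  by rewrite big_nat_recr//= big_nat1 invr0 expr0n/= invr1 expr1n; lra.
rewrite big_nat_recr//=; apply: le_trans (lerD IH (lexx _)) _.
rewrite -[j.+2]addn1 natrD.
have : (0 : R) < j.+1%:R by rewrite ltr0n.
set y := j.+1%:R => y0.
have y1 : 0 < y + 1 by lra.
rewrite -subr_ge0.
have -> : 2 - (y + 1)^-1 - (2 - y^-1 + (y + 1)^-1 ^+ 2) = (y * (y + 1) ^+ 2)^-1.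
  by field; rewrite !gt_eqF.
by rewrite invr_ge0 mulr_ge0// ltW// exprn_gt0.
Qed.

(** The absolute value is injective on each of the two half-lines, which contribute at most 2 each,
    and 2 + 2 = 2 ^ 2. *)
Lemma L2_inv_abs : L2 (@inv_abs R) 2.
Proof.
split=> [k|//|s us]; first exact: inv_abs_ge0.
have half (t : seq int) : uniq t -> {in t &, injective absz} ->
    \sum_(k <- t) (inv_abs R k) ^+ 2 <= 2.
  move=> ut it; have -> : \sum_(k <- t) (inv_abs R k) ^+ 2 =
      \sum_(n <- map absz t) (n%:R^-1 : R) ^+ 2 by rewrite big_map.
  by apply: sum_inv_sq; rewrite map_inj_in_uniq.
rewrite (bigID (fun k : int => 0 <= k)) /=.
rewrite -big_filter -[X in _ + X]big_filter.
have -> : 2 ^+ 2 = 2 + 2 :> R by ring.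
by apply: lerD; apply: half; rewrite ?filter_uniq// => i j; rewrite !mem_filter; lia.
Qed.
End inverse_squares.

(** * Sums over boxes of frequencies *)

Section boxes.
Variable R : realType.

(** In the coordinates [r], the list P lies in the product of its projections, and enlarging the
    range of a nonnegative sum only increases it. Iterated sums, estimated one variable at a time,
    therefore suffice. *)
Lemma sum2_box (T : eqType) (P : seq T) (r : T -> int * int) (G : int -> int -> R) C :
  injective r -> (forall i j, 0 <= G i j) -> uniq P ->
  (forall s1 s2, uniq s1 -> uniq s2 -> \sum_(i <- s1) \sum_(j <- s2) G i j <= C) ->
  \sum_(p <- P) G (r p).1 (r p).2 <= C.
Proof.
move=> ri G0 uP box.
pose s1 := undup [seq (r p).1 | p <- P]; pose s2 := undup [seq (r p).2 | p <- P].
have -> : \sum_(p <- P) G (r p).1 (r p).2 = \sum_(q <- map r P) G q.1 q.2 by rewrite big_map.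
apply: le_trans (box s1 s2 (undup_uniq _) (undup_uniq _)).
have -> : \sum_(i <- s1) \sum_(j <- s2) G i j = \sum_(q <- [seq (i, j) | i <- s1, j <- s2]) G q.1 q.2.
  by rewrite big_allpairs_dep.
apply: sum_superset => //; first by rewrite map_inj_uniq.
move=> q /mapP[p pP ->]; apply/allpairsP; exists (r p); split=> //.
- by rewrite mem_undup; apply: (map_f (fun p => (r p).1)).
- by rewrite mem_undup; apply: (map_f (fun p => (r p).2)).
- by case: (r p).
Qed.

Lemma sum3_box (T : eqType) (P : seq T) (r : T -> int * int * int) (G : int -> int -> int -> R) C :
  injective r -> (forall i j l, 0 <= G i j l) -> uniq P ->
  (forall s1 s2 s3, uniq s1 -> uniq s2 -> uniq s3 ->
     \sum_(i <- s1) \sum_(j <- s2) \sum_(l <- s3) G i j l <= C) ->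
  \sum_(p <- P) G (r p).1.1 (r p).1.2 (r p).2 <= C.
Proof.
move=> ri G0 uP box.
pose s1 := undup [seq (r p).1.1 | p <- P]; pose s2 := undup [seq (r p).1.2 | p <- P].
pose s3 := undup [seq (r p).2 | p <- P].
have -> : \sum_(p <- P) G (r p).1.1 (r p).1.2 (r p).2 = \sum_(q <- map r P) G q.1.1 q.1.2 q.2.
  by rewrite big_map.
apply: le_trans (box s1 s2 s3 (undup_uniq _) (undup_uniq _) (undup_uniq _)).
have -> : \sum_(i <- s1) \sum_(j <- s2) \sum_(l <- s3) G i j l =
    \sum_(q <- [seq (p, l) | p <- [seq (i, j) | i <- s1, j <- s2], l <- s3]) G q.1.1 q.1.2 q.2.
  by rewrite big_allpairs_dep big_allpairs_dep.
apply: sum_superset => //; first by rewrite map_inj_uniq.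
move=> q /mapP[p pP ->]; apply/allpairsP; exists (r p); split=> //.
- apply/allpairsP; exists (r p).1; split=> //.
  + by rewrite mem_undup; apply: (map_f (fun p => (r p).1.1)).
  + by rewrite mem_undup; apply: (map_f (fun p => (r p).1.2)).
  + by case: (r p).1.
- by rewrite mem_undup; apply: (map_f (fun p => (r p).2)).
- by case: (r p).
Qed.

Section est.
Variables (f x g y a h : int -> R) (F X G Y A H : R).
Hypotheses (fF : L2 f F) (xX : L2 x X) (gG : L2 g G) (yY : L2 y Y) (aA : L2 a A) (hH : L2 h H).

Let ge0 := (L2_ge0 fF, L2_ge0 xX, L2_ge0 gG, L2_ge0 yY, L2_ge0 aA, L2_ge0 hH).
Let fge0 := (fun k => L2_fge0 k fF, fun k => L2_fge0 k xX, fun k => L2_fge0 k gG,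
  fun k => L2_fge0 k yY, fun k => L2_fge0 k aA, fun k => L2_fge0 k hH).

Lemma box_bilinear (sg : int -> int -> int) s1 s2 : (forall i, injective (sg i)) ->
  uniq s1 -> uniq s2 ->
  \sum_(i <- s1) \sum_(j <- s2) f i * x i * (g j * y (sg i j)) <= F * X * (G * Y).
Proof.
move=> si u1 u2.
have GY : 0 <= G * Y by rewrite mulr_ge0 ?ge0.
apply: (@le_trans _ _ (\sum_(i <- s1) f i * x i * (G * Y))).
  apply: ler_sum => i _; rewrite -mulr_sumr ler_wpM2l ?mulr_ge0 ?fge0//.
  by apply: (L2_cs u2 gG); exact: (L2_comp (si i) yY).
by rewrite -mulr_suml ler_wpM2r// L2_cs.
Qed.

(** Cauchy-Schwarz in the innermost variable removes it, uniformly in the other two because [ta i j]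
    is injective; what remains is [box_bilinear]. *)
Lemma box_chain (sg : int -> int -> int) (ta : int -> int -> int -> int) s1 s2 s3 :
  (forall i, injective (sg i)) -> (forall i j, injective (ta i j)) ->
  uniq s1 -> uniq s2 -> uniq s3 ->
  \sum_(i <- s1) \sum_(j <- s2) \sum_(l <- s3)
     f i * x i * (g j * y (sg i j)) * (a l * h (ta i j l)) <= F * X * (G * Y) * (A * H).
Proof.
move=> si ti u1 u2 u3.
have AH : 0 <= A * H by rewrite mulr_ge0 ?ge0.
apply: (@le_trans _ _ (\sum_(i <- s1) \sum_(j <- s2) f i * x i * (g j * y (sg i j)) * (A * H))).
  apply: ler_sum => i _; apply: ler_sum => j _.
  rewrite -mulr_sumr ler_wpM2l ?mulr_ge0 ?fge0//.
  by apply: (L2_cs u3 aA); exact: (L2_comp (ti i j) hH).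
under eq_bigr do rewrite -mulr_suml.
by rewrite -mulr_suml ler_wpM2r// box_bilinear.
Qed.

(* Loomis-Whitney: each of the three pairs of variables carries a product of square integrable functions. *)
Lemma box_loomis_whitney s1 s2 s3 : uniq s1 -> uniq s2 -> uniq s3 ->
  \sum_(k <- s1) \sum_(i <- s2) \sum_(j <- s3)
     a k * (f i * y (k - i)) * (h j * x (k - j) * g (i + j)) <= A * (F * Y) * (H * X * G).
Proof.
move=> u1 u2 u3.
(* Cauchy-Schwarz in j against [g (i + j)] leaves B k, which no longer depends on i. Its square is
   summed over k before j at the end. *)
pose B k := Num.sqrt (\sum_(j <- s3) (h j * x (k - j)) ^+ 2).
have B0 k : 0 <= B k by rewrite sqrtr_ge0.
have B2 k : B k ^+ 2 = \sum_(j <- s3) (h j * x (k - j)) ^+ 2.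
  by rewrite sqr_sqrtr// sumr_ge0// => j _; rewrite sqr_ge0.
apply: (@le_trans _ _ (\sum_(k <- s1) \sum_(i <- s2) a k * (f i * y (k - i)) * (B k * G))).
  apply: ler_sum => k _; apply: ler_sum => i _.
  rewrite -mulr_sumr ler_wpM2l ?mulr_ge0 ?fge0//.
  apply: cauchy_schwarz_seq; rewrite ?B2 ?ge0//.
  by have [_ _] := L2_add i gG; apply.
apply: (@le_trans _ _ (\sum_(k <- s1) a k * (F * Y) * (B k * G))).
  apply: ler_sum => k _; rewrite -mulr_suml -mulr_sumr.
  rewrite ler_wpM2r ?mulr_ge0 ?ge0// ler_wpM2l ?fge0//.
  by apply: (L2_cs u2 fF); exact: L2_sub.
rewrite (_ : \sum_(k <- s1) _ = (F * Y) * G * \sum_(k <- s1) a k * B k); last first.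
  by rewrite mulr_sumr; apply: eq_bigr => k _; ring.
rewrite (_ : A * _ * _ = F * Y * G * (A * (H * X))); last by ring.
rewrite ler_wpM2l ?mulr_ge0 ?ge0//.
apply: cauchy_schwarz_seq; rewrite ?mulr_ge0 ?ge0//; first by case: aA => _ _; apply.
under eq_bigr do rewrite B2.
rewrite exchange_big/= exprMn.
apply: (@le_trans _ _ (\sum_(j <- s3) h j ^+ 2 * X ^+ 2)).
  apply: ler_sum => j _; under eq_bigr do rewrite exprMn.
  rewrite -mulr_sumr ler_wpM2l ?sqr_ge0//.
  by have [_ _] := L2_subr j xX; apply.
rewrite -mulr_suml ler_wpM2r ?sqr_ge0//.
by case: hH => _ _; apply.
Qed.
End est.
End boxes.

(** * Trilinear kernels *)

Section kernels.
Variable R : realType.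
Implicit Types (a f g h w : int -> R) (B : (int -> R) -> R -> Prop).
Notation T3 := (int * int * int)%type.
Notation e := (@inv_abs R).

Definition idx3 (p : T3) : int := p.1.1 - p.1.2 - p.2.

(* The class of time derivatives: Q(v, v)_k is only bounded by |k|. *)
Definition lin_growth f D := [/\ forall k, 0 <= f k, 0 <= D & forall k, f k <= (`|k|%N)%:R * D].

Definition nonneg_norm B := forall f F, B f F -> (forall k, 0 <= f k) /\ 0 <= F.

Lemma nonneg_norm_L2 : nonneg_norm (@L2 R). Proof. by move=> f F []. Qed.
Lemma nonneg_norm_lin_growth : nonneg_norm lin_growth. Proof. by move=> f F []. Qed.

(* [p] encodes (k, k1, k2), the third frequency being [idx3 p] = k - k1 - k2.  [a] is the dual
   variable; [B1], [B2], [B3] are [L2], or [lin_growth] for a factor hit by the time derivative. *)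
Definition tri_est B1 B2 B3 (K : T3 -> R) C := forall a f g h A F G H,
  L2 a A -> B1 f F -> B2 g G -> B3 h H -> forall P : seq T3, uniq P ->
  \sum_(p <- P) K p * (a p.1.1 * f p.1.2 * g p.2 * h (idx3 p)) <= C * (A * F * G * H).

Section fixB.
Variables B1 B2 B3 : (int -> R) -> R -> Prop.
Hypotheses (g1 : nonneg_norm B1) (g2 : nonneg_norm B2) (g3 : nonneg_norm B3).

Lemma tri_estD K K' C C' : tri_est B1 B2 B3 K C -> tri_est B1 B2 B3 K' C' ->
  tri_est B1 B2 B3 (fun p => K p + K' p) (C + C').
Proof.
move=> eK eK' a f g h A F G H aA fF gG hH P uP.
under eq_bigr do rewrite mulrDl.
by rewrite big_split mulrDl; apply: lerD; [apply: eK|apply: eK'].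
Qed.

Lemma tri_estZ K C c : 0 <= c -> tri_est B1 B2 B3 K C -> tri_est B1 B2 B3 (fun p => c * K p) (c * C).
Proof.
move=> c0 eK a f g h A F G H aA fF gG hH P uP.
under eq_bigr => p _ do rewrite -[c * K p * _]mulrA.
by rewrite -mulr_sumr -[c * C * _]mulrA ler_wpM2l//; apply: eK.
Qed.

(** The weight starts on the dual variable, test coefficients being bounded by [w k * al k]; it
    passes to the factors because k = k1 + k2 + k3. *)
Lemma tri_est_weight w K C a f g h A F G H F' G' H' :
  (forall k, 0 <= w k) -> (forall i j, w (i + j) <= w i + w j) -> (forall p, 0 <= K p) ->
  tri_est B1 B2 B3 K C -> L2 a A -> B1 f F -> B2 g G -> B3 h H ->
  B1 (fun k => w k * f k) F' -> B2 (fun k => w k * g k) G' -> B3 (fun k => w k * h k) H' ->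
  forall P : seq T3, uniq P ->
  \sum_(p <- P) K p * (w p.1.1 * a p.1.1 * f p.1.2 * g p.2 * h (idx3 p)) <=
    C * (A * (F' * G * H + F * G' * H + F * G * H')).
Proof.
move=> w0 wD K0 eK aA fF gG hH fF' gG' hH' P uP.
have [a0 _] := nonneg_norm_L2 aA; have [f0 _] := g1 fF; have [q0 _] := g2 gG; have [h0 _] := g3 hH.
apply: (@le_trans _ _ (\sum_(p <- P) (K p * (a p.1.1 * (w p.1.2 * f p.1.2) * g p.2 * h (idx3 p))
   + K p * (a p.1.1 * f p.1.2 * (w p.2 * g p.2) * h (idx3 p))
   + K p * (a p.1.1 * f p.1.2 * g p.2 * (w (idx3 p) * h (idx3 p)))))).
  apply: ler_sum => p _.
  have wp : w p.1.1 <= w p.1.2 + w p.2 + w (idx3 p).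
    have {1}-> : p.1.1 = p.1.2 + p.2 + idx3 p by rewrite /idx3; ring.
    by apply: le_trans (wD _ _) _; rewrite lerD2r.
  have Y0 : 0 <= K p * (a p.1.1 * f p.1.2 * g p.2 * h (idx3 p)) by rewrite !mulr_ge0.
  rewrite (_ : K p * (w _ * _ * _ * _ * _) = w p.1.1 * (K p * (a p.1.1 * f p.1.2 * g p.2 * h (idx3 p)))); last by ring.
  by apply: le_trans (ler_wpM2r Y0 wp) _; apply: ler_of_eq; ring.
rewrite !big_split /=.
rewrite (_ : C * _ = C * (A * F' * G * H) + C * (A * F * G' * H) + C * (A * F * G * H')); last by ring.
apply: lerD; first apply: lerD.
- exact: eK aA fF' gG hH _ uP.
- exact: eK aA fF gG' hH _ uP.
- exact: eK aA fF gG hH' _ uP.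
Qed.
End fixB.

(** The order of summation k1, k2, k is chosen so that the innermost variable is absent from both x
    and y: k is summed with a and h, then k2 with g and y, then k1 with f and x. *)
Lemma tri_est12 x y X Y : L2 x X -> L2 y Y ->
  tri_est (@L2 R) (@L2 R) (@L2 R) (fun p => x p.1.2 * y (p.1.2 + p.2)) (X * Y).
Proof.
move=> xX yY a f g h A F G H aA fF gG hH P uP.
have := @sum3_box R _ P (fun p => (p.1.2, p.2, p.1.1))
  (fun i j l => f i * x i * (g j * y (i + j)) * (a l * h (l - (i + j)))) (F * X * (G * Y) * (A * H)).
rewrite (_ : X * Y * _ = F * X * (G * Y) * (A * H)); last by ring.
move=> H1; apply: le_trans (H1 _ _ uP _); last 3 first.
- by move=> [[? ?] ?] [[? ?] ?] [-> -> ->].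
- by case: aA fF gG hH xX yY => a0 _ _ [f0 _ _] [q0 _ _] [h0 _ _] [x0 _ _] [y0 _ _] i j l; rewrite !mulr_ge0.
- move=> s1 s2 s3 u1 u2 u3.
  apply: (box_chain fF xX gG yY aA hH (sg := fun i j => i + j)
    (ta := fun i j l => l - (i + j))     (fun i => @addzI i) (fun i j => @subzrI (i + j)) u1 u2 u3).
apply: ler_of_eq; apply: eq_bigr => p _ /=.
by rewrite /idx3 opprD addrA; ring.
Qed.

Lemma tri_est13 x y X Y : L2 x X -> L2 y Y ->
  tri_est (@L2 R) (@L2 R) (@L2 R) (fun p => x p.1.2 * y (p.1.2 + idx3 p)) (X * Y).
Proof.
move=> xX yY a f g h A F G H aA fF gG hH P uP.
have := @sum3_box R _ P (fun p => (p.1.2, idx3 p, p.1.1))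
  (fun i j l => f i * x i * (h j * y (i + j)) * (a l * g (l - (i + j)))) (F * X * (H * Y) * (A * G)).
rewrite (_ : X * Y * _ = F * X * (H * Y) * (A * G)); last by ring.
move=> H1; apply: le_trans (H1 _ _ uP _); last 3 first.
- by move=> [[i j] l] [[i' j'] l'] [-> + ek]; rewrite /idx3/= ek => /subzI ->.
- by case: aA fF gG hH xX yY => a0 _ _ [f0 _ _] [q0 _ _] [h0 _ _] [x0 _ _] [y0 _ _] i j l; rewrite !mulr_ge0.
- move=> s1 s2 s3 u1 u2 u3.
  apply: (box_chain fF xX hH yY aA gG (sg := fun i j => i + j)
    (ta := fun i j l => l - (i + j))     (fun i => @addzI i) (fun i j => @subzrI (i + j)) u1 u2 u3).
apply: ler_of_eq; apply: eq_bigr => p _ /=.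
rewrite (_ : p.1.1 - (p.1.2 + idx3 p) = p.2); first by ring.
by rewrite /idx3; ring.
Qed.

(** Here k2 + k3 = k - k1, so y is paired with the dual variable a, and k2 becomes the innermost
    variable. *)
Lemma tri_est23 x y X Y : L2 x X -> L2 y Y ->
  tri_est (@L2 R) (@L2 R) (@L2 R) (fun p => x p.1.2 * y (p.2 + idx3 p)) (X * Y).
Proof.
move=> xX yY a f g h A F G H aA fF gG hH P uP.
have := @sum3_box R _ P (fun p => (p.1.2, p.1.1, p.2))
  (fun i j l => f i * x i * (a j * y (j - i)) * (g l * h (j - i - l))) (F * X * (A * Y) * (G * H)).
rewrite (_ : X * Y * _ = F * X * (A * Y) * (G * H)); last by ring.
move=> H1; apply: le_trans (H1 _ _ uP _); last 3 first.
- by move=> [[? ?] ?] [[? ?] ?] [-> -> ->].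
- by case: aA fF gG hH xX yY => a0 _ _ [f0 _ _] [q0 _ _] [h0 _ _] [x0 _ _] [y0 _ _] i j l; rewrite !mulr_ge0.
- move=> s1 s2 s3 u1 u2 u3.
  apply: (box_chain fF xX aA yY gG hH (sg := fun i j => j - i)
    (ta := fun i j l => j - i - l)     (fun i => @subzrI i) (fun i j => @subzI (j - i)) u1 u2 u3).
apply: ler_of_eq; apply: eq_bigr => p _ /=.
rewrite (_ : p.2 + idx3 p = p.1.1 - p.1.2); first by rewrite /idx3; ring.
by rewrite /idx3; ring.
Qed.

(* Up to a constant, 1 / |k1| (the symbol left by the first integration by parts) times the inverse
   of the phase of the second one. *)
Definition phase_kernel (p : T3) : R :=
  e p.1.2 * e (p.1.2 + p.2) * e (p.2 + idx3 p) * e (p.1.2 + idx3 p).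

Lemma inv_abs_lin_growth f D k : lin_growth f D -> e k * f k <= D.
Proof.
move=> [f0 D0 fD]; rewrite /inv_abs; case: (eqVneq k 0) => [->|k0].
  by rewrite absz0 invr0 mul0r.
by rewrite mulrC ler_pdivrMr ?ltr0n ?absz_gt0// mulrC.
Qed.

(** |j| <= |i| + |i + j|, divided by |i| |i + j|: one of the two inverses pays for the growth in j.
    If i or i + j is 0, the left side vanishes by the convention [inv_abs 0 = 0]. *)
Lemma inv_abs_triangle (i j : int) (d D : R) : 0 <= d -> 0 <= D ->
  d <= (`|j|%N)%:R * D -> e i * e (i + j) * d <= (e i + e (i + j)) * D.
Proof.
move=> d0 D0 dD.
have ie : (absz j <= absz (i + j)%R + absz i)%N by lia.
apply: (@le_trans _ _ (e i * e (i + j) * ((`|j|%N)%:R * D))).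
  by rewrite ler_wpM2l// mulr_ge0 ?inv_abs_ge0.
rewrite mulrA ler_wpM2r//.
case: (eqVneq i 0) => [->|i0].
  by rewrite /inv_abs absz0 invr0 !mul0r add0r invr_ge0.
case: (eqVneq (i + j) 0) => [->|ij0].
  by rewrite /inv_abs absz0 invr0 mulr0 mul0r addr0 invr_ge0.
have a0 : (0 : R) < (`|i|%N)%:R by rewrite ltr0n absz_gt0.
have b0 : (0 : R) < (absz (i + j)%R)%:R by rewrite ltr0n absz_gt0.
have gen (u v : R) : 0 < u -> 0 < v -> u^-1 + v^-1 = u^-1 * v^-1 * (v + u).
  by move=> u0 v0; field; rewrite !gt_eqF.
rewrite /inv_abs.
rewrite [leRHS]gen//.
by rewrite ler_wpM2l ?mulr_ge0 ?invr_ge0// -natrD ler_nat.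
Qed.

Let L2e := L2_inv_abs R.
Let e0 k := @inv_abs_ge0 R k.

Lemma phase_kernel_ge0 p : 0 <= phase_kernel p.
Proof. by rewrite !mulr_ge0. Qed.

(** The inverse of |k1| absorbs the growth of f. In the variables k, k2, k3 the three inverse pair
    sums depend on k - k2, k - k3 and k2 + k3, the Loomis-Whitney configuration; each has norm 2,
    whence 8. *)
Lemma tri_est_deriv1 : tri_est lin_growth (@L2 R) (@L2 R) phase_kernel 8.
Proof.
move=> a f g h A F G H aA fF gG hH P uP.
have [f0 F0 _] := fF.
have := @sum3_box R _ P (fun p => (p.1.1, p.2, idx3 p))
  (fun k i j => F * (a k * (g i * e (k - i)) * (h j * e (k - j) * e (i + j)))) (8 * (A * F * G * H)).
move=> H1; apply: le_trans (H1 _ _ uP _); last 3 first.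
- by move=> [[i j] l] [[i' j'] l'] [-> ->]; rewrite /idx3/= => /addIr/subzI ->.
- by case: aA fF gG hH => a0 _ _ _ [q0 _ _] [h0 _ _] i j l; rewrite !mulr_ge0.
- move=> s1 s2 s3 u1 u2 u3.
  have := box_loomis_whitney gG L2e L2e L2e aA hH u1 u2 u3 => /(ler_wpM2l F0) HH.
  rewrite (_ : 8 * _ = F * (A * (G * 2) * (H * 2 * 2))); last by ring.
  apply: le_trans HH; rewrite mulr_sumr; apply: ler_sum => k _.
  by rewrite mulr_sumr; apply: ler_sum => i _; rewrite mulr_sumr.
apply: ler_sum => p _ /=.
rewrite (_ : p.1.1 - p.2 = p.1.2 + idx3 p); last by rewrite /idx3; ring.
rewrite (_ : p.1.1 - idx3 p = p.1.2 + p.2); last by rewrite /idx3; ring.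
have := inv_abs_lin_growth p.1.2 fF.
have c0 : 0 <= e (p.1.2 + p.2) * e (p.2 + idx3 p) * e (p.1.2 + idx3 p) * (a p.1.1 * g p.2 * h (idx3 p)).
  by case: aA gG hH => a0 _ _ [q0 _ _] [h0 _ _]; rewrite !mulr_ge0.
move=> /(ler_wpM2r c0); rewrite /phase_kernel; lra.
Qed.

(** [inv_abs_triangle] at k1 and k2 splits the kernel in two: without the inverse of |k1| it is
    again a Loomis-Whitney sum in k, k1, k3, and without the inverse of |k1 + k2| it is a chain.
    Each part costs 8. *)
Lemma tri_est_deriv2 : tri_est (@L2 R) lin_growth (@L2 R) phase_kernel 16.
Proof.
move=> a f g h A F G H aA fF gG hH P uP.
have [q0 G0 _] := gG.
have [a0 _ _] := aA; have [f0 _ _] := fF; have [h0 _ _] := hH.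
have := @sum3_box R _ P (fun p => (p.1.1, p.1.2, idx3 p))
  (fun k i j => G * (a k * (f i * e (k - i)) * (h j * e (k - j) * e (i + j)))) (8 * (A * F * G * H)).
move=> H1; have {}H1 : _ := H1 _ _ uP _.
have := @sum3_box R _ P (fun p => (p.1.2, p.1.1, idx3 p))
  (fun i k j => G * (f i * e i * (a k * e (k - i)) * (h j * e (i + j)))) (8 * (A * F * G * H)).
move=> H2; have {}H2 : _ := H2 _ _ uP _.
rewrite (_ : 16 * _ = 8 * (A * F * G * H) + 8 * (A * F * G * H)); last by ring.
apply: le_trans (lerD (H1 _ _ _) (H2 _ _ _)).
- rewrite -big_split/=; apply: ler_sum => p _ /=.
  rewrite (_ : p.1.1 - p.1.2 = p.2 + idx3 p); last by rewrite /idx3; ring.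
  rewrite (_ : p.1.1 - idx3 p = p.1.2 + p.2); last by rewrite /idx3; ring.
  have := @inv_abs_triangle p.1.2 p.2 _ _ (q0 p.2) G0.
  case: gG => _ _ /(_ p.2) gp /(_ gp).
  have c0 : 0 <= e (p.2 + idx3 p) * e (p.1.2 + idx3 p) * (a p.1.1 * f p.1.2 * h (idx3 p)).
    by rewrite !mulr_ge0.
  move=> /(ler_wpM2r c0); rewrite /phase_kernel; lra.
- by move=> [[i j] l] [[i' j'] l'] [-> ->]; rewrite /idx3/= => /subzI ->.
- by move=> i j l; rewrite !mulr_ge0.
- move=> s1 s2 s3 u1 u2 u3.
  have := box_loomis_whitney fF L2e L2e L2e aA hH u1 u2 u3 => /(ler_wpM2l G0) HH.
  rewrite (_ : 8 * _ = G * (A * (F * 2) * (H * 2 * 2))); last by ring.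
  apply: le_trans HH; rewrite mulr_sumr; apply: ler_sum => k _.
  by rewrite mulr_sumr; apply: ler_sum => i _; rewrite mulr_sumr.
- by move=> [[i j] l] [[i' j'] l'] [-> ->]; rewrite /idx3/= => /subzI ->.
- by move=> i j l; rewrite !mulr_ge0.
- move=> s1 s2 s3 u1 u2 u3.
  have := box_chain fF L2e aA L2e hH L2e (sg := fun i k => k - i) (ta := fun i k j => i + j)
    (fun i => @subzrI i) (fun i _ => @addzI i) u1 u2 u3 => /(ler_wpM2l G0) HH.
  rewrite (_ : 8 * _ = G * (F * 2 * (A * 2) * (H * 2))); last by ring.
  apply: le_trans HH; rewrite mulr_sumr; apply: ler_sum => k _.
  by rewrite mulr_sumr; apply: ler_sum => i _; rewrite mulr_sumr.
Qed.

(** The kernel is symmetric in k2 and k3. *)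
Lemma tri_est_deriv3 : tri_est (@L2 R) (@L2 R) lin_growth phase_kernel 16.
Proof.
move=> a f g h A F G H aA fF gG hH P uP.
pose sw (p : T3) := (p.1.1, p.1.2, idx3 p).
have swI : injective sw by move=> [[i j] l] [[i' j'] l'] [-> ->]; rewrite /idx3/= => /subzI ->.
have sw2 p : idx3 (sw p) = p.2 by rewrite /sw /idx3 /=; ring.
have := tri_est_deriv2 aA fF hH gG (P := map sw P); rewrite map_inj_uniq// => /(_ uP).
rewrite big_map (_ : A * F * H * G = A * F * G * H); last by ring.
apply: le_trans; apply: ler_sum => p _; rewrite sw2 /phase_kernel sw2 /=.
rewrite [idx3 p + p.2]addrC; lra.
Qed.
End kernels.

(** * Bilinear kernels *)

Section kernels2.
Variable R : realType.
Implicit Types (a f g w : int -> R).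
Notation e := (@inv_abs R).

(** A pair encodes (k, k1), the second frequency being k - k1; a is the dual variable. *)
Definition bil_est (K : int * int -> R) C := forall a f g (A F G : R),
  L2 a A -> L2 f F -> L2 g G -> forall P : seq (int * int), uniq P ->
  \sum_(p <- P) K p * (a p.1 * f p.2 * g (p.1 - p.2)) <= C * (A * F * G).

Lemma bil_est1 : bil_est (fun p => e p.2) 2.
Proof.
move=> a f g A F G aA fF gG P uP.
have := @sum2_box R _ P (fun p => (p.2, p.1))
  (fun i j => f i * e i * (a j * g (j - i))) (F * 2 * (A * G)).
rewrite (_ : 2 * _ = F * 2 * (A * G)); last by ring.
move=> H1; apply: le_trans (H1 _ _ uP _); last 3 first.
- by move=> [i j] [i' j'] [-> ->].
- by case: aA fF gG => a0 _ _ [f0 _ _] [q0 _ _] i j; rewrite !mulr_ge0// inv_abs_ge0.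
- move=> s1 s2 u1 u2.
  exact: (box_bilinear fF (L2_inv_abs R) aA gG (sg := fun i j => j - i) (fun i => @subzrI i) u1 u2).
by apply: ler_of_eq; apply: eq_bigr => p _ /=; ring.
Qed.

Lemma bil_est2 : bil_est (fun p => e (p.1 - p.2)) 2.
Proof.
move=> a f g A F G aA fF gG P uP.
pose sw (p : int * int) := (p.1, p.1 - p.2).
have swI : injective sw by move=> [i j] [i' j'] [->] /subzI ->.
have sw2 p : (sw p).1 - (sw p).2 = p.2 by rewrite /sw /=; ring.
have := bil_est1 aA gG fF (P := map sw P); rewrite map_inj_uniq// => /(_ uP).
rewrite big_map (_ : A * G * F = A * F * G); last by ring.
by apply: le_trans; apply: ler_sum => p _; rewrite sw2 /=; lra.
Qed.

Lemma bil_estD K K' C C' : bil_est K C -> bil_est K' C' -> bil_est (fun p => K p + K' p) (C + C').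
Proof.
move=> eK eK' a f g A F G aA fF gG P uP.
under eq_bigr do rewrite mulrDl.
by rewrite big_split mulrDl; apply: lerD; [apply: eK|apply: eK'].
Qed.

Lemma bil_estZ K C c : 0 <= c -> bil_est K C -> bil_est (fun p => c * K p) (c * C).
Proof.
move=> c0 eK a f g A F G aA fF gG P uP.
under eq_bigr => p _ do rewrite -[c * K p * _]mulrA.
by rewrite -mulr_sumr -[c * C * _]mulrA ler_wpM2l//; apply: eK.
Qed.

Lemma bil_est_weight w K C a f g A F G F' G' :
  (forall k, 0 <= w k) -> (forall i j, w (i + j) <= w i + w j) -> (forall p, 0 <= K p) ->
  bil_est K C -> L2 a A -> L2 f F -> L2 g G ->
  L2 (fun k => w k * f k) F' -> L2 (fun k => w k * g k) G' ->
  forall P, uniq P ->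
  \sum_(p <- P) K p * (w p.1 * a p.1 * f p.2 * g (p.1 - p.2)) <=
    C * (A * (F' * G + F * G')).
Proof.
move=> w0 wD K0 eK aA fF gG fF' gG' P uP.
have [a0 _] := nonneg_norm_L2 aA; have [f0 _] := nonneg_norm_L2 fF; have [q0 _] := nonneg_norm_L2 gG.
apply: (@le_trans _ _ (\sum_(p <- P) (K p * (a p.1 * (w p.2 * f p.2) * g (p.1 - p.2))
   + K p * (a p.1 * f p.2 * (w (p.1 - p.2) * g (p.1 - p.2)))))).
  apply: ler_sum => p _.
  have wp : w p.1 <= w p.2 + w (p.1 - p.2).
    by have {1}-> : p.1 = p.2 + (p.1 - p.2) by ring.
  have Y0 : 0 <= K p * (a p.1 * f p.2 * g (p.1 - p.2)) by rewrite !mulr_ge0.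
  rewrite (_ : K p * (w _ * _ * _ * _) = w p.1 * (K p * (a p.1 * f p.2 * g (p.1 - p.2)))); last by ring.
  by apply: le_trans (ler_wpM2r Y0 wp) _; apply: ler_of_eq; ring.
rewrite !big_split /=.
rewrite (_ : C * _ = C * (A * F' * G) + C * (A * F * G')); last by ring.
apply: lerD; first exact: eK aA fF' gG _ uP.
exact: eK aA fF gG' _ uP.
Qed.
End kernels2.

(** * Primitives of bounded measurable functions *)

Section rprim.
Variables (R : realType) (T : R).
Notation mu := (@lebesgue_measure R).
Implicit Types (f g F G : R -> R).

Definition rbdmeas f := measurable_fun `[0, T] f /\ exists C, forall t, 0 <= t <= T -> `|f t| <= C.

Definition rint t f : R := \int[mu]_(x in `[0, t]) f x.

Lemma rbdmeas_bound f : rbdmeas f -> exists2 C, 0 <= C & forall t, 0 <= t <= T -> `|f t| <= C.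
Proof.
move=> [_ [C fC]]; exists `|C| => // t tT; exact: le_trans (fC t tT) (ler_norm _).
Qed.

Lemma rbdmeas_integrable f t : rbdmeas f -> t <= T -> mu.-integrable `[0, t] (EFin \o f).
Proof.
move=> [mf [C fC]] tT.
apply: measurable_bounded_integrable => //=.
- rewrite lebesgue_measure_itv/=; case: ifP => _; rewrite ltry //.
- by apply: measurable_funS mf => //; apply: subset_itvl; rewrite bnd_simp.
- exists C; split; first exact: num_real.
  move=> x Cx y /=; rewrite in_itv/= => /andP[y0 yt].
  by apply: le_trans (fC y _) (ltW Cx); rewrite y0 (le_trans yt).
Qed.

Lemma rbdmeasD f g : rbdmeas f -> rbdmeas g -> rbdmeas (fun t => f t + g t).
Proof.
move=> [mf [C fC]] [mg [D gD]]; split; first exact: measurable_funD.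
exists (C + D) => t tT; apply: le_trans (ler_normD _ _) (lerD (fC t tT) (gD t tT)).
Qed.

Lemma rbdmeasM f g : rbdmeas f -> rbdmeas g -> rbdmeas (fun t => f t * g t).
Proof.
move=> [mf [C fC]] [mg [D gD]]; split; first exact: measurable_funM.
by exists (C * D) => t tT; rewrite normrM ler_pM ?fC ?gD.
Qed.

Lemma rbdmeas_cst c : rbdmeas (fun=> c).
Proof. by split; [exact: measurable_cst|exists `|c|]. Qed.

Lemma rbdmeasN f : rbdmeas f -> rbdmeas (fun t => - f t).
Proof.
move=> [mf [C fC]]; split; first exact: measurableT_comp.
by exists C => t tT; rewrite normrN fC.
Qed.

Lemma rintD f g t : rbdmeas f -> rbdmeas g -> t <= T -> rint t (fun x => f x + g x) = rint t f + rint t g.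
Proof. by move=> bf bg tT; rewrite /rint RintegralD//; exact: rbdmeas_integrable. Qed.

Lemma rintZ c f t : rbdmeas f -> t <= T -> rint t (fun x => c * f x) = c * rint t f.
Proof. by move=> bf tT; rewrite /rint RintegralZl//; exact: rbdmeas_integrable. Qed.

Lemma rintN f t : rbdmeas f -> t <= T -> rint t (fun x => - f x) = - rint t f.
Proof.
move=> bf tT; rewrite -mulN1r -rintZ//; congr rint; apply/funext => x; by rewrite mulN1r.
Qed.

Lemma rint_eq f g t : (forall x, 0 <= x <= t -> f x = g x) -> rint t f = rint t g.
Proof.
by move=> fg; apply: eq_Rintegral => x; rewrite inE/= in_itv/= => /fg.
Qed.

Lemma rint0 f : rint 0 f = 0.
Proof. by rewrite /rint set_itv1 Rintegral_set1. Qed.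

Lemma rintB f a b : rbdmeas f -> 0 <= a -> a <= b -> b <= T ->
  rint b f - rint a f = \int[mu]_(x in `]a, b]) f x.
Proof.
move=> bf a0 ab bT; rewrite /rint Rintegral_itvB//=; exact: rbdmeas_integrable.
Qed.

Lemma rint_cst c t : 0 <= t -> rint t (fun=> c) = c * t.
Proof.
move=> t0; rewrite /rint Rintegral_cst//= lebesgue_measure_itv/= lte_fin.
case: ltP => [_|t0']; first by rewrite sube0.
by have -> : t = 0 by apply/le_anti; rewrite t0 t0'.
Qed.

Lemma rint_lip f a b C : rbdmeas f -> 0 <= a -> a <= b -> b <= T ->
  (forall x, a <= x <= b -> `|f x| <= C) -> `|rint b f - rint a f| <= C * (b - a).
Proof.
move=> bf a0 ab bT fC; rewrite rintB//.
have iS g : rbdmeas g -> mu.-integrable `]a, b] (EFin \o g).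
  move=> bg; apply: integrableS (rbdmeas_integrable bg bT) => //.
  by apply: subset_itvr; rewrite bnd_simp.
apply: le_trans (le_normr_Rintegral _ (iS _ bf)) _ => //.
apply: (@le_trans _ _ (\int[mu]_(x in `]a, b]) C)).
  apply: le_Rintegral => //; [|exact: (iS _ (rbdmeas_cst C))|].
  - apply: (iS (fun x => `|f x|)); split; first by apply: measurableT_comp => //; case: bf.
    by case: bf => _ [D fD]; exists D => x xT; rewrite normr_id fD.
  - by move=> x /=; rewrite in_itv/= => /andP[ax xb]; apply: fC; rewrite ltW.
rewrite Rintegral_cst//= lebesgue_measure_itv/= lte_fin.
case: ltP => [_|ba] //=.
by have -> : b = a; [apply/le_anti; rewrite ba ab|rewrite subrr].
Qed.

(** The substitute for differentiability: a solution is known only through an integral equation.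
    Boundedness of f makes F Lipschitz, and such pairs are stable under products. *)
Definition rprim F f := rbdmeas f /\ forall t, 0 <= t <= T -> F t = F 0 + rint t f.

Lemma rprim_sub F f a b : rprim F f -> 0 <= a -> a <= b -> b <= T ->
  F b - F a = rint b f - rint a f.
Proof.
move=> [_ Ff] a0 ab bT; rewrite (Ff a) ?(Ff b) ?a0 ?(le_trans ab)// ?(le_trans a0)//.
by ring.
Qed.

Lemma rprim_lip F f a b C : rprim F f -> 0 <= a -> a <= b -> b <= T ->
  (forall x, a <= x <= b -> `|f x| <= C) -> `|F b - F a| <= C * (b - a).
Proof. by move=> Ff a0 ab bT fC; rewrite (rprim_sub Ff)// rint_lip//; case: Ff. Qed.

Lemma lip_rbdmeas F L : 0 <= T -> (forall a b, 0 <= a -> a <= b -> b <= T -> `|F b - F a| <= L * (b - a)) -> rbdmeas F.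
Proof.
move=> T0 FL; split.
  apply: subspace_continuous_measurable_fun => //.
  apply/subspace_continuousP => x /=; rewrite in_itv/= => /andP[x0 xT].
  apply/cvgrPdist_le => e e0; rewrite near_withinE; near=> y; rewrite /= in_itv/= => /andP[y0 yT].
  have L1 : 0 < `|L| + 1 by rewrite ltr_wpDl.
  have xy : `|x - y| < e / (`|L| + 1).
    by near: y; apply: nbhsx_ballx; rewrite divr_gt0.
  have : `|F x - F y| <= L * `|x - y|.
    have [lexy|ltyx] := leP x y.
      by rewrite distrC (le_trans (FL x y _ _ _))// distrC ger0_norm ?subr_ge0.
    by rewrite (le_trans (FL y x _ (ltW ltyx) _))// ger0_norm// subr_ge0 ltW.
  move=> /le_trans; apply.
  apply: (@le_trans _ _ ((`|L| + 1) * `|x - y|)).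
    by rewrite ler_wpM2r// (le_trans (ler_norm _))// lerDl.
  by rewrite mulrC -ler_pdivlMr// ltW.
exists (`|F 0| + `|L| * T) => t /andP[t0 tT].
rewrite -[F t](subrK (F 0)) addrC; apply: le_trans (ler_normD _ _) _.
rewrite lerD2l; apply: le_trans (FL 0 t _ _ _) _ => //.
rewrite subr0; apply: (@le_trans _ _ (`|L| * t)); first by rewrite ler_wpM2r// ler_norm.
by rewrite ler_wpM2l.
Unshelve. all: by end_near. Qed.

Lemma rprim_rbdmeas F f : 0 <= T -> rprim F f -> rbdmeas F.
Proof.
move=> T0 Ff; have [C C0 fC] := rbdmeas_bound (proj1 Ff).
apply: (@lip_rbdmeas _ C) => // a b a0 ab bT.
apply: (rprim_lip Ff) => // x /andP[ax xb].
by apply: fC; rewrite (le_trans a0)// (le_trans xb).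
Qed.

(* Replaces differentiation in the product rule, where only Lebesgue primitives are at hand. *)
Lemma quad_const F C : (forall a b, 0 <= a -> a <= b -> b <= T -> `|F b - F a| <= C * (b - a) ^+ 2) ->
  forall t, 0 <= t <= T -> F t = F 0.
Proof.
move=> FC t /andP[t0 tT]; apply/eqP; rewrite -subr_eq0 -normr_le0.
have H (n : nat) : `|F t - F 0| <= C * t ^+ 2 / n.+1%:R.
  pose d := t / n.+1%:R.
  have d0 : 0 <= d by rewrite divr_ge0.
  have dn : d * n.+1%:R = t by rewrite /d divfK// pnatr_eq0.
  have Hj (j : nat) : (j <= n.+1)%N -> `|F (d * j%:R) - F 0| <= j%:R * (C * d ^+ 2).
    elim: j => [|j IH] jn; first by rewrite mulr0 subrr normr0 mul0r.
    have -> : F (d * j.+1%:R) - F 0 = (F (d * j.+1%:R) - F (d * j%:R)) + (F (d * j%:R) - F 0) by ring.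
    apply: le_trans (ler_normD _ _) _.
    rewrite -[in leRHS]natr1 mulrDl mul1r addrC lerD ?IH ?(ltnW jn)//.
    have -> : d ^+ 2 = (d * j.+1%:R - d * j%:R) ^+ 2 by rewrite -natr1; ring.
    apply: FC; rewrite ?mulr_ge0 ?ler_wpM2l ?ler_nat//.
    by apply: le_trans tT; rewrite -dn ler_wpM2l// ler_nat.
  have := Hj n.+1 (leqnn _); rewrite dn => /le_trans; apply.
  apply: ler_of_eq; rewrite /d.
  have : (n.+1%:R : R) != 0 by rewrite pnatr_eq0.
  by move: (n.+1%:R : R) => m m0; field.
apply/ler_addgt0Pr => e e0; rewrite add0r.
have [C0|C0] := leP (C * t ^+ 2) 0.
  by apply: le_trans (H 0%N) _; rewrite divr1 (le_trans C0)// ltW.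
have [n nC] : exists n, (C * t ^+ 2) / e < n.+1%:R.
  exists (Num.bound (C * t ^+ 2 / e)).
  by apply: lt_trans (archi_boundP _) _; rewrite ?ltr_nat ?divr_ge0// ltW.
apply: le_trans (H n) _.
by rewrite ler_pdivrMr// [leRHS]mulrC -ler_pdivrMr// ltW.
Qed.

(** The increment over [a, b] of F G minus the integral of f G + F g equals the integral of f (G b -
    G) + (F a - F) g. Both differences are O(b - a), so the increment is O((b - a)^2) and
    [quad_const] applies. *)
Lemma rprimM F f G g : 0 <= T -> rprim F f -> rprim G g ->
  rprim (fun t => F t * G t) (fun t => f t * G t + F t * g t).
Proof.
move=> T0 Ff Gg.
have bF := rprim_rbdmeas T0 Ff; have bG := rprim_rbdmeas T0 Gg.
have bf := proj1 Ff; have bg := proj1 Gg.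
have bH : rbdmeas (fun t => f t * G t + F t * g t) by apply: rbdmeasD; exact: rbdmeasM.
split=> // t tT.
have [Cf Cf0 fC] := rbdmeas_bound bf; have [Cg Cg0 gC] := rbdmeas_bound bg.
have inT a b x : 0 <= a -> b <= T -> a <= x <= b -> 0 <= x <= T.
  by move=> a0 bT /andP[ax xb]; rewrite (le_trans a0)// (le_trans xb).
apply/eqP; rewrite -subr_eq; apply/eqP.
pose H t := F t * G t - rint t (fun t => f t * G t + F t * g t).
suff : H t = H 0 by rewrite /H rint0 subr0.
apply: (@quad_const H (2 * Cf * Cg)) => // a b a0 ab bT.
have E : H b - H a =
    rint b (fun x => f x * (G b - G x) + (F a - F x) * g x)
  - rint a (fun x => f x * (G b - G x) + (F a - F x) * g x).
  have aT : a <= T by exact: le_trans bT.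
  have b1 c : rbdmeas (fun x => c * f x) by apply: rbdmeasM => //; exact: rbdmeas_cst.
  have b2 c : rbdmeas (fun x => c * g x) by apply: rbdmeasM => //; exact: rbdmeas_cst.
  have spl u : u <= T -> rint u (fun x => f x * (G b - G x) + (F a - F x) * g x) =
     G b * rint u f + F a * rint u g - rint u (fun x => f x * G x + F x * g x).
    move=> uT; rewrite -(rintZ _ bf uT) -(rintZ _ bg uT) -rintD// -rintN//.
    rewrite -rintD//; first by apply: rint_eq => x _; ring.
      exact: rbdmeasD.
    exact: rbdmeasN.
  rewrite !spl// /H.
  have := rprim_sub Ff a0 ab bT; have := rprim_sub Gg a0 ab bT.
  set c1 := rint b f; set c2 := rint a f; set c3 := rint b g; set c4 := rint a g.
  set c5 := rint b _; set c6 := rint a _ => e1 e2.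
  have -> : G b * c1 + F a * c3 - c5 - (G b * c2 + F a * c4 - c6) =
     G b * (c1 - c2) + F a * (c3 - c4) - c5 + c6 by ring.
  by rewrite -e1 -e2; ring.
rewrite E.
apply: le_trans (rint_lip (C := 2 * Cf * Cg * (b - a)) _ a0 ab bT _) _; last by apply: ler_of_eq; ring.
  apply: rbdmeasD; apply: rbdmeasM => //; apply: rbdmeasD; try exact: rbdmeas_cst; exact: rbdmeasN.
move=> x axb; have xT := inT _ _ _ a0 bT axb; case/andP: (axb) => ax xb.
apply: le_trans (ler_normD _ _) _; rewrite !normrM.
have G1 : `|G b - G x| <= Cg * (b - a).
  apply: le_trans (rprim_lip Gg _ xb bT (C := Cg) _) _.
  - by case/andP: xT.
  - by move=> y /andP[xy yb]; apply: gC; rewrite (le_trans _ xy) ?(le_trans yb)//; case/andP: xT.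
  - by rewrite ler_wpM2l// lerD2l lerN2.
have F1 : `|F a - F x| <= Cf * (b - a).
  rewrite distrC; apply: le_trans (rprim_lip Ff a0 ax _ (C := Cf) _) _.
  - by case/andP: xT.
  - by move=> y /andP[ay yx]; apply: fC; rewrite (le_trans a0)// (le_trans yx)//; case/andP: xT.
  - by rewrite ler_wpM2l// lerD2r.
have := ler_pM (normr_ge0 _) (normr_ge0 _) (fC x xT) G1.
have := ler_pM (normr_ge0 _) (normr_ge0 _) F1 (gC x xT).
lra.
Qed.

Lemma rprimD F f G g : rprim F f -> rprim G g ->
  rprim (fun t => F t + G t) (fun t => f t + g t).
Proof.
move=> [bf Ff] [bg Gg]; split; first exact: rbdmeasD.
move=> t tT; have /andP[_ tT'] := tT.
by rewrite (rintD bf bg tT') (Ff t tT) (Gg t tT) addrACA.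
Qed.

Lemma rprim_cst c : rprim (fun=> c) (fun=> 0).
Proof.
split; first exact: rbdmeas_cst.
by move=> t /andP[t0 _]; rewrite rint_cst// mul0r addr0.
Qed.

Lemma rprimN F f : rprim F f -> rprim (fun t => - F t) (fun t => - f t).
Proof.
move=> [bf Ff]; split; first exact: rbdmeasN.
move=> t tT; have /andP[_ tT'] := tT.
by rewrite (rintN bf tT') (Ff t tT) opprD.
Qed.

Lemma rprim_int f : rbdmeas f -> rprim (fun t => rint t f) f.
Proof. by move=> bf; split=> // t _; rewrite rint0 add0r. Qed.

Lemma eq_rprim F F' f f' : (forall t, 0 <= t <= T -> F t = F' t) -> (forall t, 0 <= t <= T -> f t = f' t) ->
  rprim F f -> rprim F' f'.
Proof.
move=> FF ff [[mf [C fC]] Ff]; split; first split.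
- by apply: eq_measurable_fun mf => t; rewrite inE/= in_itv/= => /ff.
- by exists C => t tT; rewrite -ff// fC.
- move=> t tT; rewrite -!FF//; last by case/andP: tT => t0 tT; rewrite lexx (le_trans t0).
  rewrite (Ff t tT); congr (_ + _); apply: rint_eq => x /andP[x0 xt].
  by apply: ff; rewrite x0 (le_trans xt)//; case/andP: tT.
Qed.

Lemma rprim_derive F f : 0 <= T -> (forall x : R, is_derive x 1 F (f x)) -> continuous f -> rprim F f.
Proof.
move=> T0 dF cf.
have cF : continuous F.
  by move=> x; apply/differentiable_continuous; rewrite -derivable1_diffP; case: (dF x).
have bf : rbdmeas f.
  split; first by apply: measurable_funTS; exact: continuous_measurable_fun.
  have [x xT fx] := EVT_max T0 (continuous_subspaceT (fun x => cf x)).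
  have [y yT fy] := EVT_min T0 (continuous_subspaceT (fun x => cf x)).
  exists (`|f x| + `|f y|) => t tT.
  have tI : t \in `[0, T] by rewrite in_itv.
  have := fx _ tI; have := fy _ tI; have := ler_norm (f x).
  have := lerNnormlW (lexx `|f y|).
  have := normr_ge0 (f x); have := normr_ge0 (f y).
  by move=> *; rewrite ler_norml; lra.
split=> // t /andP[t0 tT].
move: t0; rewrite le_eqVlt => /orP[/eqP <-|t0]; first by rewrite rint0 addr0.
rewrite /rint /Rintegral (@continuous_FTC2 _ _ F)//=.
- by ring.
- exact: continuous_subspaceT.
- split; [|by apply: cvg_at_right_filter; exact: cF|by apply: cvg_at_left_filter; exact: cF].
  by move=> x _; case: (dF x).
- by move=> x _; rewrite derive1E; exact: derive_val.
Qed.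

Lemma rdct (fn : nat -> R -> R) f C : (forall n, measurable_fun `[0, T] (fn n)) ->
  (forall n t, 0 <= t <= T -> `|fn n t| <= C) ->
  (forall t, 0 <= t <= T -> (fun n => fn n t) @ \oo --> f t) ->
  rbdmeas f /\ forall t, 0 <= t <= T -> (fun n => rint t (fn n)) @ \oo --> rint t f.
Proof.
move=> mfn fnC fnf.
have mf : measurable_fun `[0, T] f.
  by apply: measurable_fun_cvg mfn _ => x /=; rewrite in_itv/=; exact: fnf.
have fC t : 0 <= t <= T -> `|f t| <= C.
  move=> tT; apply: (cvgr_to_le (cvg_norm (fnf t tT))).
  by apply: nearW => n; exact: fnC.
have bf : rbdmeas f by split=> //; exists C.
split=> // t /andP[t0 tT].
have inT x : `[0, t]%classic x -> 0 <= x <= T.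
  by rewrite /= in_itv/= => /andP[-> /le_trans]; apply.
have sub : `[0, t] `<=` `[0, T] by apply: subset_itvl; rewrite bnd_simp.
have m1 n : measurable_fun `[0, t] (fun x => (fn n x)%:E).
  by apply/measurable_EFinP; exact: measurable_funS (mfn n).
have m2 : measurable_fun `[0, t] (fun x => (f x)%:E).
  by apply/measurable_EFinP; exact: measurable_funS mf.
case: (@dominated_convergence _ _ R mu `[0, t] (measurable_itv _) _ _ (fun=> C%:E) m1 m2 _
    (rbdmeas_integrable (rbdmeas_cst C) tT) _).
- apply: aeW => x xt; apply: cvg_EFin; first exact: nearW.
  by apply: fnf; exact: inT.
- by apply: aeW => x n xt; rewrite lee_fin; apply: fnC; exact: inT.
move=> _ _ H; apply: fine_cvg; rewrite fineK; first exact: H.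
by apply: integrable_fin_num => //; exact: rbdmeas_integrable.
Qed.
End rprim.

(** * Complex-valued primitives and limits *)

Section cnorm.
Variable R : realType.
Implicit Types (z u : R[i]).

Definition cabs z : R := Num.sqrt (abs2 z).

Lemma abs2_ge0 z : 0 <= abs2 z. Proof. by rewrite addr_ge0 ?sqr_ge0. Qed.
Lemma cabs_ge0 z : 0 <= cabs z. Proof. exact: sqrtr_ge0. Qed.
Lemma cabs_sq z : cabs z ^+ 2 = abs2 z. Proof. by rewrite sqr_sqrtr ?abs2_ge0. Qed.
Lemma cabsE z : cabs z = Normc.normc z. Proof. by case: z. Qed.
Lemma cabsM z u : cabs (z * u) = cabs z * cabs u. Proof. by rewrite !cabsE Normc.normcM. Qed.
Lemma cabsD z u : cabs (z + u) <= cabs z + cabs u.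
Proof. by rewrite !cabsE; exact: le_normcD. Qed.
Lemma cabsN z : cabs (- z) = cabs z. Proof. by rewrite !cabsE normcN. Qed.
Lemma cabsB z u : cabs (z - u) <= cabs z + cabs u. Proof. by rewrite -(cabsN u) cabsD. Qed.
Lemma cabs0 : cabs 0 = 0. Proof. by rewrite cabsE Normc.normc0. Qed.
Lemma cabs1 : cabs 1 = 1. Proof. by rewrite cabsE Normc.normc1. Qed.
Lemma cabsV z : cabs (z^-1) = (cabs z)^-1. Proof. by rewrite !cabsE Normc.normcV. Qed.
Lemma cabs_real (x : R) : cabs (x%:C) = `|x|.
Proof. by rewrite /cabs /abs2/= expr0n addr0 sqrtr_sqr. Qed.
Lemma cabs_i : cabs 'i = 1. Proof. by rewrite /cabs /abs2/= expr0n expr1n add0r sqrtr1. Qed.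
Lemma cabs_conj z : cabs (z^*) = cabs z.
Proof. by case: z => a b; rewrite /cabs /abs2/= sqrrN. Qed.
Lemma cabs_expi th : cabs (expi th) = 1 :> R.
Proof. by rewrite /cabs /abs2/= cos2Dsin2 sqrtr1. Qed.
Lemma sqr_normr (x : R) : `|x| ^+ 2 = x ^+ 2. Proof. by rewrite real_normK ?num_real. Qed.
Lemma cabs_Re z : `|complex.Re z| <= cabs z.
Proof.
by rewrite -(@ler_pXn2r _ 2)// ?nnegrE ?cabs_ge0// cabs_sq sqr_normr lerDl sqr_ge0.
Qed.
Lemma cabs_Im z : `|complex.Im z| <= cabs z.
Proof.
by rewrite -(@ler_pXn2r _ 2)// ?nnegrE ?cabs_ge0// cabs_sq sqr_normr lerDr sqr_ge0.
Qed.
Lemma cabs_ReIm z : cabs z <= `|complex.Re z| + `|complex.Im z|.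
Proof.
have := normr_ge0 (complex.Re z); have := normr_ge0 (complex.Im z) => a b.
rewrite -(@ler_pXn2r _ 2)// ?nnegrE ?cabs_ge0 ?addr_ge0// cabs_sq /abs2.
rewrite -[X in X + _]sqr_normr -[X in _ + X]sqr_normr; nra.
Qed.
Lemma cabs_eq0 z : cabs z = 0 -> z = 0. Proof. by rewrite cabsE => /Normc.eq0_normc. Qed.
Lemma cabs_le z C : 0 <= C -> (cabs z <= C) = (abs2 z <= C ^+ 2).
Proof. by move=> C0; rewrite -cabs_sq ler_pXn2r ?nnegrE ?cabs_ge0. Qed.
Lemma cabs_sum (I : Type) (s : seq I) (F : I -> R[i]) :
  cabs (\sum_(i <- s) F i) <= \sum_(i <- s) cabs (F i).
Proof.
elim: s => [|i s IH]; first by rewrite !big_nil cabs0.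
by rewrite !big_cons; apply: le_trans (cabsD _ _) _; rewrite lerD2l.
Qed.

Lemma ReD z u : complex.Re (z + u) = complex.Re z + complex.Re u. Proof. by case: z; case: u. Qed.
Lemma ImD z u : complex.Im (z + u) = complex.Im z + complex.Im u. Proof. by case: z; case: u. Qed.
Lemma ReN z : complex.Re (- z) = - complex.Re z. Proof. by case: z. Qed.
Lemma ImN z : complex.Im (- z) = - complex.Im z. Proof. by case: z. Qed.
Lemma ReM z u : complex.Re (z * u) = complex.Re z * complex.Re u - complex.Im z * complex.Im u.
Proof. by case: z; case: u. Qed.
Lemma ImM z u : complex.Im (z * u) = complex.Re z * complex.Im u + complex.Im z * complex.Re u.
Proof. by case: z => a b; case: u => c d /=; rewrite [b * c]mulrC. Qed.
Lemma complex_eq z u : complex.Re z = complex.Re u -> complex.Im z = complex.Im u -> z = u.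
Proof. by case: z; case: u => a b c d /= -> ->. Qed.
Lemma Re_sum (I : Type) (s : seq I) (F : I -> R[i]) :
  complex.Re (\sum_(i <- s) F i) = \sum_(i <- s) complex.Re (F i).
Proof. by elim: s => [|i s IH]; rewrite ?big_nil// !big_cons ReD IH. Qed.
Lemma Im_sum (I : Type) (s : seq I) (F : I -> R[i]) :
  complex.Im (\sum_(i <- s) F i) = \sum_(i <- s) complex.Im (F i).
Proof. by elim: s => [|i s IH]; rewrite ?big_nil// !big_cons ImD IH. Qed.

Lemma expiD (a b : R) : expi (a + b) = expi a * expi b.
Proof.
by apply: complex_eq; rewrite ?ReM ?ImM/= ?cosD// sinD addrC.
Qed.
Lemma expi_conj (a : R) : (expi a)^* = expi (- a).
Proof. by rewrite /expi/= cosN sinN. Qed.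

(** Componentwise, to match the limits in the definition of [conv]. *)
Definition ccvg (u : nat -> R[i]) (l : R[i]) :=
  (fun n => complex.Re (u n)) @ \oo --> complex.Re l /\
  (fun n => complex.Im (u n)) @ \oo --> complex.Im l.

Lemma ccvg_cst l : ccvg (fun=> l) l. Proof. by split; exact: cvg_cst. Qed.
Lemma ccvgD (u v : nat -> R[i]) l m : ccvg u l -> ccvg v m -> ccvg (fun n => u n + v n) (l + m).
Proof.
move=> [ul1 ul2] [vm1 vm2]; split.
- by rewrite ReD; under eq_fun do rewrite ReD; exact: cvgD.
- by rewrite ImD; under eq_fun do rewrite ImD; exact: cvgD.
Qed.
Lemma ccvgN (u : nat -> R[i]) l : ccvg u l -> ccvg (fun n => - u n) (- l).
Proof.
move=> [ul1 ul2]; split.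
- by rewrite ReN; under eq_fun do rewrite ReN; exact: cvgN.
- by rewrite ImN; under eq_fun do rewrite ImN; exact: cvgN.
Qed.
Lemma ccvgM (u v : nat -> R[i]) l m : ccvg u l -> ccvg v m -> ccvg (fun n => u n * v n) (l * m).
Proof.
move=> [ul1 ul2] [vm1 vm2]; split.
- rewrite ReM; under eq_fun do rewrite ReM; apply: cvgB; exact: cvgM.
- rewrite ImM; under eq_fun do rewrite ImM; apply: cvgD; exact: cvgM.
Qed.
Lemma ccvg_sum (I : Type) (s : seq I) (u : I -> nat -> R[i]) (l : I -> R[i]) :
  (forall i, ccvg (u i) (l i)) ->
  ccvg (fun n => \sum_(i <- s) u i n) (\sum_(i <- s) l i).
Proof.
move=> ul; elim: s => [|i s IH].
  by rewrite big_nil; under eq_fun do rewrite big_nil; exact: ccvg_cst.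
by rewrite big_cons; under eq_fun do rewrite big_cons; exact: ccvgD.
Qed.
Lemma ccvg_cabs_le (u : nat -> R[i]) l C : (forall n, cabs (u n) <= C) -> ccvg u l -> cabs l <= C.
Proof.
move=> uC [u1 u2].
have C0 : 0 <= C by apply: le_trans (uC 0%N); exact: cabs_ge0.
rewrite cabs_le// /abs2.
have h : (fun n => abs2 (u n)) @ \oo --> complex.Re l ^+ 2 + complex.Im l ^+ 2.
  by rewrite /abs2 !expr2; apply: cvgD; apply: cvgM.
apply: (cvgr_to_le h); apply: nearW => n.
by rewrite -cabs_le.
Qed.
Lemma ccvg_unique (u : nat -> R[i]) l m : ccvg u l -> ccvg u m -> l = m.
Proof. by move=> [a b] [c d]; apply: complex_eq; [apply: (cvg_unique _ a c)|apply: (cvg_unique _ b d)]. Qed.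
Lemma ccvg_eventually_cabs (u : nat -> R[i]) l (e : R) : ccvg u l -> 0 < e -> \forall n \near \oo, cabs (u n - l) <= e.
Proof.
move=> [a b] e0; have e2 : 0 < e / 2 by rewrite divr_gt0.
near=> n.
apply: le_trans (cabs_ReIm _) _; rewrite ReD ImD ReN ImN.
have -> : e = e / 2 + e / 2 by lra.
apply: lerD; rewrite distrC.
- by near: n; move/cvgrPdist_le: a; apply.
- by near: n; move/cvgrPdist_le: b; apply.
Unshelve. all: by end_near. Qed.
Lemma ccvgP (u : nat -> R[i]) l : (forall e, 0 < e -> \forall n \near \oo, cabs (u n - l) <= e) -> ccvg u l.
Proof.
move=> H; split; apply/cvgrPdist_le => e e0; near=> n.
- rewrite distrC -ReN -ReD; apply: le_trans (cabs_Re _) _; by near: n; exact: H.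
- rewrite distrC -ImN -ImD; apply: le_trans (cabs_Im _) _; by near: n; exact: H.
Unshelve. all: by end_near. Qed.

Lemma L2_cabs_add (w : int -> R) (x y : int -> R[i]) (A B : R) : (forall k, 0 <= w k) ->
  L2 (fun k => w k * cabs (x k)) A -> L2 (fun k => w k * cabs (y k)) B ->
  L2 (fun k => w k * cabs (x k + y k)) (A + B).
Proof.
move=> w0 lx ly; have A0 := L2_ge0 lx; have B0 := L2_ge0 ly.
split=> [k| |r ur]; [by rewrite mulr_ge0// cabs_ge0|by rewrite addr_ge0|].
apply: (@le_trans _ _ (\sum_(k <- r) ((w k * cabs (x k)) ^+ 2 + (w k * cabs (y k)) ^+ 2 +
   2 * ((w k * cabs (x k)) * (w k * cabs (y k)))))).
  apply: ler_sum => k _; have h := ler_wpM2l (w0 k) (cabsD (x k) (y k)).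
  apply: (@le_trans _ _ ((w k * (cabs (x k) + cabs (y k))) ^+ 2)).
    by rewrite lerXn2r ?nnegrE ?mulr_ge0 ?addr_ge0 ?cabs_ge0.
  by apply: ler_of_eq; ring.
rewrite !big_split/= -mulr_sumr.
have [_ _ /(_ r ur) h1] := lx; have [_ _ /(_ r ur) h2] := ly; have h3 := L2_cs ur lx ly.
have -> : (A + B) ^+ 2 = A ^+ 2 + B ^+ 2 + 2 * (A * B) by ring.
by apply: lerD; [exact: lerD|rewrite ler_wpM2l].
Qed.

Lemma L2_cabs_opp (w : int -> R) (x : int -> R[i]) (A : R) :
  L2 (fun k => w k * cabs (x k)) A -> L2 (fun k => w k * cabs (- x k)) A.
Proof. by under [X in _ -> L2 X _]eq_fun do rewrite cabsN. Qed.

Lemma L2_cabs_sub (x y : int -> R[i]) (A B : R) :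
  L2 (fun k => cabs (x k)) A -> L2 (fun k => cabs (y k)) B -> L2 (fun k => cabs (x k - y k)) (A + B).
Proof.
have one1 (z : int -> R[i]) : (fun k => cabs (z k)) = (fun k => 1 * cabs (z k)).
  by apply/funext => k; rewrite mul1r.
by rewrite !one1 => lx /L2_cabs_opp; exact: L2_cabs_add.
Qed.
End cnorm.

Section cprim.
Variables (R : realType) (T : R).
Hypothesis T0 : 0 <= T.
Implicit Types (f g F G : R -> R[i]).

Definition cbdmeas f := rbdmeas T (fun t => complex.Re (f t)) /\ rbdmeas T (fun t => complex.Im (f t)).

Definition cprim F f := rprim T (fun t => complex.Re (F t)) (fun t => complex.Re (f t)) /\
  rprim T (fun t => complex.Im (F t)) (fun t => complex.Im (f t)).

Lemma cbdmeasD f g : cbdmeas f -> cbdmeas g -> cbdmeas (fun t => f t + g t).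
Proof.
move=> [a b] [c d]; split; under eq_fun do rewrite ?ReD ?ImD; exact: rbdmeasD.
Qed.
Lemma cbdmeasM f g : cbdmeas f -> cbdmeas g -> cbdmeas (fun t => f t * g t).
Proof.
move=> [a b] [c d]; split; under eq_fun do rewrite ?ReM ?ImM; apply: rbdmeasD; try apply: rbdmeasN; exact: rbdmeasM.
Qed.
Lemma cbdmeas_cst c : cbdmeas (fun=> c). Proof. by split; exact: rbdmeas_cst. Qed.
Lemma cbdmeas_sum (I : Type) (s : seq I) (u : I -> R -> R[i]) : (forall i, cbdmeas (u i)) ->
  cbdmeas (fun t => \sum_(i <- s) u i t).
Proof.
move=> ul; elim: s => [|i s IH].
  by under eq_fun do rewrite big_nil; exact: cbdmeas_cst.
by under eq_fun do rewrite big_cons; exact: cbdmeasD.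
Qed.
Lemma cprimD F f G g : cprim F f -> cprim G g -> cprim (fun t => F t + G t) (fun t => f t + g t).
Proof.
move=> [a b] [c d]; split.
- by apply: (eq_rprim _ _ (rprimD a c)) => t _; rewrite ReD.
- by apply: (eq_rprim _ _ (rprimD b d)) => t _; rewrite ImD.
Qed.
Lemma cprimN F f : cprim F f -> cprim (fun t => - F t) (fun t => - f t).
Proof.
move=> [a b]; split.
- by apply: (eq_rprim _ _ (rprimN a)) => t _; rewrite ReN.
- by apply: (eq_rprim _ _ (rprimN b)) => t _; rewrite ImN.
Qed.
Lemma cprim_cst c : cprim (fun=> c) (fun=> 0).
Proof. by split; exact: rprim_cst. Qed.
Lemma cprimM F f G g : cprim F f -> cprim G g ->
  cprim (fun t => F t * G t) (fun t => f t * G t + F t * g t).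
Proof.
move=> [a b] [c d]; split.
- apply: (eq_rprim _ _ (rprimD (rprimM T0 a c) (rprimN (rprimM T0 b d)))) => t _; rewrite ?ReD !ReM//; ring.
- apply: (eq_rprim _ _ (rprimD (rprimM T0 a d) (rprimM T0 b c))) => t _; rewrite ?ImD !ImM//; ring.
Qed.
Lemma eq_cprim F F' f f' : (forall t, 0 <= t <= T -> F t = F' t) ->
  (forall t, 0 <= t <= T -> f t = f' t) -> cprim F f -> cprim F' f'.
Proof.
move=> FF ff [a b]; split.
- by apply: (eq_rprim _ _ a) => t tT; rewrite ?FF ?ff.
- by apply: (eq_rprim _ _ b) => t tT; rewrite ?FF ?ff.
Qed.
Lemma cprimZ c F f : cprim F f -> cprim (fun t => c * F t) (fun t => c * f t).
Proof.
move=> Ff; apply: (eq_cprim _ _ (cprimM (cprim_cst c) Ff)) => t _ //.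
by rewrite mul0r add0r.
Qed.
Lemma cprim_sum (I : Type) (s : seq I) (F f : I -> R -> R[i]) : (forall i, cprim (F i) (f i)) ->
  cprim (fun t => \sum_(i <- s) F i t) (fun t => \sum_(i <- s) f i t).
Proof.
move=> ul; elim: s => [|i s IH].
  by under eq_fun do rewrite big_nil; under [X in cprim _ X]eq_fun do rewrite big_nil; exact: cprim_cst.
by under eq_fun do rewrite big_cons; under [X in cprim _ X]eq_fun do rewrite big_cons; exact: cprimD.
Qed.
Lemma cprim_cbdmeas F f : cprim F f -> cbdmeas F.
Proof. by move=> [a b]; split; exact: rprim_rbdmeas a || exact: rprim_rbdmeas b. Qed.
Lemma cprim_deriv_cbdmeas F f : cprim F f -> cbdmeas f.
Proof. by move=> [[a _] [b _]]. Qed.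
Lemma cprim_int f : cbdmeas f -> cprim (fun t => cintegral t f) f.
Proof. by move=> [a b]; split; exact: rprim_int. Qed.
Lemma cprimE F f t : cprim F f -> 0 <= t <= T -> F t = F 0 + cintegral t f.
Proof.
move=> [[_ a] [_ b]] tT; apply: complex_eq; first by rewrite ReD; exact: a.
by rewrite ImD; exact: b.
Qed.

Lemma cintegral_eq f g t : (forall x, 0 <= x <= t -> f x = g x) -> cintegral t f = cintegral t g.
Proof. by move=> fg; apply: complex_eq; apply: rint_eq => x /fg ->. Qed.

Lemma cintegral0 f : cintegral 0 f = 0.
Proof. by apply: complex_eq; exact: rint0. Qed.

Lemma cintegralD f g t : cbdmeas f -> cbdmeas g -> 0 <= t <= T ->
  cintegral t (fun x => f x + g x) = cintegral t f + cintegral t g.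
Proof.
move=> bf bg tT; have := cprimE (cprimD (cprim_int bf) (cprim_int bg)) tT.
by rewrite !cintegral0 !add0r => ->.
Qed.

(** The factor 2 comes from treating real and imaginary parts separately. *)
Lemma cprim_lip F f a b C : cprim F f -> 0 <= a -> a <= b -> b <= T ->
  (forall x, a <= x <= b -> cabs (f x) <= C) -> cabs (F b - F a) <= 2 * C * (b - a).
Proof.
move=> [Fa Fb] a0 ab bT fC.
apply: le_trans (cabs_ReIm _) _; rewrite ReD ImD ReN ImN.
rewrite -mulrA mulrDl mul1r; apply: lerD.
- by apply: (rprim_lip Fa a0 ab bT) => x xab; apply: le_trans (cabs_Re _) (fC _ xab).
- by apply: (rprim_lip Fb a0 ab bT) => x xab; apply: le_trans (cabs_Im _) (fC _ xab).
Qed.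

Lemma cprim_expi (a : R) : cprim (fun t => expi (a * t)) (fun t => ('i * a%:C) * expi (a * t)).
Proof.
have ca x : {for x, continuous (fun t : R => a * t)} by apply: continuousM; [exact: cvg_cst|exact: cvg_id].
split.
- apply: (@eq_rprim _ _ (fun t => cos (a * t)) _ (fun t => - a * sin (a * t))) => //.
    by move=> t _; rewrite !ReM ImM /=; ring.
  apply: rprim_derive => //.
  + move=> x; apply: is_derive_eq; rewrite /GRing.scale/=; ring.
  + move=> x; apply: cvgM; first exact: cvg_cst.
    by apply: (continuous_comp (f := fun t : R => a * t)); [exact: ca|exact: continuous_sin].
- apply: (@eq_rprim _ _ (fun t => sin (a * t)) _ (fun t => a * cos (a * t))) => //.
    by move=> t _; rewrite !ImM ReM /=; ring.
  apply: rprim_derive => //.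
  + move=> x; apply: is_derive_eq; rewrite /GRing.scale/=; ring.
  + move=> x; apply: cvgM; first exact: cvg_cst.
    by apply: (continuous_comp (f := fun t : R => a * t)); [exact: ca|exact: continuous_cos].
Qed.

Lemma cdct (fn : nat -> R -> R[i]) f C : (forall n, cbdmeas (fn n)) ->
  (forall n t, 0 <= t <= T -> cabs (fn n t) <= C) ->
  (forall t, 0 <= t <= T -> ccvg (fun n => fn n t) (f t)) ->
  cbdmeas f /\ forall t, 0 <= t <= T -> ccvg (fun n => cintegral t (fn n)) (cintegral t f).
Proof.
move=> bf fC fnf.
have [b1 c1] := rdct (fun n => (bf n).1.1) (fun n t tT => le_trans (cabs_Re _) (fC n t tT))
  (fun t tT => (fnf t tT).1).
have [b2 c2] := rdct (fun n => (bf n).2.1) (fun n t tT => le_trans (cabs_Im _) (fC n t tT))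
  (fun t tT => (fnf t tT).2).
by split=> // t tT; split; [exact: c1|exact: c2].
Qed.

(** The passage from finite to infinite sums: C may be any dominating constant, whereas the useful
    bound B is uniform in n and survives the limit. *)
Lemma cdct_le (fn : nat -> R -> R[i]) f C a b B : (forall n, cbdmeas (fn n)) ->
  (forall n t, 0 <= t <= T -> cabs (fn n t) <= C) ->
  (forall t, 0 <= t <= T -> ccvg (fun n => fn n t) (f t)) ->
  0 <= a <= T -> 0 <= b <= T ->
  (forall n, cabs (cintegral b (fn n) - cintegral a (fn n)) <= B) ->
  cabs (cintegral b f - cintegral a f) <= B.
Proof.
move=> bf fC fnf aT bT H; have [_ c] := cdct bf fC fnf.
by apply: ccvg_cabs_le H _; apply: ccvgD; [exact: c|apply: ccvgN; exact: c].
Qed.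
End cprim.

(** * Trilinear and bilinear estimates *)

Section trilinear.
Variables (R : realType) (T : R) (w : int -> R) (m a b : R).
Hypotheses (T0 : 0 <= T) (a0 : 0 <= a) (bT : b <= T) (m0 : 0 <= m).
Hypotheses (w0 : forall k, 0 <= w k) (wD : forall i j, w (i + j) <= w i + w j).
Notation C := R[i].
Notation T3 := (int * int * int)%type.
Notation e := (@inv_abs R).

(* On [[a, b]], [A] and [W] bound [f] in l^2 and in weighted l^2; the bounds on [df] are those that
   a quadratic nonlinearity in such families satisfies. *)
Definition fam (f df : R -> int -> C) (A W : R) :=
  (forall k, cprim T (fun t => f t k) (fun t => df t k)) /\
  forall t, a <= t <= b ->
  [/\ L2 (fun k => cabs (f t k)) A, L2 (fun k => w k * cabs (f t k)) W,
      lin_growth (fun k => cabs (df t k)) (m * A) & lin_growth (fun k => w k * cabs (df t k)) (m * W)].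

Definition phase3 (p : T3) : R :=
  (3 * ((p.1.2 + p.2) * (p.2 + idx3 p) * (p.1.2 + idx3 p)))%:~R.

(** * Integration by parts in a finite trilinear form *)

Section tri.
Variables (f df g dg h dh : R -> int -> C) (Af Wf Ag Wg Ah Wh : R).
Hypotheses (fF : fam f df Af Wf) (gG : fam g dg Ag Wg) (hH : fam h dh Ah Wh).
Variables (c : int -> C) (al : int -> R) (mu : T3 -> C) (P : seq T3) (N : nat).
Hypotheses (al1 : L2 al 1) (cal : forall k, cabs (c k) <= w k * al k).
Hypotheses (mue : forall p, cabs (mu p) <= e p.1.2) (mu0 : forall p, p.1.1 = p.1.2 -> mu p = 0).
Hypotheses (uP : uniq P) (N0 : (0 < N)%N).

(** [c] is a test family and [mu] the symbol left by the first integration by parts: of its inverses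
    1 / (|k1| |k - k1|) the second is spent on the factor k - k1 of the substituted equation, and
    that factor also makes [mu] vanish at k = k1, that is on the resonance k2 + k3 = 0. *)
Definition tri_int (t : R) : C := \sum_(p <- P)
  c p.1.1 * mu p * (expi (phase3 p * t) * (f t p.1.2 * (g t p.2 * h t (idx3 p)))).

Let Y := Wf * Ag * Ah + Af * Wg * Ah + Af * Ag * Wh.

(* Off [high], either the phase vanishes or |k1 + k2| <= N; both are covered by [Knear]. *)
Let high (p : T3) := (phase3 p != 0) && [|| (N < absz (p.1.2 + p.2)%R)%N,
  (N < absz (p.2 + idx3 p)%R)%N | (N < absz (p.1.2 + idx3 p)%R)%N].

Let co (p : T3) : C := if high p then c p.1.1 * mu p / ('i * (phase3 p)%:C) else 0.

Let bd (t : R) : C := \sum_(p <- P)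
  co p * (expi (phase3 p * t) * (f t p.1.2 * (g t p.2 * h t (idx3 p)))).

Let dbd (t : R) : C := \sum_(p <- P)
  co p * ('i * (phase3 p)%:C * expi (phase3 p * t) * (f t p.1.2 * (g t p.2 * h t (idx3 p))) +
  expi (phase3 p * t) * (df t p.1.2 * (g t p.2 * h t (idx3 p)) +
   f t p.1.2 * (dg t p.2 * h t (idx3 p) + g t p.2 * dh t (idx3 p)))).

Let bd_prim : cprim T bd dbd.
Proof.
apply: cprim_sum => p; apply: (cprimZ T0); apply: (cprimM T0); first exact: cprim_expi.
apply: (cprimM T0); first exact: fF.1.
by apply: (cprimM T0); [exact: gG.1|exact: hH.1].
Qed.

Let tri_cbdmeas : cbdmeas T tri_int.
Proof.
apply: cbdmeas_sum => p; apply: cbdmeasM; first exact: cbdmeas_cst.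
apply: cbdmeasM; first exact: (cprim_cbdmeas T0 (cprim_expi _ _)).
apply: cbdmeasM; first exact: (cprim_cbdmeas T0 (fF.1 _)).
by apply: cbdmeasM; [exact: (cprim_cbdmeas T0 (gG.1 _))|exact: (cprim_cbdmeas T0 (hH.1 _))].
Qed.

(** A pair sum exceeding N supplies 1 / N; of the two other inverse pair sums one is kept and one is
    bounded by 1. *)
Let Khi (p : T3) : R := N%:R^-1 * (e p.1.2 * e (p.2 + idx3 p) + e p.1.2 * e (p.1.2 + p.2)).

Let delta (k : int) : R := (k == 0)%:R.

Let L2_delta : L2 delta 1.
Proof.
split=> [k|//|s us]; first by rewrite ler0n.
rewrite /delta; have -> : \sum_(k <- s) ((k == 0)%:R : R) ^+ 2 = \sum_(k <- s | k == 0) 1.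
  by rewrite [RHS]big_mkcond; apply: eq_bigr => k _; case: eqP => _; rewrite ?expr1n ?expr0n.
rewrite big_const_seq iter_addr_0 expr1n.
have : (count (pred1 (0 : int)) s <= 1)%N by rewrite count_uniq_mem//; case: (_ \in _).
by move=> h1; rewrite -[leRHS]/(1%:R : R) ler_nat.
Qed.

(** The resonances k1 + k2 = 0 and k1 + k3 = 0 are recorded by a Kronecker delta, an l^2 function of
    norm 1, so that the general estimates apply to them. For 0 < |k1 + k2| <= N one has 1 <= N / |k1
    + k2|. *)
Let Knear (p : T3) : R := e p.1.2 * delta (p.1.2 + p.2) + e p.1.2 * delta (p.1.2 + idx3 p) +
   N%:R * (e p.1.2 * e (p.1.2 + p.2)).

Let L2e := L2_inv_abs R.
Let e0 k := @inv_abs_ge0 R k.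
Let gL := @nonneg_norm_L2 R.
Let gD := @nonneg_norm_lin_growth R.

Let est_hi : tri_est (@L2 R) (@L2 R) (@L2 R) Khi (N%:R^-1 * 8).
Proof.
apply: tri_estZ; first by rewrite invr_ge0.
have -> : 8 = 2 * 2 + 2 * 2 :> R by ring.
by apply: tri_estD; [exact: tri_est23|exact: tri_est12].
Qed.

Let est_near : tri_est (@L2 R) (@L2 R) (@L2 R) Knear (4 + N%:R * 4).
Proof.
have -> : 4 + N%:R * 4 = 2 * 1 + 2 * 1 + N%:R * (2 * 2) :> R by ring.
apply: tri_estD; first by apply: tri_estD; [exact: tri_est12|exact: tri_est13].
by apply: tri_estZ => //; exact: tri_est12.
Qed.

Let NV0 : 0 < N%:R :> R. Proof. by rewrite ltr0n. Qed.

Let e_high k : (N < `|k|)%N -> e k <= N%:R^-1.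
Proof. by move=> Nk; rewrite lef_pV2 ?posrE ?ltr0n ?(leq_ltn_trans _ Nk)// ler_nat ltnW. Qed.

Let e_low k : k != 0 -> (`|k| <= N)%N -> 1 <= N%:R * e k.
Proof.
move=> k0 kN; rewrite /inv_abs ler_pdivlMr ?ltr0n ?absz_gt0// mul1r ler_nat//.
Qed.

Let al0 k : 0 <= al k. Proof. by case: al1. Qed.

Let phase3V p : `|phase3 p|^-1 <= e (p.1.2 + p.2) * e (p.2 + idx3 p) * e (p.1.2 + idx3 p).
Proof.
rewrite /phase3 /inv_abs -!invfM -!natrM -!abszM.
move: ((p.1.2 + p.2) * (p.2 + idx3 p) * (p.1.2 + idx3 p)) => x.
rewrite intrM normrM invfM.
have -> : `|x%:~R| = (`|x|%N)%:R :> R by rewrite -intr_norm -abszE.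
rewrite ler_piMl ?invr_ge0//.
have -> : (3 : int)%:~R = 3%:R :> R by [].
by rewrite ger0_norm// invf_le1// ?ltr0n// ler1n.
Qed.

Let cabs_co p : cabs (co p) <= phase_kernel R p * (w p.1.1 * al p.1.1).
Proof.
rewrite /co; case: ifP => _; last by rewrite cabs0 !mulr_ge0 ?phase_kernel_ge0.
rewrite !cabsM cabsV cabsM cabs_i mul1r cabs_real mulrC /phase_kernel.
have := ler_pM (cabs_ge0 _) (cabs_ge0 _) (cal p.1.1) (mue p).
have i0 : 0 <= `|phase3 p|^-1 by rewrite invr_ge0.
move=> /(ler_pM i0 (mulr_ge0 (cabs_ge0 _) (cabs_ge0 _)) (phase3V p)) /le_trans; apply.
by apply: ler_of_eq; ring.
Qed.

Let cabs_co_hi p : cabs (co p) <= Khi p * (w p.1.1 * al p.1.1).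
Proof.
have wa : 0 <= w p.1.1 * al p.1.1 by rewrite mulr_ge0.
have Khi0 : 0 <= Khi p by rewrite mulr_ge0 ?invr_ge0// addr_ge0// mulr_ge0.
have [hp|nhp] := boolP (high p); last first.
  by rewrite /co (negbTE nhp) cabs0 mulr_ge0.
apply: le_trans (cabs_co p) _; rewrite ler_wpM2r// /phase_kernel /Khi.
have e1 := @inv_abs_le1 R; have NV : 0 <= N%:R^-1 :> R by rewrite invr_ge0.
have M3 x y z : 0 <= x -> 0 <= y <= N%:R^-1 -> 0 <= z <= 1 -> x * y * z <= N%:R^-1 * x.
  move=> x0 /andP[y0 yN] /andP[z0 z1]; rewrite [leRHS]mulrC -[leRHS]mulr1.
  by rewrite ler_pM ?mulr_ge0// ler_wpM2l.
case/andP: hp => _ /or3P[] /e_high hi; rewrite mulrDr.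
- apply: ler_wpDr; first by rewrite !mulr_ge0.
  by rewrite [X in X * _]mulrAC; apply: M3; rewrite ?mulr_ge0 ?e0 ?hi ?e1.
- apply: ler_wpDl; first by rewrite !mulr_ge0.
  by apply: M3; rewrite ?mulr_ge0 ?e0 ?hi ?e1.
- apply: ler_wpDr; first by rewrite !mulr_ge0.
  rewrite [X in X * _]mulrAC [leLHS]mulrAC; apply: M3; rewrite ?mulr_ge0 ?e0 ?hi ?e1//.
Qed.

Let Khi0 p : 0 <= Khi p. Proof. by rewrite mulr_ge0 ?invr_ge0// addr_ge0// mulr_ge0. Qed.
Let Knear0 p : 0 <= Knear p.
Proof. by rewrite !addr_ge0 ?mulr_ge0// ler0n. Qed.

Let bd_le t : a <= t <= b -> cabs (bd t) <= N%:R^-1 * 8 * Y.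
Proof.
move=> tab.
have [f1 f2 _ _] := fF.2 t tab; have [g1 g2 _ _] := gG.2 t tab; have [h1 h2 _ _] := hH.2 t tab.
apply: le_trans (cabs_sum _ _) _.
have := tri_est_weight gL gL gL w0 wD Khi0 est_hi al1 f1 g1 h1 f2 g2 h2 uP.
rewrite mul1r; apply: le_trans; apply: ler_sum => p _.
rewrite !cabsM cabs_expi mul1r.
have := ler_wpM2r (mulr_ge0 (cabs_ge0 (f t p.1.2)) (mulr_ge0 (cabs_ge0 (g t p.2)) (cabs_ge0 (h t (idx3 p))))) (cabs_co_hi p).
move=> /le_trans; apply; apply: ler_of_eq; ring.
Qed.

(** Where [high] holds, the derivative of the oscillating factor in [dbd] cancels the integrand, and
    only terms with a differentiated factor remain. Elsewhere [co] is 0 and the integrand itself is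
    estimated. *)
Let term_le t p : a <= t <= b ->
  cabs (c p.1.1 * mu p * (expi (phase3 p * t) * (f t p.1.2 * (g t p.2 * h t (idx3 p)))) -
  co p * ('i * (phase3 p)%:C * expi (phase3 p * t) * (f t p.1.2 * (g t p.2 * h t (idx3 p))) +
  expi (phase3 p * t) * (df t p.1.2 * (g t p.2 * h t (idx3 p)) +
   f t p.1.2 * (dg t p.2 * h t (idx3 p) + g t p.2 * dh t (idx3 p))))) <=
  Knear p * (w p.1.1 * al p.1.1 * cabs (f t p.1.2) * cabs (g t p.2) * cabs (h t (idx3 p))) +
  (phase_kernel R p * (w p.1.1 * al p.1.1 * cabs (df t p.1.2) * cabs (g t p.2) * cabs (h t (idx3 p))) +
  phase_kernel R p * (w p.1.1 * al p.1.1 * cabs (f t p.1.2) * cabs (dg t p.2) * cabs (h t (idx3 p))) +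
  phase_kernel R p * (w p.1.1 * al p.1.1 * cabs (f t p.1.2) * cabs (g t p.2) * cabs (dh t (idx3 p)))).
Proof.
move=> tab; set E := expi _; have nE : cabs E = 1 by exact: cabs_expi.
have pk := phase_kernel_ge0 R p.
have wa k : 0 <= w k * al k by rewrite mulr_ge0.
have [hp|nhp] := boolP (high p); last first.
  rewrite /co (negbTE nhp) mul0r subr0; apply: ler_wpDr.
    by rewrite !addr_ge0// !mulr_ge0// cabs_ge0.
  rewrite !cabsM nE mul1r.
  have [pp|pp] := eqVneq p.1.1 p.1.2.
    by rewrite mu0// cabs0 mulr0 mul0r !mulr_ge0// cabs_ge0.
  have K1 : cabs (c p.1.1) * cabs (mu p) <= Knear p * (w p.1.1 * al p.1.1).
    rewrite [leRHS]mulrC; apply: ler_pM; rewrite ?cabs_ge0//.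
    apply: le_trans (mue p) _; rewrite /Knear.
    have -> : N%:R * (e p.1.2 * e (p.1.2 + p.2)) = e p.1.2 * (N%:R * e (p.1.2 + p.2)) by ring.
    rewrite -!mulrDr ler_peMr//.
    move: nhp; rewrite negb_and negbK !negb_or -!leqNgt => /orP[|/and3P[l1 l2 l3]].
      rewrite /phase3 intr_eq0 mulf_eq0/= !mulf_eq0 => /orP[/orP[z|z]|z].
      - by rewrite /delta z -addrA lerDl addr_ge0 ?mulr_ge0// ler0n.
      (* k2 + k3 = 0 means k = k1, where [mu] vanishes; this case is already settled. *)
      - exfalso; move/eqP: z => z; move/eqP: pp; apply.
        have E1 : p.1.1 = p.1.2 + (p.2 + idx3 p) by rewrite /idx3; ring.
        by rewrite E1 z addr0.
      - by rewrite /delta z addrAC lerDr addr_ge0 ?mulr_ge0// ler0n.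
    have [z|z] := eqVneq (p.1.2 + p.2) 0.
      by rewrite /delta z eqxx -addrA lerDl addr_ge0 ?mulr_ge0// ler0n.
    by apply: le_trans (e_low z l1) _; rewrite lerDr addr_ge0// ler0n.
  have := ler_wpM2r (mulr_ge0 (cabs_ge0 (f t p.1.2)) (mulr_ge0 (cabs_ge0 (g t p.2)) (cabs_ge0 (h t (idx3 p))))) K1.
  move=> /le_trans; apply; apply: ler_of_eq; ring.
apply: ler_wpDl; first by rewrite !mulr_ge0// cabs_ge0.
have -> : c p.1.1 * mu p * (E * (f t p.1.2 * (g t p.2 * h t (idx3 p)))) =
   co p * ('i * (phase3 p)%:C * E * (f t p.1.2 * (g t p.2 * h t (idx3 p)))).
  rewrite /co hp; case/andP: hp => hp _.
  have i0 : 'i * (phase3 p)%:C != 0 :> C.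
    by rewrite mulf_neq0 ?neq0Ci// (_ : 0 = 0%:C)// (inj_eq (@complexI R)).
  by rewrite -['i * _ * E * _]mulrA [RHS]mulrA divfK.
rewrite mulrDr opprD addNKr cabsN !cabsM nE mul1r.
have := ler_wpM2r (cabs_ge0 (df t p.1.2 * (g t p.2 * h t (idx3 p)) +
   f t p.1.2 * (dg t p.2 * h t (idx3 p) + g t p.2 * dh t (idx3 p)))) (cabs_co p).
move=> /le_trans; apply.
have D3 : cabs (df t p.1.2 * (g t p.2 * h t (idx3 p)) +
   f t p.1.2 * (dg t p.2 * h t (idx3 p) + g t p.2 * dh t (idx3 p))) <=
   cabs (df t p.1.2) * (cabs (g t p.2) * cabs (h t (idx3 p))) +
   cabs (f t p.1.2) * (cabs (dg t p.2) * cabs (h t (idx3 p)) + cabs (g t p.2) * cabs (dh t (idx3 p))).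
  apply: le_trans (cabsD _ _) _; rewrite !cabsM lerD2l ler_wpM2l ?cabs_ge0//.
  by apply: le_trans (cabsD _ _) _; rewrite !cabsM.
have := ler_wpM2l (mulr_ge0 pk (wa p.1.1)) D3.
move=> /le_trans; apply; apply: ler_of_eq; ring.
Qed.

(** The boundary terms at s and t cost 8 / N each. What remains has a derivative bounded by 4 + 4 N
    for the near terms plus 40 m, with 40 = 8 + 16 + 16 for the three positions of the time
    derivative; [cprim_lip] doubles this. *)
Lemma tri_bound s t : a <= s -> s <= t -> t <= b ->
  cabs (cintegral t tri_int - cintegral s tri_int) <=
  (16 / N%:R + (b - a) * (8 + 8 * N%:R + 80 * m)) * Y.
Proof.
move=> as_ st tb.
have sab : a <= s <= b by rewrite as_ (le_trans st).
have tab : a <= t <= b by rewrite tb (le_trans as_).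
have Y0 : 0 <= Y.
  have [f1 f2 _ _] := fF.2 t tab; have [g1 g2 _ _] := gG.2 t tab; have [h1 h2 _ _] := hH.2 t tab.
  by rewrite !addr_ge0 ?mulr_ge0// ?(L2_ge0 f1) ?(L2_ge0 f2) ?(L2_ge0 g1) ?(L2_ge0 g2) ?(L2_ge0 h1) ?(L2_ge0 h2).
pose F x := cintegral x tri_int - bd x.
have Fp : cprim T F (fun x => tri_int x - dbd x).
  by apply: cprimD; [exact: cprim_int|exact: cprimN].
have Fl : cabs (F t - F s) <= 2 * ((4 + N%:R * 4 + 40 * m) * Y) * (t - s).
  apply: (cprim_lip Fp) => //; [exact: le_trans as_|exact: le_trans bT|].
  move=> x /andP[sx xt].
  have xab : a <= x <= b by rewrite (le_trans as_ sx) (le_trans xt tb).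
  have [f1 f2 f3 f4] := fF.2 x xab; have [g1 g2 g3 g4] := gG.2 x xab; have [h1 h2 h3 h4] := hH.2 x xab.
  rewrite /tri_int /dbd -sumrB; apply: le_trans (cabs_sum _ _) _.
  apply: le_trans (ler_sum _ (fun p _ => term_le p xab)) _.
  rewrite !big_split/=.
  have q1 := tri_est_weight gL gL gL w0 wD Knear0 est_near al1 f1 g1 h1 f2 g2 h2 uP.
  have pk := @phase_kernel_ge0 R.
  have q2 := tri_est_weight gD gL gL w0 wD pk (@tri_est_deriv1 R) al1 f3 g1 h1 f4 g2 h2 uP.
  have q3 := tri_est_weight gL gD gL w0 wD pk (@tri_est_deriv2 R) al1 f1 g3 h1 f2 g4 h2 uP.
  have q4 := tri_est_weight gL gL gD w0 wD pk (@tri_est_deriv3 R) al1 f1 g1 h3 f2 g2 h4 uP.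
  apply: le_trans (lerD q1 (lerD (lerD q2 q3) q4)) _.
  by apply: ler_of_eq; rewrite /Y; ring.
have -> : cintegral t tri_int - cintegral s tri_int = (F t - F s) + (bd t - bd s) by rewrite /F; ring.
apply: le_trans (cabsD _ _) _.
have Bl : cabs (bd t - bd s) <= 16 / N%:R * Y.
  apply: le_trans (cabsB _ _) _; apply: le_trans (lerD (bd_le tab) (bd_le sab)) _.
  by apply: ler_of_eq; ring.
have Fl' : 2 * ((4 + N%:R * 4 + 40 * m) * Y) * (t - s) <= (b - a) * (8 + 8 * N%:R + 80 * m) * Y.
  rewrite [leRHS](_ : _ = 2 * ((4 + N%:R * 4 + 40 * m) * Y) * (b - a)); last by ring.
  rewrite ler_wpM2l ?lerB// !mulr_ge0// !addr_ge0// ?mulr_ge0//.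
by rewrite [leRHS]mulrDl addrC; apply: lerD => //; exact: le_trans Fl'.
Qed.
End tri.

(** The estimates live on [a, b], but dominated convergence runs over [0, T] and needs some bound
    there, of whatever size. *)
Definition gfam f df A W := fam f df A W /\
  exists B, forall t, 0 <= t <= T -> L2 (fun k => cabs (f t k)) B.

Definition box (n : nat) : seq int := [seq (j%:Z - n%:Z)%R | j <- iota 0 (2 * n).+1].

Definition phase2 (k l : int) : R := 3 * (k * l * (k - l))%:~R.

Definition half_ik (k : int) : C := 'i * ((k%:~R / 2 : R)%:C).

(* Two products, because the equation for a difference is z' = Q(v, z) + Q(z, u); the multiplier
   [gam] is 1, or the cutoff of a Galerkin truncation. *)
Definition Qpart (gam : int -> C) (g1 h1 g2 h2 : R -> int -> C) (n : nat) (t : R) (k : int) : C :=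
  gam k * half_ik k * \sum_(j <- box n)
    expi (phase2 k j * t) * (g1 t j * h1 t (k - j) + g2 t j * h2 t (k - j)).

Definition Qlim gam g1 h1 g2 h2 (q : R -> int -> C) := forall t, 0 <= t <= T -> forall k,
  ccvg (fun n => Qpart gam g1 h1 g2 h2 n t k) (q t k).

Lemma box_uniq n : uniq (box n).
Proof. by rewrite map_inj_uniq ?iota_uniq// => i j /addIr []. Qed.

Lemma cabs_half_ik k : cabs (half_ik k) = (`|k|%N)%:R / 2.
Proof.
rewrite /half_ik cabsM cabs_i mul1r cabs_real normrM [X in _ * X]ger0_norm ?invr_ge0//.
by rewrite -intr_norm -abszE.
Qed.

Lemma Qpart_le gam g1 h1 g2 h2 n t k A1 B1 A2 B2 : (forall k, cabs (gam k) <= 1) ->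
  L2 (fun k => cabs (g1 t k)) A1 -> L2 (fun k => cabs (h1 t k)) B1 ->
  L2 (fun k => cabs (g2 t k)) A2 -> L2 (fun k => cabs (h2 t k)) B2 ->
  cabs (Qpart gam g1 h1 g2 h2 n t k) <= (`|k|%N)%:R * ((A1 * B1 + A2 * B2) / 2).
Proof.
move=> g1' l1 l2 l3 l4; rewrite /Qpart cabsM [cabs (gam k * _)]cabsM cabs_half_ik.
have S1 : cabs (\sum_(j <- box n)
    expi (phase2 k j * t) * (g1 t j * h1 t (k - j) + g2 t j * h2 t (k - j))) <= A1 * B1 + A2 * B2.
  apply: le_trans (cabs_sum _ _) _.
  apply: (@le_trans _ _ (\sum_(j <- box n) (cabs (g1 t j) * cabs (h1 t (k - j)) + cabs (g2 t j) * cabs (h2 t (k - j))))).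
    apply: ler_sum => j _; rewrite cabsM cabs_expi mul1r; apply: le_trans (cabsD _ _) _.
    by rewrite !cabsM.
  rewrite big_split/=; apply: lerD.
    by apply: (L2_cs (box_uniq n) l1); exact: (L2_sub k l2).
  by apply: (L2_cs (box_uniq n) l3); exact: (L2_sub k l4).
have k0 : 0 <= (`|k|%N)%:R / 2 :> R by rewrite divr_ge0.
have := ler_pM (mulr_ge0 (cabs_ge0 _) k0) (cabs_ge0 _) (ler_pM (cabs_ge0 _) k0 (g1' k) (lexx _)) S1.
move=> /le_trans; apply; apply: ler_of_eq; ring.
Qed.

Lemma Qpart_wle gam g1 h1 g2 h2 n t k A1 B1 A2 B2 A1' B1' A2' B2' : (forall k, cabs (gam k) <= 1) ->
  L2 (fun k => cabs (g1 t k)) A1 -> L2 (fun k => cabs (h1 t k)) B1 ->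
  L2 (fun k => cabs (g2 t k)) A2 -> L2 (fun k => cabs (h2 t k)) B2 ->
  L2 (fun k => w k * cabs (g1 t k)) A1' -> L2 (fun k => w k * cabs (h1 t k)) B1' ->
  L2 (fun k => w k * cabs (g2 t k)) A2' -> L2 (fun k => w k * cabs (h2 t k)) B2' ->
  w k * cabs (Qpart gam g1 h1 g2 h2 n t k) <=
    (`|k|%N)%:R * ((A1' * B1 + A1 * B1' + A2' * B2 + A2 * B2') / 2).
Proof.
move=> g1' l1 l2 l3 l4 l1' l2' l3' l4'; rewrite /Qpart cabsM [cabs (gam k * _)]cabsM cabs_half_ik.
have S1 : w k * cabs (\sum_(j <- box n)
    expi (phase2 k j * t) * (g1 t j * h1 t (k - j) + g2 t j * h2 t (k - j))) <=
    A1' * B1 + A1 * B1' + A2' * B2 + A2 * B2'.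
  apply: le_trans (ler_wpM2l (w0 k) (cabs_sum _ _)) _; rewrite mulr_sumr.
  apply: (@le_trans _ _ (\sum_(j <- box n) ((w j * cabs (g1 t j)) * cabs (h1 t (k - j)) +
     cabs (g1 t j) * (w (k - j) * cabs (h1 t (k - j))) +
     (w j * cabs (g2 t j)) * cabs (h2 t (k - j)) + cabs (g2 t j) * (w (k - j) * cabs (h2 t (k - j)))))).
    apply: ler_sum => j _; rewrite cabsM cabs_expi mul1r.
    have wk : w k <= w j + w (k - j) by have {1}-> : k = j + (k - j) by ring.
    apply: le_trans (ler_wpM2r (cabs_ge0 _) wk) _.
    apply: le_trans (ler_wpM2l (addr_ge0 (w0 _) (w0 _)) (cabsD _ _)) _; rewrite !cabsM.
    by apply: ler_of_eq; ring.
  rewrite !big_split/=; apply: lerD; first apply: lerD; first apply: lerD.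
  - by apply: (L2_cs (box_uniq n) l1'); exact: (L2_sub k l2).
  - by apply: (L2_cs (box_uniq n) l1); exact: (L2_sub k l2').
  - by apply: (L2_cs (box_uniq n) l3'); exact: (L2_sub k l4).
  - by apply: (L2_cs (box_uniq n) l3); exact: (L2_sub k l4').
have k0 : 0 <= (`|k|%N)%:R / 2 :> R by rewrite divr_ge0.
rewrite mulrCA.
have := ler_pM (mulr_ge0 (cabs_ge0 _) k0) (mulr_ge0 (w0 k) (cabs_ge0 _)) (ler_pM (cabs_ge0 _) k0 (g1' k) (lexx _)) S1.
move=> /le_trans; apply; apply: ler_of_eq; ring.
Qed.

Lemma Qlim_cabs_le gam g1 h1 g2 h2 q t k D : Qlim gam g1 h1 g2 h2 q -> 0 <= t <= T ->
  (forall n, cabs (Qpart gam g1 h1 g2 h2 n t k) <= D) -> cabs (q t k) <= D.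
Proof. by move=> Qq tT H; apply: ccvg_cabs_le H (Qq t tT k). Qed.

Definition Y3 (A1 W1 A2 W2 A3 W3 : R) := W1 * A2 * A3 + A1 * W2 * A3 + A1 * A2 * W3.

Definition kap (N : nat) : R := 16 / N%:R + (b - a) * (8 + 8 * N%:R + 80 * m).

(** * Trilinear forms with one factor an infinite sum *)

Section triq.
Variables (f df g1 dg1 h1 dh1 g2 dg2 h2 dh2 q : R -> int -> C).
Variables (Af Wf Ag1 Wg1 Ah1 Wh1 Ag2 Wg2 Ah2 Wh2 : R) (gam : int -> C).
Hypotheses (fF : gfam f df Af Wf) (gG1 : gfam g1 dg1 Ag1 Wg1) (hH1 : gfam h1 dh1 Ah1 Wh1)
  (gG2 : gfam g2 dg2 Ag2 Wg2) (hH2 : gfam h2 dh2 Ah2 Wh2).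
Hypotheses (gam1 : forall k, cabs (gam k) <= 1) (Qq : Qlim gam g1 h1 g2 h2 q).
Variables (c : int -> C) (al : int -> R) (nu : int * int -> C) (P : seq (int * int)) (N : nat).
Hypotheses (al1 : L2 al 1) (cal : forall k, cabs (c k) <= w k * al k).
Hypotheses (nue : forall p, cabs (nu p) <= e p.2 * e (p.1 - p.2)).
Hypotheses (uP : uniq P) (N0 : (0 < N)%N).

Definition triq_int (t : R) : C := \sum_(p <- P)
  c p.1 * nu p * (expi (phase2 p.1 p.2 * t) * (f t p.2 * q t (p.1 - p.2))).

Let P3 n : seq T3 := [seq (p, j) | p <- P, j <- box n].
Let mu (p : T3) : C := nu p.1 * (gam (p.1.1 - p.1.2) * half_ik (p.1.1 - p.1.2)).

Let triq_n n (t : R) : C := tri_int f g1 h1 c mu (P3 n) t + tri_int f g2 h2 c mu (P3 n) t.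

(** With k = k1 + k2 + k3: k k1 (k2 + k3) + (k2 + k3) k2 k3 = (k2 + k3) (k1 + k2) (k1 + k3). *)
Let phase23 p j : phase2 p.1 p.2 + phase2 (p.1 - p.2) j = phase3 (p, j).
Proof.
rewrite /phase2 /phase3 /idx3 /= -mulrDr -rmorphD/=.
have -> : (3 : R) = (3 : int)%:~R by [].
by rewrite -intrM; congr (_%:~R); ring.
Qed.

Let triq_nE n t : triq_n n t = \sum_(p <- P)
  c p.1 * nu p * (expi (phase2 p.1 p.2 * t) * (f t p.2 * Qpart gam g1 h1 g2 h2 n t (p.1 - p.2))).
Proof.
rewrite /triq_n /tri_int -big_split /P3 big_allpairs_dep/=; apply: eq_bigr => p _.
rewrite /Qpart !mulr_sumr; apply: eq_bigr => j _.
by rewrite -phase23 mulrDl expiD /mu /idx3/=; ring.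
Qed.

Let P3u n : uniq (P3 n).
Proof. by apply: allpairs_uniq => //; [exact: box_uniq|move=> [? ?] [? ?]]. Qed.

(** The factor |k - k1| / 2 of the substituted equation is cancelled by the inverse of |k - k1| in
    the bound on [nu]. *)
Let mue p : cabs (mu p) <= e p.1.2.
Proof.
rewrite /mu cabsM [cabs (gam _ * _)]cabsM cabs_half_ik.
have h : e (p.1.1 - p.1.2) * ((absz (p.1.1 - p.1.2)%R)%:R / 2) <= 1.
  rewrite /inv_abs; case: (absz _) => [|j]; first by rewrite invr0 mul0r.
  by rewrite mulrA mulVf ?pnatr_eq0// mul1r invf_le1// ler1n.
have k0 : 0 <= (absz (p.1.1 - p.1.2)%R)%:R / 2 :> R by rewrite divr_ge0.
apply: le_trans (ler_pM (cabs_ge0 _) (mulr_ge0 (cabs_ge0 _) k0) (nue p.1) (ler_wpM2r k0 (gam1 _))) _.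
rewrite mul1r -mulrA ler_piMr ?inv_abs_ge0//.
Qed.

Let mu0 p : p.1.1 = p.1.2 -> mu p = 0.
Proof. by move=> pp; rewrite /mu /half_ik pp subrr mul0r !mulr0. Qed.

(** With q replaced by its n-th partial sum, the form is a sum of two finite trilinear forms, one
    for each product in [Qpart]. [tri_bound] bounds them uniformly in n. *)
Lemma triq_bound : cbdmeas T triq_int /\ forall s t, a <= s -> s <= t -> t <= b ->
  cabs (cintegral t triq_int - cintegral s triq_int) <=
  kap N * (Y3 Af Wf Ag1 Wg1 Ah1 Wh1 + Y3 Af Wf Ag2 Wg2 Ah2 Wh2).
Proof.
have [B fB] := fF.2; have [B1 gB1] := gG1.2; have [D1 hD1] := hH1.2.
have [B2 gB2] := gG2.2; have [D2 hD2] := hH2.2.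
have tb (g dg h dh : R -> int -> C) A W A' W' : gfam g dg A W -> gfam h dh A' W' -> forall n,
    cbdmeas T (tri_int f g h c mu (P3 n)).
  move=> gG hH n; apply: cbdmeas_sum => p; apply: cbdmeasM; first exact: cbdmeas_cst.
  apply: cbdmeasM; first exact: (cprim_cbdmeas T0 (cprim_expi _ _)).
  apply: cbdmeasM; first exact: (cprim_cbdmeas T0 (fF.1.1 _)).
  by apply: cbdmeasM; [exact: (cprim_cbdmeas T0 (gG.1.1 _))|exact: (cprim_cbdmeas T0 (hH.1.1 _))].
have bn n : cbdmeas T (triq_n n) by apply: cbdmeasD; [exact: tb gG1 hH1 n|exact: tb gG2 hH2 n].
pose Cb := \sum_(p <- P) cabs (c p.1 * nu p) * (B * ((absz (p.1 - p.2)%R)%:R * ((B1 * D1 + B2 * D2) / 2))).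
have nCb n t : 0 <= t <= T -> cabs (triq_n n t) <= Cb.
  move=> tT; rewrite triq_nE; apply: le_trans (cabs_sum _ _) _; apply: ler_sum => p _.
  rewrite cabsM [cabs (expi _ * _)]cabsM cabs_expi mul1r ler_wpM2l ?cabs_ge0// cabsM.
  apply: ler_pM; rewrite ?cabs_ge0//; first exact: (L2_pt p.2 (fB t tT)).
  by apply: Qpart_le; rewrite ?gB1 ?hD1 ?gB2 ?hD2 //; auto.
have cn t : 0 <= t <= T -> ccvg (fun n => triq_n n t) (triq_int t).
  move=> tT; under eq_fun do rewrite triq_nE.
  apply: ccvg_sum => p; apply: ccvgM; first exact: ccvg_cst.
  apply: ccvgM; first exact: ccvg_cst.
  by apply: ccvgM; [exact: ccvg_cst|exact: Qq].
split; first by have [] := cdct bn nCb cn.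
move=> s t as_ st tb'.
have sT : 0 <= s <= T by rewrite (le_trans a0 as_) (le_trans st (le_trans tb' bT)).
have tT : 0 <= t <= T by rewrite (le_trans a0 (le_trans as_ st)) (le_trans tb' bT).
apply: (cdct_le bn nCb cn) => // n.
have i1 := tb _ _ _ _ _ _ _ _ gG1 hH1 n; have i2 := tb _ _ _ _ _ _ _ _ gG2 hH2 n.
rewrite /triq_n (cintegralD i1 i2 sT) (cintegralD i1 i2 tT) opprD addrACA mulrDr.
apply: le_trans (cabsD _ _) _; apply: lerD.
- exact: tri_bound fF.1 gG1.1 hH1.1 _ _ _ _ _ al1 cal mue mu0 (P3u n) N0 _ _ as_ st tb'.
- exact: tri_bound fF.1 gG2.1 hH2.1 _ _ _ _ _ al1 cal mue mu0 (P3u n) N0 _ _ as_ st tb'.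
Qed.
End triq.

(** * Integration by parts in the bilinear form *)

Section bil.
Variables (f df f1 df1 f2 df2 f3 df3 f4 df4 : R -> int -> C).
Variables (g dg g1 dg1 g2 dg2 g3 dg3 g4 dg4 : R -> int -> C).
Variables (Af Wf Af1 Wf1 Af2 Wf2 Af3 Wf3 Af4 Wf4 : R).
Variables (Ag Wg Ag1 Wg1 Ag2 Wg2 Ag3 Wg3 Ag4 Wg4 : R) (gam : int -> C).
Hypotheses (fF : gfam f df Af Wf) (fF1 : gfam f1 df1 Af1 Wf1) (fF2 : gfam f2 df2 Af2 Wf2)
  (fF3 : gfam f3 df3 Af3 Wf3) (fF4 : gfam f4 df4 Af4 Wf4).
Hypotheses (gG : gfam g dg Ag Wg) (gG1 : gfam g1 dg1 Ag1 Wg1) (gG2 : gfam g2 dg2 Ag2 Wg2)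
  (gG3 : gfam g3 dg3 Ag3 Wg3) (gG4 : gfam g4 dg4 Ag4 Wg4).
Hypotheses (gam1 : forall k, cabs (gam k) <= 1).
Hypotheses (Qf : Qlim gam f1 f2 f3 f4 df) (Qg : Qlim gam g1 g2 g3 g4 dg).
Hypotheses (f0 : forall t, f t 0 = 0) (g0 : forall t, g t 0 = 0).
Variables (c : int -> C) (al : int -> R) (P : seq (int * int)) (N : nat).
Hypotheses (al1 : L2 al 1) (cal : forall k, cabs (c k) <= w k * al k).
Hypotheses (uP : uniq P) (N0 : (0 < N)%N).
Notation T2 := (int * int)%type.

Definition bil_int (t : R) : C := \sum_(p <- P)
  c p.1 * half_ik p.1 * (expi (phase2 p.1 p.2 * t) * (f t p.2 * g t (p.1 - p.2))).

Let high (p : T2) := [&& p.1 != 0, p.2 != 0, p.1 - p.2 != 0 &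
  (N < absz p.2)%N || (N < absz (p.1 - p.2)%R)%N].

Let nu (p : T2) : C := if high p then half_ik p.1 / ('i * (phase2 p.1 p.2)%:C) else 0.

Let bd (t : R) : C := \sum_(p <- P)
  c p.1 * nu p * (expi (phase2 p.1 p.2 * t) * (f t p.2 * g t (p.1 - p.2))).
Let dbd (t : R) : C := \sum_(p <- P)
  c p.1 * nu p * ('i * (phase2 p.1 p.2)%:C * expi (phase2 p.1 p.2 * t) * (f t p.2 * g t (p.1 - p.2)) +
   expi (phase2 p.1 p.2 * t) * (df t p.2 * g t (p.1 - p.2) + f t p.2 * dg t (p.1 - p.2))).

Let bd_prim : cprim T bd dbd.
Proof.
apply: cprim_sum => p; apply: (cprimZ T0); apply: (cprimM T0); first exact: cprim_expi.
by apply: (cprimM T0); [exact: fF.1.1|exact: gG.1.1].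
Qed.

Let bil_cbdmeas : cbdmeas T bil_int.
Proof.
apply: cbdmeas_sum => p; apply: cbdmeasM; first exact: cbdmeas_cst.
apply: cbdmeasM; first exact: (cprim_cbdmeas T0 (cprim_expi _ _)).
by apply: cbdmeasM; [exact: (cprim_cbdmeas T0 (fF.1.1 _))|exact: (cprim_cbdmeas T0 (gG.1.1 _))].
Qed.

Let e0 k := @inv_abs_ge0 R k.
Let NV0 : 0 < N%:R :> R. Proof. by rewrite ltr0n. Qed.
Let al0 k : 0 <= al k. Proof. by case: al1. Qed.

(** The phase contains k, which cancels the factor k / 2 of the equation: (k / 2) / (3 k k1 k2) = 1
    / (6 k1 k2), where k2 = k - k1. *)
Let nu_e p : cabs (nu p) <= e p.2 * e (p.1 - p.2).
Proof.
rewrite /nu; case: ifP => [/and4P[p1 p2 p3 _]|_]; last by rewrite cabs0 mulr_ge0.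
rewrite cabsM cabs_half_ik cabsV cabsM cabs_i mul1r cabs_real /phase2 normrM.
have ni (x : int) : `|x%:~R| = (absz x)%:R :> R by rewrite -intr_norm -abszE.
rewrite ni !abszM !natrM [`|3|]ger0_norm// /inv_abs.
have a1 : (0 : R) < (absz p.1)%:R by rewrite ltr0n absz_gt0.
have a2 : (0 : R) < (absz p.2)%:R by rewrite ltr0n absz_gt0.
have a3 : (0 : R) < (absz (p.1 - p.2)%R)%:R by rewrite ltr0n absz_gt0.
move: a1 a2 a3; move: ((absz p.1)%:R : R) ((absz p.2)%:R : R) ((absz (p.1 - p.2)%R)%:R : R) => x y z x0 y0 z0.
have -> : x / 2 / (3 * (x * y * z)) = 6^-1 * (y^-1 * z^-1) by field; rewrite !gt_eqF.
by rewrite ler_piMl ?mulr_ge0 ?invr_ge0 ?ltW// invf_lt1// ltr1n.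
Qed.

Let Khi (p : T2) : R := N%:R^-1 * (e p.2 + e (p.1 - p.2)).
Let Khi0 p : 0 <= Khi p. Proof. by rewrite mulr_ge0 ?invr_ge0// addr_ge0. Qed.
Let est_hi : bil_est Khi (N%:R^-1 * 4).
Proof.
apply: bil_estZ; first by rewrite invr_ge0.
have -> : 4 = 2 + 2 :> R by ring.
by apply: bil_estD; [exact: bil_est1|exact: bil_est2].
Qed.
(** If no index is 0 and [high] fails, both |k1| and |k - k1| are at most N, so |k| / 2 <= N <= N^2
    / |k1|. Terms with a zero index vanish. *)
Let Klo (p : T2) : R := (N * N)%:R * e p.2.
Let Klo0 p : 0 <= Klo p. Proof. by rewrite mulr_ge0. Qed.
Let est_lo : bil_est Klo ((N * N)%:R * 2).
Proof. by apply: bil_estZ; [rewrite ler0n|exact: bil_est1]. Qed.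

Let nu_hi p : cabs (nu p) <= Khi p.
Proof.
have [hp|hp] := boolP (high p); last by rewrite /nu (negbTE hp) cabs0.
apply: le_trans (nu_e p) _; rewrite /Khi mulrDr.
case/and4P: hp => _ _ _ /orP[] hN.
- apply: ler_wpDl; first by rewrite mulr_ge0 ?invr_ge0.
  by rewrite ler_wpM2r// lef_pV2 ?posrE ?ltr0n ?(leq_ltn_trans _ hN)// ler_nat ltnW.
- apply: ler_wpDr; first by rewrite mulr_ge0 ?invr_ge0.
  rewrite mulrC ler_wpM2r// lef_pV2 ?posrE ?ltr0n ?(leq_ltn_trans _ hN)// ler_nat ltnW//.
Qed.

Let Y2 := Wf * Ag + Af * Wg.

Let bd_le t : a <= t <= b -> cabs (bd t) <= N%:R^-1 * 4 * Y2.
Proof.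
move=> tab.
have [q1 q2 _ _] := fF.1.2 t tab; have [r1 r2 _ _] := gG.1.2 t tab.
apply: le_trans (cabs_sum _ _) _.
have := bil_est_weight w0 wD Khi0 est_hi al1 q1 r1 q2 r2 uP.
rewrite mul1r; apply: le_trans; apply: ler_sum => p _.
rewrite cabsM [cabs (expi _ * _)]cabsM cabs_expi mul1r !cabsM.
have := ler_pM (cabs_ge0 _) (cabs_ge0 _) (cal p.1) (nu_hi p).
move=> /(ler_wpM2r (mulr_ge0 (cabs_ge0 (f t p.2)) (cabs_ge0 (g t (p.1 - p.2))))).
move=> /le_trans; apply; apply: ler_of_eq; ring.
Qed.

Let X2 := triq_int f dg c nu P.
Let sw (p : T2) : T2 := (p.1, p.1 - p.2).
(** [triq_int] expects the substituted factor in second place; exchanging k1 and k - k1 preserves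
    the phase and brings [df] there. *)
Let X1 := triq_int g df c (nu \o sw) (map sw P).

Let sw2 p : p.1 - (p.1 - p.2) = p.2 :> int. Proof. by ring. Qed.
Let phase_sw (k l : int) : phase2 k (k - l) = phase2 k l.
Proof. by rewrite /phase2; congr (_ * _%:~R); ring. Qed.

Let swK : involutive sw. Proof. by case=> k l; rewrite /sw/=; congr pair; ring. Qed.

Let X1E t : X1 t = \sum_(p <- P)
  c p.1 * nu p * (expi (phase2 p.1 p.2 * t) * (df t p.2 * g t (p.1 - p.2))).
Proof.
rewrite /X1 /triq_int big_map; apply: eq_bigr => p _.
by rewrite /= swK /= phase_sw sw2 [g _ _ * _]mulrC.
Qed.

Let term_le t p : a <= t <= b ->
  cabs (c p.1 * half_ik p.1 * (expi (phase2 p.1 p.2 * t) * (f t p.2 * g t (p.1 - p.2))) -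
    c p.1 * nu p * ('i * (phase2 p.1 p.2)%:C * expi (phase2 p.1 p.2 * t) * (f t p.2 * g t (p.1 - p.2))))
  <= Klo p * (w p.1 * al p.1 * cabs (f t p.2) * cabs (g t (p.1 - p.2))).
Proof.
move=> tab; have [hp|hp] := boolP (high p).
  have z0 : 'i * (phase2 p.1 p.2)%:C != 0 :> C.
    case/and4P: hp => p1 p2 p3 _.
    rewrite mulf_neq0 ?neq0Ci// (_ : 0 = 0%:C)// (inj_eq (@complexI R)).
    by rewrite /phase2 mulf_neq0// intr_eq0 !mulf_neq0.
  rewrite /nu hp (_ : _ - _ = 0) ?cabs0.
    by rewrite !mulr_ge0// cabs_ge0.
  apply/eqP; rewrite subr_eq0; apply/eqP.
  move: ('i * _) z0 (expi _) (half_ik _) (f t _ * g t _) => z z0 E H X.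
  by rewrite [RHS](_ : _ = c p.1 * H * (E * X) * (z^-1 * z)); [rewrite mulVf ?mulr1|ring].
rewrite /nu (negbTE hp) mulr0 mul0r subr0 cabsM [cabs (c _ * _)]cabsM [cabs (expi _ * _)]cabsM cabs_expi mul1r cabsM cabs_half_ik.
have R0 : 0 <= Klo p * (w p.1 * al p.1 * cabs (f t p.2) * cabs (g t (p.1 - p.2))).
  by rewrite !mulr_ge0// cabs_ge0.
have [p1|p1] := eqVneq p.1 0; first by rewrite p1 absz0 mul0r mulr0 mul0r -p1.
have [p2|p2] := eqVneq p.2 0; first by rewrite {1}p2 f0 cabs0 mul0r mulr0.
have [p3|p3] := eqVneq (p.1 - p.2) 0; first by rewrite {1}p3 g0 cabs0 !mulr0.
move: hp; rewrite /high p1 p2 p3/= negb_or -!leqNgt => /andP[l1 l2].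
have K1 : (absz p.1)%:R / 2 <= Klo p.
  rewrite /Klo natrM -mulrA.
  have n1 : (absz p.1)%:R <= N%:R * 2 :> R by rewrite -natrM ler_nat; lia.
  have n2 : 1 <= N%:R * e p.2 by rewrite /inv_abs ler_pdivlMr ?ltr0n ?absz_gt0// mul1r ler_nat.
  apply: (@le_trans _ _ N%:R); first by rewrite ler_pdivrMr.
  by rewrite ler_peMr// ltW.
have k0 : 0 <= (absz p.1)%:R / 2 :> R by rewrite divr_ge0.
have := ler_pM (cabs_ge0 _) k0 (cal p.1) K1.
move=> /(ler_wpM2r (mulr_ge0 (cabs_ge0 (f t p.2)) (cabs_ge0 (g t (p.1 - p.2))))).
move=> /le_trans; apply; apply: ler_of_eq; ring.
Qed.

(** Subtracting the boundary term and adding back the integrals of [X1] and [X2], where the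
    derivative falls on a factor, leaves a function whose derivative is bounded through [Klo]. The
    boundary terms cost 4 / N each, the low part 2 N^2, doubled by [cprim_lip], and [X1], [X2] cost
    [kap N] times their trilinear norms. *)
Lemma bil_bound s t : a <= s -> s <= t -> t <= b ->
  cabs (cintegral t bil_int - cintegral s bil_int) <=
  (8 / N%:R + (b - a) * (4 * (N * N)%:R)) * Y2 +
  kap N * (Y3 Ag Wg Af1 Wf1 Af2 Wf2 + Y3 Ag Wg Af3 Wf3 Af4 Wf4) +
  kap N * (Y3 Af Wf Ag1 Wg1 Ag2 Wg2 + Y3 Af Wf Ag3 Wg3 Ag4 Wg4).
Proof.
move=> as_ st tb.
have sab : a <= s <= b by rewrite as_ (le_trans st).
have tab : a <= t <= b by rewrite tb (le_trans as_).
have sT : s <= T by rewrite (le_trans st (le_trans tb bT)).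
have tT : t <= T by rewrite (le_trans tb bT).
have s0 : 0 <= s by exact: le_trans as_.
have t0 : 0 <= t by exact: le_trans st.
have nu_e' p : cabs ((nu \o sw) p) <= e p.2 * e (p.1 - p.2).
  by apply: le_trans (nu_e _) _; rewrite /= sw2 mulrC.
have uP' : uniq (map sw P) by rewrite map_inj_uniq//; exact: inv_inj swK.
have [b1 B1] := triq_bound gG fF1 fF2 fF3 fF4 gam1 Qf al1 cal nu_e' uP' N0.
have [b2 B2] := triq_bound fF gG1 gG2 gG3 gG4 gam1 Qg al1 cal nu_e uP N0.
have Y0 : 0 <= Y2.
  have [q1 q2 _ _] := fF.1.2 t tab; have [r1 r2 _ _] := gG.1.2 t tab.
  by rewrite !addr_ge0 ?mulr_ge0// ?(L2_ge0 q1) ?(L2_ge0 q2) ?(L2_ge0 r1) ?(L2_ge0 r2).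
pose F x := cintegral x bil_int - bd x + (cintegral x X1 + cintegral x X2).
have Fp : cprim T F (fun x => bil_int x - dbd x + (X1 x + X2 x)).
  apply: cprimD; first by apply: cprimD; [exact: cprim_int|exact: cprimN].
  by apply: cprimD; exact: cprim_int.
have Fl : cabs (F t - F s) <= 2 * ((N * N)%:R * 2 * Y2) * (t - s).
  apply: (cprim_lip Fp) => // x /andP[sx xt].
  have xab : a <= x <= b by rewrite (le_trans as_ sx) (le_trans xt tb).
  have [q1 q2 _ _] := fF.1.2 x xab; have [r1 r2 _ _] := gG.1.2 x xab.
  rewrite X1E /X2 /triq_int /bil_int /dbd -sumrB -!big_split/=.
  apply: le_trans (cabs_sum _ _) _.
  have := bil_est_weight w0 wD Klo0 est_lo al1 q1 r1 q2 r2 uP.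
  rewrite mul1r; apply: le_trans; apply: ler_sum => p _.
  apply: le_trans (term_le p xab); apply: ler_of_eq; congr cabs.
  by ring.
have -> : cintegral t bil_int - cintegral s bil_int =
   ((F t - F s) + (bd t - bd s)) - (cintegral t X1 - cintegral s X1) - (cintegral t X2 - cintegral s X2).
  by rewrite /F; ring.
apply: le_trans (cabsB _ _) _; apply: lerD; last exact: B2.
apply: le_trans (cabsB _ _) _; apply: lerD; last exact: B1.
apply: le_trans (cabsD _ _) _.
have Bl : cabs (bd t - bd s) <= 8 / N%:R * Y2.
  apply: le_trans (cabsB _ _) _; apply: le_trans (lerD (bd_le tab) (bd_le sab)) _.
  by apply: ler_of_eq; ring.
have Fl' : 2 * ((N * N)%:R * 2 * Y2) * (t - s) <= (b - a) * (4 * (N * N)%:R) * Y2.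
  rewrite [leRHS](_ : _ = 2 * ((N * N)%:R * 2 * Y2) * (b - a)); last by ring.
  by rewrite ler_wpM2l ?lerB// !mulr_ge0.
by rewrite [leRHS]mulrDl addrC; apply: lerD => //; exact: le_trans Fl'.
Qed.
End bil.
End trilinear.

(** * The difference equation *)

Section diff.
Variables (R : realType) (T : R).
Hypothesis T0 : 0 <= T.
Notation C := R[i].

Definition zfam : R -> int -> C := fun _ _ => 0.

(** [zfam] switches off the second product of [Qpart], leaving v' = gam Q(v, v). The bound and the
    limit are required at every time of [0, T], not almost every one, and the entry at 0 is fixed to
    be 0. *)
Definition solves (gam : int -> C) (v dv : R -> int -> C) (M : R) :=
  [/\ forall t, v t 0 = 0, forall k, cprim T (fun t => v t k) (fun t => dv t k),
      forall t, 0 <= t <= T -> L2 (fun k => cabs (v t k)) M &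
      Qlim T gam v v zfam zfam dv].

Lemma L2_zero M : 0 <= M -> L2 (fun=> 0 : R) M.
Proof.
by move=> M0; split=> // s us; rewrite big1 ?sqr_ge0// => k _; rewrite expr0n.
Qed.

Lemma L2_cabs_zero t M (w : int -> R) : 0 <= M -> L2 (fun k => w k * cabs (zfam t k)) M.
Proof. by move=> M0; under eq_fun do rewrite /zfam cabs0 mulr0; exact: L2_zero. Qed.

Lemma L2_wcabs_zero t M : 0 <= M -> L2 (fun k => cabs (zfam t k)) M.
Proof. by move=> M0; under eq_fun do rewrite /zfam cabs0; exact: L2_zero. Qed.

Section w.
Variable (w : int -> R).
Hypotheses (w0 : forall k, 0 <= w k) (wD : forall i j, w (i + j) <= w i + w j).

Lemma gfam_zero m a b : 0 <= m -> gfam T w m a b zfam zfam 0 0.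
Proof.
move=> m0; split; last by exists 0 => t _; exact: L2_wcabs_zero.
split; first by move=> k; exact: cprim_cst.
move=> t _; split; [exact: L2_wcabs_zero|exact: L2_cabs_zero| |];
  by split=> [k||k] //; rewrite /zfam ?mulr0 ?cabs0 ?mulr0.
Qed.

Lemma Qlim_lin_growth gam g1 h1 g2 h2 q t A1 B1 A2 B2 D :
  (forall k, cabs (gam k) <= 1) -> Qlim T gam g1 h1 g2 h2 q -> 0 <= t <= T ->
  L2 (fun k => cabs (g1 t k)) A1 -> L2 (fun k => cabs (h1 t k)) B1 ->
  L2 (fun k => cabs (g2 t k)) A2 -> L2 (fun k => cabs (h2 t k)) B2 ->
  (A1 * B1 + A2 * B2) / 2 <= D -> lin_growth (fun k => cabs (q t k)) D.
Proof.
move=> gam1 Qq tT l1 l2 l3 l4 hD; split.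
- by move=> k; exact: cabs_ge0.
- apply: le_trans hD; rewrite divr_ge0// addr_ge0// mulr_ge0//;
    by [exact: L2_ge0 l1|exact: L2_ge0 l2|exact: L2_ge0 l3|exact: L2_ge0 l4].
- move=> k; apply: (Qlim_cabs_le Qq tT) => n.
  apply: le_trans (Qpart_le n k gam1 l1 l2 l3 l4) _.
  by rewrite ler_wpM2l.
Qed.

Lemma Qlim_wlin_growth gam g1 h1 g2 h2 q t A1 B1 A2 B2 A1' B1' A2' B2' D :
  (forall k, cabs (gam k) <= 1) -> Qlim T gam g1 h1 g2 h2 q -> 0 <= t <= T ->
  L2 (fun k => cabs (g1 t k)) A1 -> L2 (fun k => cabs (h1 t k)) B1 ->
  L2 (fun k => cabs (g2 t k)) A2 -> L2 (fun k => cabs (h2 t k)) B2 ->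
  L2 (fun k => w k * cabs (g1 t k)) A1' -> L2 (fun k => w k * cabs (h1 t k)) B1' ->
  L2 (fun k => w k * cabs (g2 t k)) A2' -> L2 (fun k => w k * cabs (h2 t k)) B2' ->
  (A1' * B1 + A1 * B1' + A2' * B2 + A2 * B2') / 2 <= D ->
  lin_growth (fun k => w k * cabs (q t k)) D.
Proof.
move=> gam1 Qq tT l1 l2 l3 l4 l1' l2' l3' l4' hD; split.
- by move=> k; rewrite mulr_ge0// cabs_ge0.
- apply: le_trans hD; rewrite divr_ge0// !addr_ge0// mulr_ge0//;
    by [exact: L2_ge0 l1|exact: L2_ge0 l2|exact: L2_ge0 l3|exact: L2_ge0 l4
       |exact: L2_ge0 l1'|exact: L2_ge0 l2'|exact: L2_ge0 l3'|exact: L2_ge0 l4'].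
- move=> k; have -> : w k * cabs (q t k) = cabs ((w k)%:C * q t k).
    by rewrite cabsM cabs_real ger0_norm.
  apply: (@ccvg_cabs_le _ (fun n => (w k)%:C * Qpart gam g1 h1 g2 h2 n t k)).
    move=> n; rewrite cabsM cabs_real ger0_norm//.
    apply: le_trans (Qpart_wle w0 wD n k gam1 l1 l2 l3 l4 l1' l2' l3' l4') _.
    by rewrite ler_wpM2l.
  by apply: ccvgM; [exact: ccvg_cst|exact: Qq].
Qed.

(* Tested against finitely many frequencies, z is a finite sum, to which integration by parts applies. *)
Lemma duality (z za : int -> C) Za B :
  L2 (fun k => w k * cabs (za k)) Za -> 0 <= B ->
  (forall (F : seq int) (c : int -> C) (al : int -> R), uniq F -> L2 al 1 ->
     (forall k, cabs (c k) <= w k * al k) ->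
     cabs (\sum_(k <- F) c k * (z k - za k)) <= B) ->
  L2 (fun k => w k * cabs (z k)) (Za + B).
Proof.
move=> lza B0 H; have Za0 := L2_ge0 lza; split.
- by move=> k; rewrite mulr_ge0// cabs_ge0.
- by rewrite addr_ge0.
move=> F uF; set S := \sum_(k <- F) _.
have S0 : 0 <= S by rewrite sumr_ge0// => k _; rewrite sqr_ge0.
pose X := Num.sqrt S.
have XS : X ^+ 2 = S by rewrite sqr_sqrtr.
have X0 : 0 <= X by rewrite sqrtr_ge0.
rewrite -XS lerXn2r ?nnegrE ?addr_ge0//.
move: X0; rewrite le_eqVlt => /orP[/eqP <-|X0]; first by rewrite addr_ge0.
(* On F, [al] is w |z| normalised in l^2 and [c] is w^2 conj(z) / X, so that the sum of c z is
   exactly X. *)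
pose al k := if k \in F then w k * cabs (z k) / X else 0.
pose c k : C := if k \in F then (w k ^+ 2 / X)%:C * (z k)^* else 0.
have al0 k : 0 <= al k by rewrite /al; case: ifP => // _; rewrite divr_ge0 ?mulr_ge0 ?cabs_ge0 ?(ltW X0).
have al1 : L2 al 1.
  split=> // s us.
  rewrite (bigID (fun k => k \in F))/= [X in _ + X]big1 ?addr0; last first.
    by move=> k kF; rewrite /al (negbTE kF) expr0n.
  rewrite -big_filter.
  have sF : {subset [seq i <- s | i \in F] <= F} by move=> k; rewrite mem_filter => /andP[].
  apply: le_trans (sum_superset _ (filter_uniq _ us) sF) _; first by move=> k; rewrite sqr_ge0.
  rewrite (_ : \sum_(k <- F) _ = \sum_(k <- F) (w k * cabs (z k)) ^+ 2 * (X ^+ 2)^-1).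
    by rewrite -mulr_suml -/S XS divff ?expr1n// -XS gt_eqF// exprn_gt0.
  by apply: eq_big_seq => k kF; rewrite /al kF exprMn exprVn.
have cal k : cabs (c k) <= w k * al k.
  rewrite /c /al; case: ifP => _; last by rewrite cabs0 mulr0.
  rewrite cabsM cabs_conj cabs_real ger0_norm ?divr_ge0 ?sqr_ge0 ?(ltW X0)//.
  by apply: ler_of_eq; field; rewrite gt_eqF.
have cX : \sum_(k <- F) c k * z k = X%:C.
  rewrite (_ : \sum_(k <- F) _ = \sum_(k <- F) ((w k * cabs (z k)) ^+ 2 / X)%:C).
    rewrite -raddf_sum/= -mulr_suml -/S -XS expr2 mulfK ?gt_eqF//.
  apply: eq_big_seq => k kF; rewrite /c kF exprMn cabs_sq.
  by case: (z k) => x y; apply: complex_eq; rewrite /abs2 ?ReM ?ImM/=; ring.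
have cza : cabs (\sum_(k <- F) c k * za k) <= Za.
  apply: le_trans (cabs_sum _ _) _; rewrite -[Za]mul1r.
  apply: le_trans (L2_cs uF al1 lza); apply: ler_sum => k _.
  by rewrite cabsM mulrA [al k * _]mulrC ler_wpM2r ?cabs_ge0.
have := H F c al uF al1 cal.
rewrite (_ : \sum_(k <- F) c k * (z k - za k) = X%:C - \sum_(k <- F) c k * za k); last first.
  by rewrite -cX -sumrB; apply: eq_bigr => k _; rewrite mulrBr.
move=> h1.
have -> : X = cabs (X%:C - \sum_(k <- F) c k * za k + \sum_(k <- F) c k * za k).
  by rewrite subrK cabs_real ger0_norm// ltW.
by apply: le_trans (cabsD _ _) _; rewrite addrC; exact: lerD.
Qed.

Section step.
Variables (gam : int -> C) (v dv u du : R -> int -> C) (M P S S0 Za a b : R) (N : nat).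
(** The weighted bound on z' is P S0 + M S, at most 2 M S by [PS]. *)
Let m := 2 * M.
Let z t k := v t k - u t k.
Let dz t k := dv t k - du t k.
Hypotheses (gam1 : forall k, cabs (gam k) <= 1) (sv : solves gam v dv M) (su : solves gam u du M).
Hypotheses (a0 : 0 <= a) (ab : a <= b) (bT : b <= T) (N0 : (0 < N)%N) (M0 : 0 <= M).
Hypotheses (vP : forall t, a <= t <= b -> L2 (fun k => w k * cabs (v t k)) P)
  (uP : forall t, a <= t <= b -> L2 (fun k => w k * cabs (u t k)) P)
  (zS : forall t, a <= t <= b -> L2 (fun k => w k * cabs (z t k)) S)
  (zS0 : forall t, a <= t <= b -> L2 (fun k => cabs (z t k)) S0)
  (zZ : L2 (fun k => w k * cabs (z a k)) Za) (PS : P * S0 <= M * S).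
(* Makes the total loss in [diff_step] at most [S / 2]: N large first, then b - a small. *)
Hypothesis small : (32 * M + 288 * M ^+ 2) / N%:R +
  (b - a) * (16 * M * (N * N)%:R + 18 * M ^+ 2 * (8 + 8 * N%:R + 160 * M)) <= 2^-1.

Let m0 : 0 <= m. Proof. by rewrite mulr_ge0. Qed.
Let P0 : 0 <= P. Proof. by apply: (L2_ge0 (vP (t := a) _)); rewrite lexx. Qed.
Let S00 : 0 <= S0. Proof. by apply: (L2_ge0 (zS0 (t := a) _)); rewrite lexx. Qed.
Let SS0 : 0 <= S. Proof. by apply: (L2_ge0 (zS (t := a) _)); rewrite lexx. Qed.

Let inT t : a <= t <= b -> 0 <= t <= T.
Proof. by move=> /andP[at_ tb]; rewrite (le_trans a0 at_) (le_trans tb bT). Qed.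

Let sfam v' dv' : solves gam v' dv' M -> (forall t, a <= t <= b -> L2 (fun k => w k * cabs (v' t k)) P) ->
  gfam T w m a b v' dv' M P.
Proof.
move=> [v0 pv vM Qv] vP'; split; last by exists M.
split=> // t tab; split; [exact: vM (inT tab)|exact: vP'| |].
- have l := vM _ (inT tab); have lz := L2_wcabs_zero t (lexx (0 : R)).
  by apply: (Qlim_lin_growth gam1 Qv (inT tab) l l lz lz); rewrite /m; nra.
- have l := vM _ (inT tab); have lz := L2_wcabs_zero t (lexx (0 : R)).
  have lz' := L2_cabs_zero t w (lexx (0 : R)).
  apply: (Qlim_wlin_growth gam1 Qv (inT tab) l l lz lz (vP' _ tab) (vP' _ tab) lz' lz').
  rewrite /m; have := mulr_ge0 P0 M0; lra.
Qed.

Let QzE n t k : Qpart gam v z z u n t k =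
  Qpart gam v v zfam zfam n t k - Qpart gam u u zfam zfam n t k.
Proof.
rewrite /Qpart -mulrBr -sumrB; congr (_ * _); apply: eq_bigr => j _.
by rewrite /z /zfam; ring.
Qed.

Let Qz : Qlim T gam v z z u dz.
Proof.
move=> t tT k; under eq_fun do rewrite QzE.
by apply: ccvgD; [case: sv => _ _ _; apply|apply: ccvgN; case: su => _ _ _; apply].
Qed.

Let L2v t : 0 <= t <= T -> L2 (fun k => cabs (v t k)) M. Proof. by case: sv => _ _ h _; exact: h. Qed.
Let L2u t : 0 <= t <= T -> L2 (fun k => cabs (u t k)) M. Proof. by case: su => _ _ h _; exact: h. Qed.

Let L2z2 t : 0 <= t <= T -> L2 (fun k => cabs (z t k)) (M + M).
Proof. by move=> tT; exact: L2_cabs_sub (L2v tT) (L2u tT). Qed.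

Let zfamily : gfam T w m a b z dz S0 S.
Proof.
have [v0 pv vM Qv] := sv; have [u0 pu uM Qu] := su.
split; last by exists (M + M).
split; first by move=> k; apply: cprimD; [exact: pv|exact: cprimN].
move=> t tab; have tT := inT tab; split; [exact: zS0|exact: zS| |].
- apply: (Qlim_lin_growth gam1 Qz tT (vM t tT) (zS0 tab) (zS0 tab) (uM t tT)).
  by have := mulr_ge0 M0 S00; rewrite /m; lra.
- apply: (Qlim_wlin_growth gam1 Qz tT (vM t tT) (zS0 tab) (zS0 tab) (uM t tT) (vP tab) (zS tab) (zS tab) (uP tab)).
  by have := PS; rewrite /m; lra.
Qed.

(** The separate bounds P and S0 let one estimate serve two purposes. With u = 0 one takes P = S and
    S0 = M, which gives the a priori bound; for two solutions bounded by M in the weighted norm one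
    takes P = M and S0 = S. Both satisfy [PS] with equality. *)
Lemma diff_step t : a <= t <= b -> L2 (fun k => w k * cabs (z t k)) (Za + S / 2).
Proof.
move=> /andP[at_ tb]; apply: (duality zZ); first by rewrite divr_ge0.
move=> F c al uF al1 cal.
have tT : 0 <= t <= T by apply: inT; rewrite at_.
have aT : 0 <= a <= T by apply: inT; rewrite lexx.
have [v0 pv vM Qv] := sv; have [u0 pu uM Qu] := su.
have [[zp _] _] := zfamily.
pose G x := \sum_(k <- F) c k * z x k.
pose dG x := \sum_(k <- F) c k * dz x k.
have Gp : cprim T G dG by apply: cprim_sum => k; exact: (cprimZ T0).
have -> : \sum_(k <- F) c k * (z t k - z a k) = cintegral t dG - cintegral a dG.
  rewrite (_ : \sum_(k <- F) _ = G t - G a); last first.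
    by rewrite /G -sumrB; apply: eq_bigr => k _; rewrite mulrBr.
  by rewrite (cprimE Gp tT) (cprimE Gp aT) opprD addrACA subrr add0r.
pose Pn n : seq (int * int) := [seq (k, j) | k <- F, j <- box n].
have uPn n : uniq (Pn n).
  by apply: allpairs_uniq => //; [exact: box_uniq|move=> [? ?] [? ?]].
pose c' k := c k * gam k.
have cal' k : cabs (c' k) <= w k * al k.
  by rewrite cabsM; apply: le_trans (cal k); rewrite ler_piMr ?cabs_ge0.
pose fn n x := bil_int v z c' (Pn n) x + bil_int z u c' (Pn n) x.
have fnE n x : fn n x = \sum_(k <- F) c k * Qpart gam v z z u n x k.
  rewrite /fn /bil_int -big_split /Pn big_allpairs_dep/=; apply: eq_bigr => k _.
  rewrite /Qpart !mulr_sumr; apply: eq_bigr => j _; rewrite /c'; ring.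
have bb (f df g dg : R -> int -> C) : (forall k, cprim T (fun t => f t k) (fun t => df t k)) ->
    (forall k, cprim T (fun t => g t k) (fun t => dg t k)) -> forall n, cbdmeas T (bil_int f g c' (Pn n)).
  move=> fp gp n; apply: cbdmeas_sum => p; apply: cbdmeasM; first exact: cbdmeas_cst.
  apply: cbdmeasM; first exact: (cprim_cbdmeas T0 (cprim_expi _ _)).
  by apply: cbdmeasM; [exact: (cprim_cbdmeas T0 (fp _))|exact: (cprim_cbdmeas T0 (gp _))].
have b1 := bb _ _ _ _ pv zp; have b2 := bb _ _ _ _ zp pu.
have bn n : cbdmeas T (fn n) by exact: cbdmeasD.
pose Cb := \sum_(k <- F) cabs (c k) * ((absz k)%:R * ((M * (M + M) + (M + M) * M) / 2)).
apply: (cdct_le (C := Cb) bn _ _ aT tT).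
- move=> n x xT; rewrite fnE; apply: le_trans (cabs_sum _ _) _; apply: ler_sum => k _.
  rewrite cabsM ler_wpM2l ?cabs_ge0//.
  exact: (Qpart_le n k gam1 (L2v xT) (L2z2 xT) (L2z2 xT) (L2u xT)).
- move=> x xT; under eq_fun do rewrite fnE.
  by apply: ccvg_sum => k; apply: ccvgM; [exact: ccvg_cst|exact: Qz].
move=> n.
rewrite /fn (cintegralD (b1 n) (b2 n) tT) (cintegralD (b1 n) (b2 n) aT) opprD addrACA; apply: le_trans (cabsD _ _) _.
have fv := sfam sv vP; have fu := sfam su uP; have f0 := @gfam_zero m a b m0.
have z00 x : z x 0 = 0 by rewrite /z v0 u0 subr0.
have aa : a <= a by [].
have B1 := bil_bound T0 a0 bT m0 w0 wD fv fv fv f0 f0 zfamily fv zfamily zfamily fu gam1 Qv Qz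
  v0 z00 al1 cal' (uPn n) N0 aa at_ tb.
have B2 := bil_bound T0 a0 bT m0 w0 wD zfamily fv zfamily zfamily fu fu fu fu f0 f0 gam1 Qz Qu
  z00 u0 al1 cal' (uPn n) N0 aa at_ tb.
apply: le_trans (lerD B1 B2) _; rewrite /kap /Y3 !(mul0r, mulr0, add0r, addr0) /m.
have MS := mulr_ge0 M0 SS0; have PS' := PS.
have y1 : M * S + P * S0 <= 2 * M * S by lra.
have y2 : S0 * P * M <= M ^+ 2 * S.
  by have := ler_wpM2l M0 PS; rewrite expr2; lra.
have Nn : 0 <= N%:R :> R by [].
have NN0 : 0 <= (N * N)%:R :> R by [].
have NV : 0 <= N%:R^-1 :> R by rewrite invr_ge0.
have d0 : 0 <= b - a by rewrite subr_ge0.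
set n1 := (N * N)%:R; set nv := N%:R^-1.
set A := 8 * nv + (b - a) * (4 * n1).
set K := 16 * nv + (b - a) * (8 + 8 * N%:R + 80 * (2 * M)).
have A0 : 0 <= A by rewrite addr_ge0// !mulr_ge0.
have K0 : 0 <= K by rewrite addr_ge0// !mulr_ge0// !addr_ge0// !mulr_ge0.
(* The two bilinear forms, for Q(v, z) and Q(z, u), contribute at most 2 M S each. Their
   substitutions yield six nonzero trilinear norms of at most 3 M^2 S each, whence 18. *)
apply: (@le_trans _ _ (A * (4 * M * S) + K * (18 * M ^+ 2 * S))).
  have q1 : A * (P * S0 + M * S) <= A * (2 * M * S) by rewrite ler_wpM2l; lra.
  have q2 : A * (S * M + S0 * P) <= A * (2 * M * S) by rewrite ler_wpM2l; lra.
  have q3 := ler_wpM2l K0 y2; have q4 : K * (S * M * M) = K * (M ^+ 2 * S) by ring.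
  nra.
have := ler_wpM2l SS0 small; rewrite -/n1 -/nv /A /K; lra.
Qed.
End step.
End w.
End diff.

(** * Growth over long times *)

Section growth.
Variables (R : realType) (T : R).
Hypothesis T0 : 0 <= T.
Notation C := R[i].

(** Each of the two summands is made at most 1 / 4. Both N and d depend on M alone, so the interval
    of existence of the estimate does not shrink as time goes on. *)
Lemma small_choice (M : R) : 0 <= M -> exists2 N : nat, (0 < N)%N & exists2 d : R, 0 < d &
  forall a b, a <= b -> b - a <= d ->
  (32 * M + 288 * M ^+ 2) / N%:R +
  (b - a) * (16 * M * (N * N)%:R + 18 * M ^+ 2 * (8 + 8 * N%:R + 160 * M)) <= 2^-1.
Proof.
move=> M0; pose X := 32 * M + 288 * M ^+ 2.
have X0 : 0 <= X by have := sqr_ge0 M; rewrite /X; lra.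
pose N := (Num.bound (4 * X)).+1.
exists N => //; pose Y := 16 * M * (N * N)%:R + 18 * M ^+ 2 * (8 + 8 * N%:R + 160 * M).
have Y0 : 0 <= Y.
  have q1 : 0 <= M * (N * N)%:R by rewrite mulr_ge0.
  have q2 : 0 <= M ^+ 2 * N%:R by rewrite mulr_ge0 ?sqr_ge0.
  have q3 : 0 <= M ^+ 2 * M by rewrite mulr_ge0 ?sqr_ge0.
  have := sqr_ge0 M; rewrite /Y; lra.
exists (4^-1 / (Y + 1)); first by rewrite divr_gt0// ltr_wpDl.
move=> a b ab bad; rewrite -/X -/Y.
have h1 : X / N%:R <= 4^-1.
  rewrite ler_pdivrMr ?ltr0n// mulrC ler_pdivlMr//.
  have : 4 * X <= N%:R.
    by apply: ltW; apply: lt_trans (archi_boundP _) _; rewrite ?mulr_ge0// ltr_nat.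
  lra.
have h2 : (b - a) * Y <= 4^-1.
  apply: (@le_trans _ _ (4^-1 / (Y + 1) * (Y + 1))).
    by rewrite ler_pM ?subr_ge0// lerDl.
  by rewrite divfK// gt_eqF// ltr_wpDl.
lra.
Qed.

Lemma L2_closed (f : int -> R) X : 0 <= X -> (forall e, 0 < e -> L2 f (X + e)) -> L2 f X.
Proof.
move=> X0 H; have [f0 _ _] := H 1 ltr01; split=> // s us.
apply/ler_addgt0Pr => e e0.
pose d := Num.min 1 (e / (2 * X + 1)).
have X1 : 0 < 2 * X + 1 by rewrite ltr_wpDl// mulr_ge0.
have d0 : 0 < d by rewrite lt_min ltr01/= divr_gt0.
have [_ _ /(_ s us) h] := H d d0; apply: le_trans h _.
have dle : d * (2 * X + 1) <= e by rewrite -ler_pdivlMr// ge_min lexx orbT.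
have : d <= 1 by rewrite ge_min lexx.
nra.
Qed.

(** Iterating S -> Za + S / 2 from a finite bound approaches its fixed point 2 Za geometrically;
    this replaces taking a supremum and absorbing half of it. *)
Lemma halving (Pr : R -> Prop) Za S : 0 <= Za -> 0 <= S -> Pr S ->
  (forall S', 0 <= S' -> Pr S' -> Pr (Za + S' / 2)) ->
  forall e, 0 < e -> exists S', S' <= 2 * Za + e /\ Pr S'.
Proof.
move=> Za0 S0 PS HS e e0.
have Hn n : Pr (2 * Za + (S - 2 * Za) / 2 ^+ n) /\ 0 <= 2 * Za + (S - 2 * Za) / 2 ^+ n.
  elim: n => [|n [IH IH0]].
    by rewrite expr0 divr1 addrC subrK.
  have h := HS _ IH0 IH.
  have E : Za + (2 * Za + (S - 2 * Za) / 2 ^+ n) / 2 = 2 * Za + (S - 2 * Za) / 2 ^+ n.+1.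
    by rewrite exprS; field; rewrite expf_neq0.
  by rewrite -E; split=> //; rewrite addr_ge0// divr_ge0.
have [n hn] : exists n, (S / e) < 2 ^+ n.
  exists (Num.bound (S / e)); apply: lt_le_trans (archi_boundP _) _; first by rewrite divr_ge0// ltW.
  by rewrite -natrX ler_nat ltnW// ltn_expl.
exists (2 * Za + (S - 2 * Za) / 2 ^+ n); split; last by case: (Hn n).
rewrite lerD2l ler_pdivrMr ?exprn_gt0//.
apply: (@le_trans _ _ S); first by rewrite gerBl mulr_ge0.
by rewrite mulrC -ler_pdivrMr// ltW.
Qed.

(** The bound doubles on each interval of length d, and the interval [0, T] is covered by
    [Num.bound (T / d)] of them. *)
Lemma time_steps (w : int -> R) (z : R -> int -> C) d Z0 : 0 < d ->
  (forall a b Za, 0 <= a -> a <= b -> b <= T -> b - a <= d ->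
     L2 (fun k => w k * cabs (z a k)) Za ->
     forall t, a <= t <= b -> L2 (fun k => w k * cabs (z t k)) (2 * Za)) ->
  L2 (fun k => w k * cabs (z 0 k)) Z0 ->
  forall t, 0 <= t <= T -> L2 (fun k => w k * cabs (z t k)) (2 ^+ (Num.bound (T / d)) * Z0).
Proof.
move=> d0 H z0 t tT; have Z00 := L2_ge0 z0.
have Hj (j : nat) s : 0 <= s <= T -> s <= j%:R * d -> L2 (fun k => w k * cabs (z s k)) (2 ^+ j * Z0).
  elim: j s => [|j IH] s /andP[s0 sT] sj.
    have -> : s = 0 by apply/le_anti; rewrite s0 andbT; move: sj; rewrite mul0r.
    by rewrite expr0 mul1r.
  have [sj'|js] := leP s (j%:R * d).
    apply: (@L2_le _ _ _ (2 ^+ j * Z0)); last by apply: (IH s) => //; rewrite s0.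
      by move=> k; rewrite lexx andbT; have [f0 _ _] := IH s (introT andP (conj s0 sT)) sj'; exact: f0.
    by rewrite ler_wpM2r// exprS ler_peMl ?exprn_ge0// ler1n.
  have jd0 : 0 <= j%:R * d by rewrite mulr_ge0// ltW.
  rewrite exprS -mulrA; apply: (H (j%:R * d) s) => //; last by rewrite (ltW js) lexx.
  - exact: ltW.
  - by move: sj; rewrite -natr1 mulrDl mul1r; lra.
  - by apply: IH => //; rewrite jd0 (le_trans (ltW js)).
apply: Hj => //; case/andP: tT => t0 tT.
apply: le_trans tT _; rewrite -ler_pdivrMr//; apply: ltW; apply: archi_boundP.
by rewrite divr_ge0// ltW.
Qed.

Lemma solves_zero gam M : 0 <= M -> solves T gam (@zfam R) (@zfam R) M.
Proof.
move=> M0; split=> //; first by move=> k; exact: cprim_cst.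
  by move=> t _; exact: L2_wcabs_zero.
move=> t tT k; rewrite /zfam (_ : (fun n => _) = fun=> 0); first exact: ccvg_cst.
apply/funext => n; rewrite /Qpart big1 ?mulr0// => j _.
by rewrite /zfam ?mulr0 ?addr0 ?mulr0.
Qed.

(** K is chosen before w, gam, v and S: it is uniform over capped weights and over Galerkin cutoffs.
    The finite bound S serves to start [halving], and disappears in the limit. *)
Lemma apriori_growth M : 0 <= M -> exists2 K : R, 0 <= K &
  forall (w : int -> R) gam v dv S Z0,
  (forall k, 0 <= w k) -> (forall i j, w (i + j) <= w i + w j) ->
  (forall k, cabs (gam k) <= 1) -> solves T gam v dv M ->
  (forall t, 0 <= t <= T -> L2 (fun k => w k * cabs (v t k)) S) ->
  L2 (fun k => w k * cabs (v 0 k)) Z0 ->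
  forall t, 0 <= t <= T -> L2 (fun k => w k * cabs (v t k)) (K * Z0).
Proof.
move=> M0; have [N N0 [d d0 sm]] := small_choice M0.
exists (2 ^+ (Num.bound (T / d))); first by rewrite exprn_ge0.
move=> w gam v dv S Z0 w0 wD gam1 sv vS vZ t tT.
apply: time_steps => // a b Za a0 ab bT bad vZa s sab.
have inT x : a <= x <= b -> 0 <= x <= T.
  by move=> /andP[ax xb]; rewrite (le_trans a0 ax) (le_trans xb bT).
have Za0 := L2_ge0 vZa.
have S0 : 0 <= S by apply: (L2_ge0 (vS a _)); rewrite a0 (le_trans ab).
pose Pr X := forall x, a <= x <= b -> L2 (fun k => w k * cabs (v x k)) X.
have PS : Pr S by move=> x /inT; exact: vS.
have vz x k : cabs (v x k - @zfam R x k) = cabs (v x k) by rewrite /zfam subr0.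
have st S' : 0 <= S' -> Pr S' -> Pr (Za + S' / 2).
  move=> S'0 PS' x xab.
  have sz := solves_zero gam M0.
  have e1 y : (fun k => w k * cabs (v y k - @zfam R y k)) = (fun k => w k * cabs (v y k)).
    by apply/funext => k; rewrite vz.
  have e2 y : (fun k => cabs (v y k - @zfam R y k)) = (fun k => cabs (v y k)).
    by apply/funext => k; rewrite vz.
  have h1 y : a <= y <= b -> L2 (fun k => w k * cabs (v y k - @zfam R y k)) S' by rewrite e1; exact: PS'.
  have h2 y : a <= y <= b -> L2 (fun k => cabs (v y k - @zfam R y k)) M.
    by rewrite e2 => /inT yT; case: sv => _ _ h _; exact: h.
  have h3 : L2 (fun k => w k * cabs (v a k - @zfam R a k)) Za by rewrite e1.
  have PM : S' * M <= M * S' by rewrite mulrC.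
  have := diff_step T0 w0 wD gam1 sv sz a0 ab bT N0 M0 PS' (fun t _ => L2_cabs_zero t w S'0)
    h1 h2 h3 PM (sm a b ab bad) xab.
  by rewrite e1.
apply: L2_closed => [|e e0]; first by rewrite mulr_ge0.
have [S' [S'e PS']] := halving Za0 S0 PS st e0.
apply: (L2_le _ S'e (PS' s sab)) => k.
by rewrite lexx andbT mulr_ge0// cabs_ge0.
Qed.

(** M bounds the weighted norms as well as the l^2 norms, and [w >= 1] off 0 makes the l^2 norm of
    the difference at most its weighted norm, as [diff_step] requires with S0 = S. *)
Lemma lipschitz_growth M : 0 <= M -> exists2 K : R, 0 <= K &
  forall (w : int -> R) gam v dv u du Z0,
  (forall k, 0 <= w k) -> (forall i j, w (i + j) <= w i + w j) -> (forall k, k != 0 -> 1 <= w k) ->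
  (forall k, cabs (gam k) <= 1) -> solves T gam v dv M -> solves T gam u du M ->
  (forall t, 0 <= t <= T -> L2 (fun k => w k * cabs (v t k)) M) ->
  (forall t, 0 <= t <= T -> L2 (fun k => w k * cabs (u t k)) M) ->
  L2 (fun k => w k * cabs (v 0 k - u 0 k)) Z0 ->
  forall t, 0 <= t <= T -> L2 (fun k => w k * cabs (v t k - u t k)) (K * Z0).
Proof.
move=> M0; have [N N0 [d d0 sm]] := small_choice M0.
exists (2 ^+ (Num.bound (T / d))); first by rewrite exprn_ge0.
move=> w gam v dv u du Z0 w0 wD w1 gam1 sv su vM uM zZ t tT.
pose z x k := v x k - u x k.
apply: (time_steps (z := z)) => // a b Za a0 ab bT bad zZa s sab.
have inT x : a <= x <= b -> 0 <= x <= T.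
  by move=> /andP[ax xb]; rewrite (le_trans a0 ax) (le_trans xb bT).
have Za0 := L2_ge0 zZa.
pose Pr X := forall x, a <= x <= b -> L2 (fun k => w k * cabs (z x k)) X.
have PS : Pr (M + M).
  by move=> x /inT xT; apply: L2_cabs_add (vM x xT) (L2_cabs_opp (uM x xT)).
have st S' : 0 <= S' -> Pr S' -> Pr (Za + S' / 2).
  move=> S'0 PS'.
  have h2 y : a <= y <= b -> L2 (fun k => cabs (z y k)) S'.
    move=> yab; apply: (L2_le _ (lexx _) (PS' y yab)) => k; rewrite cabs_ge0/=.
    have [->|k0] := eqVneq k 0; last by rewrite ler_peMl ?cabs_ge0// w1.
    by rewrite /z; case: sv su => -> _ _ _ [-> _ _ _]; rewrite subrr cabs0 mulr0.
  exact: (diff_step T0 w0 wD gam1 sv su a0 ab bT N0 M0 (fun y yab => vM y (inT y yab))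
     (fun y yab => uM y (inT y yab)) PS' h2 zZa (lexx _) (sm a b ab bad)).
apply: L2_closed => [|e e0]; first by rewrite mulr_ge0.
have [S' [S'e PS']] := halving Za0 (addr_ge0 M0 M0) PS st e0.
apply: (L2_le _ S'e (PS' s sab)) => k.
by rewrite lexx andbT mulr_ge0// cabs_ge0.
Qed.
End growth.

(** * Weights *)

Section weights.
Variable R : realType.
Implicit Types (s : R) (v : int -> R[i]).

(** x / (x + y) and y / (x + y) lie in [0, 1] and add up to 1, and r <= r^s for such r. *)
Lemma powR_subadd (x y s : R) : 0 <= x -> 0 <= y -> 0 < s <= 1 -> (x + y) `^ s <= x `^ s + y `^ s.
Proof.
move=> x0 y0 /andP[s0 s1].
have [->|xn] := eqVneq x 0; first by rewrite add0r lerDr powR_ge0.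
have [->|yn] := eqVneq y 0; first by rewrite addr0 lerDl powR_ge0.
have xp : 0 < x by rewrite lt_neqAle eq_sym xn.
have yp : 0 < y by rewrite lt_neqAle eq_sym yn.
have xyp : 0 < x + y by rewrite addr_gt0.
have h z : 0 < z -> z <= x + y -> z / (x + y) * (x + y) `^ s <= z `^ s.
  move=> zp zxy; have zq : 0 < z / (x + y) <= 1 by rewrite divr_gt0//= ler_pdivrMr// mul1r.
  have -> : z `^ s = (z / (x + y)) `^ s * (x + y) `^ s.
    by rewrite -powRM ?divfK ?gt_eqF//; [apply: divr_ge0|]; exact: ltW.
  by rewrite ler_wpM2r ?powR_ge0// ger1_powR.
have h1 := h x xp; have h2 := h y yp.
apply: le_trans (lerD (h1 _) (h2 _)); rewrite ?lerDl ?lerDr//.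
by rewrite -mulrDl -mulrDl divff ?mul1r// gt_eqF.
Qed.

(* For l^2 solutions the norm with weight [wcap] is finite beforehand, with weight [wfull] it is not. *)
Definition wcap s (K : nat) (k : int) : R := (minn (absz k) K)%:R `^ s.
Definition wfull s (k : int) : R := (absz k)%:R `^ s.

Lemma wcap_ge0 s K k : 0 <= wcap s K k. Proof. exact: powR_ge0. Qed.
Lemma wfull_ge0 s k : 0 <= wfull s k. Proof. exact: powR_ge0. Qed.

Lemma wcapD s K i j : 0 < s <= 1 -> wcap s K (i + j) <= wcap s K i + wcap s K j.
Proof.
move=> s01; apply: le_trans (powR_subadd _ _ s01); rewrite ?ler0n//.
case/andP: s01 => s0 _; apply: ge0_ler_powR; rewrite ?nnegrE ?addr_ge0 ?ler0n ?(ltW s0)//.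
rewrite -natrD ler_nat; lia.
Qed.

Lemma wfullD s i j : 0 < s <= 1 -> wfull s (i + j) <= wfull s i + wfull s j.
Proof.
move=> s01; apply: le_trans (powR_subadd _ _ s01); rewrite ?ler0n//.
case/andP: s01 => s0 _; apply: ge0_ler_powR; rewrite ?nnegrE ?addr_ge0 ?ler0n ?(ltW s0)//.
rewrite -natrD ler_nat; lia.
Qed.

Lemma wfull_ge1 s k : 0 < s -> k != 0 -> 1 <= wfull s k.
Proof.
move=> s0 k0; have <- : 1 `^ s = 1 by rewrite powR1.
apply: ge0_ler_powR; rewrite ?nnegrE ?ler0n ?(ltW s0)//.
by rewrite ler1n absz_gt0.
Qed.

Lemma wcap_le s K k : 0 < s -> wcap s K k <= wfull s k.
Proof.
move=> s0; apply: ge0_ler_powR; rewrite ?nnegrE ?ler0n ?(ltW s0)//.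
by rewrite ler_nat geq_minl.
Qed.

Lemma wcap_bound s K k : 0 < s -> wcap s K k <= K%:R `^ s.
Proof.
move=> s0; apply: ge0_ler_powR; rewrite ?nnegrE ?ler0n ?(ltW s0)//.
by rewrite ler_nat geq_minr.
Qed.

Lemma wcap_wfull s K k : (absz k <= K)%N -> wcap s K k = wfull s k.
Proof. by move=> kK; rewrite /wcap /wfull (minn_idPl kK). Qed.

Lemma L2_wcap_wfull s (f : int -> R) M : 0 < s -> (forall k, 0 <= f k) ->
  (forall K, L2 (fun k => wcap s K k * f k) M) -> L2 (fun k => wfull s k * f k) M.
Proof.
move=> s0 f0 H; split=> [k| |r ur]; [by rewrite mulr_ge0 ?wfull_ge0|exact: L2_ge0 (H 0%N)|].
have [_ _ /(_ r ur)] := H (\max_(k <- r) absz k); apply: le_trans.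
apply: ler_of_eq; apply: eq_big_seq => k kr; rewrite wcap_wfull//.
by apply: leq_bigmax_seq.
Qed.

(** The statement imposes no equation at the index 0, while [solves] and the unrestricted sums over
    the integers need the entry there to be 0. *)
Definition off0 v : int -> R[i] := fun k => if k == 0 then 0 else v k.

(* At [s = 0] the weight [wfull 0 0] is [1], hence the explicit removal of the index 0. *)
Lemma hs_normP s v M : 0 <= M ->
  (hs_norm s v <= M%:E)%E <-> L2 (fun k => wfull s k * cabs (off0 v k)) M.
Proof.
move=> M0.
have sqE k : k != 0 -> (wfull s k * cabs (off0 v k)) ^+ 2 = hs_weight s k * abs2 (v k).
  move=> k0; rewrite exprMn cabs_sq /off0 (negbTE k0) /wfull /hs_weight; congr (_ * _).
  by rewrite [2 * s]mulrC powRrM powR_mulrn ?powR_ge0.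
have a0 k : 0 <= hs_weight s k * abs2 (v k) by rewrite mulr_ge0 ?powR_ge0 ?abs2_ge0.
have sumE (r : seq int) : all (fun k => k != 0) r ->
    \sum_(k <- r) (wfull s k * cabs (off0 v k)) ^+ 2 = \sum_(k <- r) hs_weight s k * abs2 (v k).
  by move=> /allP r0; apply: eq_big_seq => k /r0; exact: sqE.
have key : (hs_norm s v <= M%:E)%E <-> (hs_norm2 s v <= (M ^+ 2)%:E)%E.
  have n0 : (0 <= hs_norm2 s v)%E by apply: esum_ge0 => k _; rewrite lee_fin.
  rewrite /hs_norm; case: (hs_norm2 s v) n0 => [r|//|//]; rewrite !lee_fin => r0.
  split=> [h|h].
    by rewrite -(sqr_sqrtr r0) lerXn2r ?nnegrE ?sqrtr_ge0.
  by rewrite -(ger0_norm M0) -sqrtr_sqr ler_wsqrtr.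
split=> [/key h|[_ _ h]].
  split=> [k|//|r ur]; first by rewrite mulr_ge0 ?wfull_ge0 ?cabs_ge0.
  rewrite (bigID (fun k => k == 0))/= big1 ?add0r; last first.
    by move=> k /eqP ->; rewrite /off0 eqxx cabs0 mulr0 expr0n.
  rewrite -big_filter sumE; last by apply/allP => k; rewrite mem_filter => /andP[].
  rewrite -lee_fin; apply: le_trans h; apply: esum_ge.
  exists [set` [seq k <- r | k != 0]].
    split; first exact: finite_seq.
    by move=> k /=; rewrite mem_filter => /andP[].
  by rewrite -fsbig_seq ?filter_uniq//= sumEFin.
apply/key; apply: ge_ereal_sup => _ [A [fA A0] <-].
rewrite fsbig_finite//= sumEFin lee_fin -sumE; last first.
  by apply/allP => k; rewrite in_fset_set// inE => /A0.
by apply: h; exact: finmap.fset_uniq.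
Qed.

Lemma hs_norm_ge0 s v : (0 <= hs_norm s v)%E.
Proof. by rewrite /hs_norm; case: (hs_norm2 s v) => [r| |]//; rewrite lee_fin sqrtr_ge0. Qed.

Lemma hs_norm2_fin s v : (hs_norm2 s v < +oo)%E -> exists2 M, 0 <= M & hs_norm s v = M%:E.
Proof.
have n0 : (0 <= hs_norm2 s v)%E.
  by apply: esum_ge0 => k _; rewrite lee_fin mulr_ge0 ?powR_ge0 ?abs2_ge0.
rewrite /hs_norm; case: (hs_norm2 s v) n0 => [r|//|//] _ _.
by exists (Num.sqrt r); rewrite ?sqrtr_ge0.
Qed.

Lemma hs_norm_fin s v M : (hs_norm s v <= M%:E)%E -> (hs_norm2 s v < +oo)%E.
Proof. by rewrite /hs_norm; case: (hs_norm2 s v) => [r| |]; rewrite ?ltry. Qed.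

Lemma wfull0 k : wfull 0 k = 1. Proof. by rewrite /wfull powRr0. Qed.

Lemma hs_norm0P v M : 0 <= M -> (hs_norm 0 v <= M%:E)%E <-> L2 (fun k => cabs (off0 v k)) M.
Proof.
move=> M0; rewrite hs_normP//.
by under eq_fun do rewrite wfull0 mul1r.
Qed.

(** Fatou's lemma for sequences: each finite sum of squares is continuous in the coefficients. *)
Lemma L2_ccvg (w : int -> R) (u : nat -> int -> R[i]) l M : (forall k, 0 <= w k) ->
  (forall k, ccvg (fun n => u n k) (l k)) -> (forall n, L2 (fun k => w k * cabs (u n k)) M) ->
  L2 (fun k => w k * cabs (l k)) M.
Proof.
move=> w0 ul uM; split=> [k| |r ur]; [by rewrite mulr_ge0 ?cabs_ge0|exact: L2_ge0 (uM 0%N)|].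
have h : (fun n => \sum_(k <- r) (w k * cabs (u n k)) ^+ 2) @ \oo --> \sum_(k <- r) (w k * cabs (l k)) ^+ 2.
  elim: r {ur} => [|k r IH].
    by rewrite big_nil; under eq_fun do rewrite big_nil; exact: cvg_cst.
  rewrite big_cons; under eq_fun do rewrite big_cons; apply: cvgD => //.
  rewrite exprMn cabs_sq; under eq_fun do rewrite exprMn cabs_sq.
  have [u1 u2] := ul k; rewrite /abs2.
  apply: cvgM; first exact: cvg_cst.
  by rewrite !expr2; apply: cvgD; apply: cvgM.
apply: (cvgr_to_le h); apply: nearW => n.
by have [_ _] := uM n; apply.
Qed.

End weights.

(** * Convergence of the convolution series *)

Section limits.
Variable R : realType.

Lemma mem_box n j : (j \in box n) = (absz j <= n)%N.
Proof.
apply/mapP/idP => [[m]|jn]; first by rewrite mem_iota => ? ->; lia.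
exists (absz (j + n%:Z)); first by rewrite mem_iota; lia.
by lia.
Qed.

(** r = (|r| + r) - |r| is a difference of nonnegative families, whose symmetric partial sums are
    monotone and bounded. *)
Lemma cvg_box (r : int -> R) B : (forall s, uniq s -> \sum_(j <- s) `|r j| <= B) ->
  cvgn (fun n => \sum_(j <- box n) r j).
Proof.
move=> rB.
have nd (q : int -> R) C : (forall j, 0 <= q j) -> (forall s, uniq s -> \sum_(j <- s) q j <= C) ->
    cvgn (fun n => \sum_(j <- box n) q j).
  move=> q0 qC; apply: nondecreasing_is_cvgn.
    move=> m n mn; apply: sum_superset => //; first exact: box_uniq.
    by move=> j; rewrite !mem_box => /leq_trans; apply.
  by exists C => _ [n _ <-]; apply: qC; exact: box_uniq.
have c1 := nd (fun j => `|r j|) B (fun j => normr_ge0 _) rB.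
have c2 : cvgn (fun n => \sum_(j <- box n) (`|r j| + r j)).
  apply: (nd _ (B + B)) => [j|s us]; first by have := ler_norm (- r j); rewrite normrN; lra.
  rewrite big_split lerD ?rB//; apply: le_trans (rB s us).
  by apply: ler_sum => j _; exact: ler_norm.
have -> : (fun n => \sum_(j <- box n) r j) =
    (fun n => \sum_(j <- box n) (`|r j| + r j)) \- (fun n => \sum_(j <- box n) `|r j|).
  by apply/funext => n /=; rewrite big_split/= addrAC subrr add0r.
exact: is_cvgB.
Qed.

Lemma ccvg_box (F : int -> R[i]) B : (forall s, uniq s -> \sum_(j <- s) cabs (F j) <= B) ->
  ccvg (fun n => \sum_(j <- box n) F j)
    ((limn (fun n => complex.Re (\sum_(j <- box n) F j))) +i*
     (limn (fun n => complex.Im (\sum_(j <- box n) F j)))).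
Proof.
move=> FB; split => /=.
- under eq_fun do rewrite Re_sum; apply: (cvg_box (B := B)) => s us.
  by apply: le_trans (FB s us); apply: ler_sum => j _; exact: cabs_Re.
- under eq_fun do rewrite Im_sum; apply: (cvg_box (B := B)) => s us.
  by apply: le_trans (FB s us); apply: ler_sum => j _; exact: cabs_Im.
Qed.

Lemma conv_partialE (u : seqC R) k tau n : conv_partial u k tau n =
  \sum_(j <- box n) expi (phase2 R k j * tau) * (off0 u j * off0 u (k - j)).
Proof.
rewrite /box big_map /conv_partial -[iota 0 _]/(index_iota 0 (2 * n).+1).
rewrite big_mkord; apply: eq_bigr => j _ /=.
rewrite /off0 /phase2; set k1 := (_ - _ : int).
case: (k1 == 0) => /=; first by rewrite mul0r mulr0.
by case: (k - k1 == 0) => /=; rewrite ?mulr0// mulrA.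
Qed.

Lemma conv_ccvg (u : seqC R) k tau M : L2 (fun k => cabs (off0 u k)) M ->
  ccvg (fun n => conv_partial u k tau n) (Defs.conv u k tau).
Proof.
move=> uM.
have h : forall s, uniq s -> \sum_(j <- s) cabs (expi (phase2 R k j * tau) * (off0 u j * off0 u (k - j))) <= M * M.
  move=> s us; rewrite (eq_bigr (fun j => cabs (off0 u j) * cabs (off0 u (k - j)))).
    by apply: (L2_cs us uM); exact: (L2_sub k uM).
  by move=> j _; rewrite cabsM cabs_expi mul1r cabsM.
have := ccvg_box h; rewrite /Defs.conv.
have -> : (fun n => conv_partial u k tau n) = fun n => \sum_(j <- box n)
   expi (phase2 R k j * tau) * (off0 u j * off0 u (k - j)).
  by apply/funext => n; exact: conv_partialE.
by have -> : conv_partial u k tau = fun n => \sum_(j <- box n)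
   expi (phase2 R k j * tau) * (off0 u j * off0 u (k - j))
  by apply/funext => n; exact: conv_partialE.
Qed.

Lemma conv_le (u : seqC R) k tau M : L2 (fun k => cabs (off0 u k)) M -> cabs (Defs.conv u k tau) <= M * M.
Proof.
move=> uM; apply: ccvg_cabs_le (conv_ccvg k tau uM) => n; rewrite conv_partialE.
apply: le_trans (cabs_sum _ _) _; rewrite (eq_bigr (fun j => cabs (off0 u j) * cabs (off0 u (k - j)))).
  by apply: (L2_cs (box_uniq n) uM); exact: (L2_sub k uM).
by move=> j _; rewrite cabsM cabs_expi mul1r cabsM.
Qed.

(** The Cauchy criterion with countably many conditions, which makes a set of convergence
    measurable. *)
Lemma cauchy_cvgn (u : nat -> R) :
  (forall p : nat, exists N : nat, forall m, (N <= m)%N -> `|u N - u m| <= p.+1%:R^-1) <-> cvgn u.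
Proof.
split=> [H|/cvg_ex[l ul] p].
  apply/cauchy_cvgP; apply: cauchy_exP => e e0.
  have [p pe] : exists p : nat, p.+1%:R^-1 < e.
    exists (Num.bound e^-1); rewrite invf_plt ?posrE ?ltr0n//.
    by apply: lt_trans (archi_boundP _) _; rewrite ?invr_ge0 ?(ltW e0)// ltr_nat.
  have [N HN] := H p; exists (u N); exists N => // m /= Nm.
  by rewrite /ball/=; apply: le_lt_trans (HN m Nm) pe.
have e0 : (0 : R) < p.+1%:R^-1 / 2 by rewrite divr_gt0.
move/cvgrPdist_le: ul => /(_ _ e0) [N _ HN]; exists N => m Nm.
have h1 := HN N (leqnn N); have h2 := HN m Nm.
have -> : u N - u m = (l - u m) - (l - u N) by ring.
by apply: le_trans (ler_normB _ _) _; apply: le_trans (lerD h2 h1) _; rewrite -splitr.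
Qed.

(** [limn] of a divergent sequence is [point], so on the measurable set Cv of convergence and on its
    complement the value is a pointwise limit of measurable functions. The integrand [conv] needs
    this, its series being known at first to converge only for almost every time. *)
Lemma measurable_limn (D : set R) (u : nat -> R -> R) : measurable D ->
  (forall n, measurable_fun D (u n)) -> measurable_fun D (fun x => limn (u ^~ x)).
Proof.
move=> mD mu.
pose A p N m := D `&` [set x | `|u N x - u m x| <= p.+1%:R^-1].
pose Cv := \bigcap_p \bigcup_N \bigcap_(m in [set m | (N <= m)%N]) A p N m.
have mA p N m : measurable (A p N m).
  have mf : measurable_fun D (fun x => `|u N x - u m x|).
    by apply: measurableT_comp => //; exact: measurable_funB.
  have := mf mD `]-oo, p.+1%:R^-1]%classic (measurable_itv _).
  rewrite (_ : _ `&` _ = A p N m)//; apply/seteqP; split=> x /=; by rewrite ?in_itv.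
have mCv : measurable Cv.
  apply: bigcap_measurable => [|p _]; first by exists 0%N.
  apply: bigcup_measurable => N _.
  apply: bigcap_measurable => [|m _]; last exact: mA.
  by exists N => /=.
have CvP x : D x -> Cv x <-> cvgn (u ^~ x).
  move=> Dx; rewrite -cauchy_cvgn; split=> [H p|H p _].
    have [N _ HN] := H p Logic.I; exists N => m Nm; by case: (HN m Nm).
  by have [N HN] := H p; exists N => // m Nm; split=> //; exact: HN.
pose h n x := u n x * \1_Cv x + (point : R) * (1 - \1_Cv x) : R.
have mh n : measurable_fun D (h n).
  have m1 : measurable_fun D (\1_Cv : R -> R) by exact: measurable_indic.
  apply: measurable_funD; first exact: measurable_funM.
  by apply: measurable_funM => //; exact: measurable_funB.
apply: measurable_fun_cvg mh _ => x Dx; rewrite /h.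
have [cx|ncx] := pselect (cvgn (u ^~ x)).
  have Cx : Cv x by apply/CvP.
  have xC := mem_set Cx.
  rewrite indicE xC subrr mulr0; under eq_fun do rewrite mulr1 addr0.
  exact: cx.
have nCx : ~ Cv x by move/(CvP x Dx).
have xC := memNset nCx.
rewrite indicE xC (dvgP ncx); under eq_fun do rewrite mulr0 add0r subr0 mulr1.
exact: cvg_cst.
Qed.
End limits.

(** * Solutions as families of primitives *)

Section solution.
Variables (R : realType) (T : R).
Hypothesis Tpos : 0 < T.
Let T0 : 0 <= T. Proof. exact: ltW. Qed.
Notation C := R[i].
Notation mu := (@lebesgue_measure R).

Definition cmeas (f : R -> C) := measurable_fun `[0, T] (fun t => complex.Re (f t)) /\
  measurable_fun `[0, T] (fun t => complex.Im (f t)).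

Let mfE (F G : R -> R) : (forall t, F t = G t) -> measurable_fun `[0, T] F -> measurable_fun `[0, T] G.
Proof. by move=> /funext ->. Qed.

Lemma cmeasD f g : cmeas f -> cmeas g -> cmeas (fun t => f t + g t).
Proof.
move=> [a b] [c d]; split.
- by apply: mfE (measurable_funD a c) => t; rewrite ReD.
- by apply: mfE (measurable_funD b d) => t; rewrite ImD.
Qed.
Lemma cmeasM f g : cmeas f -> cmeas g -> cmeas (fun t => f t * g t).
Proof.
move=> [a b] [c d]; split.
- by apply: mfE (measurable_funB (measurable_funM a c) (measurable_funM b d)) => t; rewrite ReM.
- by apply: mfE (measurable_funD (measurable_funM a d) (measurable_funM b c)) => t; rewrite ImM.
Qed.
Lemma cmeas_cst c : cmeas (fun=> c). Proof. by split; exact: measurable_cst. Qed.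
Lemma cmeas_sum (I : Type) (s : seq I) (u : I -> R -> C) : (forall i, cmeas (u i)) ->
  cmeas (fun t => \sum_(i <- s) u i t).
Proof.
move=> ul; elim: s => [|i s IH].
  by under eq_fun do rewrite big_nil; exact: cmeas_cst.
by under eq_fun do rewrite big_cons; exact: cmeasD.
Qed.
Lemma cbdmeas_cmeas f : cbdmeas T f -> cmeas f. Proof. by case=> [[? _] [? _]]. Qed.
Lemma cmeas_bounded f B : cmeas f -> (forall t, 0 <= t <= T -> cabs (f t) <= B) -> cbdmeas T f.
Proof.
move=> [a b] fB; split; split=> //; exists B => t tT.
- exact: le_trans (cabs_Re _) (fB t tT).
- exact: le_trans (cabs_Im _) (fB t tT).
Qed.

Lemma null_dense (N : set R) t e : measurable N -> mu N = 0%E -> 0 <= t <= T -> 0 < e ->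
  exists2 t', 0 <= t' <= T & `|t' - t| <= e /\ ~ N t'.
Proof.
move=> mN N0 /andP[t0 tT] e0; have Tp := Tpos; apply: contrapT => H.
pose a := Num.max 0 (t - e); pose b := Num.min T (t + e).
have ab : a < b by rewrite gt_max !lt_min; apply/andP; split; apply/andP; split; lra.
have sub : `[a, b]%classic `<=` N.
  move=> x /=; rewrite in_itv/= /a /b ge_max le_min => /andP[/andP[x0 xe1] /andP[xT xe2]].
  apply: contrapT => nN; apply: H; exists x; first by rewrite x0.
  by split=> //; rewrite ler_norml; lra.
have : (mu `[a, b]%classic <= mu N)%E by apply: le_measure; rewrite ?inE.
rewrite N0 lebesgue_measure_itv/= lte_fin ab -EFinB lee_fin; lra.
Qed.

(** The task is to upgrade the almost everywhere l^2 bound to every t; then the convolution series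
    converges at every time and defines [dv]. *)
Lemma solves_of_solution v0 v : is_solution T v0 v ->
  exists2 M, 0 <= M & exists2 dv, solves T (fun=> 1) (fun t => off0 (v t)) dv M &
    forall k, k != 0 -> v 0 k = v0 k.
Proof.
move=> [mv [M' [N [mN N0 HN]]] eqv].
pose M := `|M'|; have M0 : 0 <= M by exact: normr_ge0.
have good t : 0 <= t <= T -> ~ N t -> L2 (fun k => cabs (off0 (v t) k)) M.
  move=> tT nNt; apply/hs_norm0P => //.
  have [] : in_Hs 0 (v t) /\ (hs_norm 0 (v t) <= M'%:E)%E.
    by apply: contrapT => h; apply: nNt; apply: HN => /= /(_ tT).
  move=> _ /le_trans; apply; rewrite lee_fin; exact: ler_norm.
have cv k : cmeas (fun t => off0 (v t) k).
  rewrite /off0; case: (k == 0); first exact: cmeas_cst.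
  exact: mv.
pose f k t := Defs.conv (v t) k t.
have mf k : cmeas (f k).
  have mp n : cmeas (fun t => conv_partial (v t) k t n).
    under eq_fun do rewrite conv_partialE.
    apply: cmeas_sum => j; apply: cmeasM; first exact: (cbdmeas_cmeas (cprim_cbdmeas T0 (cprim_expi T0 _))).
    by apply: cmeasM; exact: cv.
  split; rewrite /f /Defs.conv/=.
  - by apply: measurable_limn => // n; case: (mp n).
  - by apply: measurable_limn => // n; case: (mp n).
(* On the null set N the value of [conv] is out of control; putting 0 there gives a function bounded
   everywhere with the same integrals. *)
pose ft k t := f k t * (\1_(~` N) t)%:C.
have mft k : cmeas (ft k).
  apply: cmeasM => //; split=> /=; last exact: measurable_cst.
  by apply: measurable_indic; exact: measurableC.
have ft1 k t : 0 <= t <= T -> cabs (ft k t) <= M * M.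
  move=> tT; rewrite /ft cabsM cabs_real indicE.
  have [nNt|Nt] := pselect (N t).
    by rewrite memNset ?normr0 ?mulr0 ?mulr_ge0//=; apply.
  by rewrite mem_set// normr1 mulr1; apply: conv_le; exact: good.
have bft k : cbdmeas T (ft k) by exact: cmeas_bounded (mft k) (ft1 k).
have aeE (g h : R -> R) t : t <= T -> measurable_fun `[0, T] g -> measurable_fun `[0, T] h ->
    (forall x, ~ N x -> g x = h x) -> rint t g = rint t h.
  move=> tT mg mh gh; rewrite /rint /Rintegral; congr fine.
  have sub : `[0, t] `<=` `[0, T] by apply: subset_itvl; rewrite bnd_simp.
  apply: ae_eq_integral => //.
  - by apply/measurable_EFinP; exact: measurable_funS mg.
  - by apply/measurable_EFinP; exact: measurable_funS mh.
  - exists N; split=> // x /= h1; apply: contrapT => nN; apply: h1 => _.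
    by rewrite gh.
have intE k t : t <= T -> cintegral t (f k) = cintegral t (ft k).
  move=> tT; have H x : ~ N x -> f k x = ft k x.
    by move=> nN; rewrite /ft indicE mem_set// mulr1.
  apply: complex_eq; apply: aeE => //; try (by case: (mf k)); try (by case: (mft k));
    by move=> x /H ->.
have pft k : cprim T (fun t => off0 (v t) k) (fun t => half_ik R k * ft k t).
  have [->|k0] := eqVneq k 0.
    rewrite /off0 eqxx /half_ik mul0r mulr0.
    by under [X in cprim _ _ X]eq_fun do rewrite mul0r; exact: cprim_cst.
  apply: (eq_cprim _ _ (cprimD (cprim_cst T (v0 k)) (cprimZ T0 (half_ik R k) (cprim_int (bft k))))).
  - move=> t tT; rewrite /off0 (negbTE k0).
    have := eqv k k0 t tT; rewrite -/(half_ik R k) => /eqP; rewrite subr_eq addrC => /eqP ->.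
    by rewrite -intE//; case/andP: tT.
  - by move=> t _; rewrite add0r.
(* Every time is a limit of times off N. The coefficients are Lipschitz by the integral equation, so
   the bound at those times reaches t by Fatou. *)
have all t : 0 <= t <= T -> L2 (fun k => cabs (off0 (v t) k)) M.
  move=> tT.
  have /choice[tn Htn] : forall n : nat, exists t', 0 <= t' <= T /\ (`|t' - t| <= n.+1%:R^-1 /\ ~ N t').
    move=> n; have [|t' h1 h2] := @null_dense N t n.+1%:R^-1 mN N0 tT _; first by rewrite invr_gt0.
    by exists t'.
  have lim k : ccvg (fun n => off0 (v (tn n)) k) (off0 (v t) k).
    apply: ccvgP => e e0.
    pose L := cabs (half_ik R k) * (M * M).
    have L0 : 0 <= L by rewrite mulr_ge0 ?cabs_ge0// mulr_ge0.
    have lip a b : 0 <= a -> a <= b -> b <= T -> cabs (off0 (v b) k - off0 (v a) k) <= 2 * L * (b - a).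
      move=> a0 ab bT; apply: (cprim_lip (pft k)) => // x /andP[ax xb].
      by rewrite cabsM ler_wpM2l ?cabs_ge0// ft1// (le_trans a0 ax) (le_trans xb bT).
    near=> n.
    have [/andP[s0 sT] [st _]] := Htn n; case/andP: (tT) => t0 tT'.
    have h : cabs (off0 (v (tn n)) k - off0 (v t) k) <= 2 * L * `|tn n - t|.
      have [le|/ltW le] := leP (tn n) t.
        by rewrite -cabsN opprB distrC ger0_norm ?subr_ge0//; exact: lip.
      by rewrite ger0_norm ?subr_ge0//; exact: lip.
    apply: le_trans h _; apply: (@le_trans _ _ (2 * L * n.+1%:R^-1)).
      by rewrite ler_wpM2l// mulr_ge0.
    rewrite ler_pdivrMr ?ltr0n// [leRHS]mulrC -ler_pdivrMr//.
    near: n; exists (Num.bound (2 * L / e)) => // n /= hn.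
    apply: ltW; apply: lt_le_trans (archi_boundP _) _; first by rewrite divr_ge0 ?(ltW e0)// mulr_ge0.
    by rewrite ler_nat ltnW.
  have := @L2_ccvg R (fun=> 1) (fun n => off0 (v (tn n))) (off0 (v t)) M (fun=> ler01) lim.
  have e1 (u : int -> C) : (fun k => 1 * cabs (u k)) = fun k => cabs (u k).
    by apply/funext => k; rewrite mul1r.
  rewrite e1; apply=> n; rewrite e1.
  by have [h1 [_ h2]] := Htn n; exact: good.
have bf k : cbdmeas T (f k).
  by apply: (cmeas_bounded (mf k) (B := M * M)) => t tT; apply: conv_le; exact: all.
exists M => //; exists (fun t k => half_ik R k * f k t); last first.
  move=> k k0; have := eqv k k0 0; rewrite lexx T0 => /(_ isT).
  by rewrite cintegral0 mulr0 => /eqP; rewrite subr_eq0 => /eqP.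
split=> //.
- move=> k; have [->|k0] := eqVneq k 0.
    rewrite /off0 eqxx /half_ik mul0r mulr0.
    by under [X in cprim _ _ X]eq_fun do rewrite mul0r; exact: cprim_cst.
  apply: (eq_cprim _ _ (cprimD (cprim_cst T (v0 k)) (cprimZ T0 (half_ik R k) (cprim_int (bf k))))).
  - move=> t tT; rewrite /off0 (negbTE k0).
    by have := eqv k k0 t tT; rewrite -/(half_ik R k) => /eqP; rewrite subr_eq addrC => /eqP ->.
  - by move=> t _; rewrite add0r.
- move=> t tT k.
  have h := ccvgM (ccvg_cst (half_ik R k)) (conv_ccvg k t (all t tT)).
  rewrite /f; move: h; congr (ccvg _ _); apply/funext => n.
  rewrite conv_partialE /Qpart mul1r; congr (_ * _); apply: eq_bigr => j _.
  by rewrite /zfam mul0r addr0.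
Unshelve. all: by end_near. Qed.

(** Uniqueness of limits identifies [dv] with ik / 2 times the convolution; dividing by ik / 2,
    nonzero for k != 0, shows that the convolution is bounded and measurable. *)
Lemma solution_of_solves v0 v dv M : solves T (fun=> 1) v dv M ->
  (forall k, v 0 k = off0 v0 k) -> (forall t k, 0 <= t <= T -> v t (- k) = (v t k)^*) ->
  is_solution T v0 v.
Proof.
move=> [vz vp vM vQ] vi vr.
have M0 : 0 <= M by apply: (L2_ge0 (vM 0 _)); rewrite lexx.
have voff t : off0 (v t) = v t.
  by apply/funext => k; rewrite /off0; case: eqVneq => // ->; rewrite vz.
split.
- by move=> k; have [[a _] [b _]] := cprim_cbdmeas T0 (vp k).
- exists M; apply: aeW => t tT.
  have h : (hs_norm 0 (v t) <= M%:E)%E by apply/hs_norm0P => //; rewrite voff; exact: vM.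
  by split=> //; split; [move=> k _; exact: vr|exact: hs_norm_fin h].
- move=> k k0 t tT.
  have E x : 0 <= x <= T -> dv x k = half_ik R k * Defs.conv (v x) k x.
    move=> xT; apply: (ccvg_unique (vQ x xT k)).
    have lv : L2 (fun k => cabs (off0 (v x) k)) M by rewrite voff; exact: vM.
    have := ccvgM (ccvg_cst (half_ik R k)) (conv_ccvg k x lv).
    congr (ccvg _ _); apply/funext => n.
    rewrite conv_partialE /Qpart mul1r voff; congr (_ * _); apply: eq_bigr => j _.
    by rewrite /zfam mul0r addr0.
  have hk : half_ik R k != 0.
    rewrite /half_ik mulf_neq0 ?neq0Ci// (_ : 0 = 0%:C)// (inj_eq (@complexI R)).
    by rewrite mulf_neq0// intr_eq0.
  have bc : cbdmeas T (fun x => Defs.conv (v x) k x).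
    have pd := cprim_int (cprim_deriv_cbdmeas (cprimZ T0 (half_ik R k)^-1 (vp k))).
    apply: (cprim_deriv_cbdmeas (F := fun t => cintegral t (fun x => (half_ik R k)^-1 * dv x k))).
    by apply: (eq_cprim _ _ pd) => x xT //; rewrite E// mulKf.
  have p2 : cprim T (fun t => half_ik R k * cintegral t (fun x => Defs.conv (v x) k x)) (fun t => dv t k).
    by apply: (eq_cprim _ _ (cprimZ T0 (half_ik R k) (cprim_int bc))) => x xT //; rewrite E.
  rewrite (cprimE (vp k) tT) vi /off0 (negbTE k0) addrC addKr -/(half_ik R k).
  by have := cprimE p2 tT; rewrite cintegral0 mulr0 add0r => ->.
Qed.
End solution.

(** * Compactness and Peano's theorem *)

Section compactness.
Variables (R : realType) (T : R).
Hypothesis Tpos : 0 < T.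
Let T0 : 0 <= T. Proof. exact: ltW. Qed.
Notation C := R[i].

Definition lip (f : R -> C) (L : R) := forall a b, 0 <= a -> a <= b -> b <= T -> cabs (f b - f a) <= L * (b - a).

Lemma lip_abs f L a b : lip f L -> 0 <= a <= T -> 0 <= b <= T -> cabs (f a - f b) <= L * `|a - b|.
Proof.
move=> fL /andP[a0 aT] /andP[b0 bT]; have [ab|/ltW ba] := leP a b.
  by rewrite -cabsN opprB distrC ger0_norm ?subr_ge0//; exact: fL.
by rewrite ger0_norm ?subr_ge0//; exact: fL.
Qed.

Lemma lip_cbdmeas f L : lip f L -> cbdmeas T f.
Proof.
move=> fL; split; apply: (lip_rbdmeas (L := L) T0) => a b a0 ab bT.
- by rewrite -ReN -ReD; apply: le_trans (cabs_Re _) (fL a b a0 ab bT).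
- by rewrite -ImN -ImD; apply: le_trans (cabs_Im _) (fL a b a0 ab bT).
Qed.

Lemma cprim_lipschitz F f D : cprim T F f -> (forall t, 0 <= t <= T -> cabs (f t) <= D) -> lip F (2 * D).
Proof.
move=> Ff fD a b a0 ab bT; apply: (cprim_lip Ff) => // x /andP[ax xb].
by apply: fD; rewrite (le_trans a0 ax) (le_trans xb bT).
Qed.

(** Tychonoff. The index set used below is uncountable, so a subsequence converging at every index
    cannot be expected; but a cluster point in the product is approached, infinitely often, on any
    given finite set of indices. *)
Lemma finite_approx (I : eqType) (x : nat -> I -> R) (B : I -> R) :
  (forall n i, `|x n i| <= B i) ->
  exists f : I -> R, forall (s : seq I) e N, 0 < e ->
    exists2 n, (N <= n)%N & forall i, i \in s -> `|x n i - f i| <= e.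
Proof.
move=> xB.
pose A (i : I) : set R := `[- B i, B i]%classic.
pose PT : topologicalType := prod_topology (fun _ : I => R : topologicalType).
have cA : @compact PT [set f : PT | forall i, A i (f i)].
  by apply: (@tychonoff I (fun=> R : topologicalType)) => i; exact: segment_compact.
pose F : set_system PT := (fun n => (x n : PT)) @ \oo.
have FA : F [set f : PT | forall i, A i (f i)].
  exists 0%N => // n _ i; rewrite /A /= in_itv/= -ler_norml; exact: xB.
have [f [_ cf]] := cA F _ FA.
exists f => s e N e0.
pose S1 := [set y : PT | exists2 n, (N <= n)%N & y = x n].
have FS1 : F S1 by exists N => // n /= Nn; exists n.
pose S2 := [set y : PT | forall i, i \in s -> `|y i - f i| <= e].
have nS2 : @nbhs _ PT f S2.
  have nF := @nbhs_filter PT f.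
  rewrite /S2; elim: s {S2} => [|i s IH].
    by apply: (@filterS _ _ nF setT); [move=> y _ i|exact: (@filterT _ _ nF)].
  have ni : @nbhs _ PT f [set y : PT | `|y i - f i| <= e].
    have pc := @proj_continuous I (fun=> R : topologicalType) i f.
    have /cvgrPdist_le/(_ e e0) := pc.
    by apply: (@filterS _ _ nF) => y /=; rewrite distrC.
  apply: (@filterS2 _ _ nF _ _ _ _ ni IH) => y h1 h2 j; rewrite in_cons => /orP[/eqP ->//|]; exact: h2.
have [y [[n Nn ->] h]] := cf _ _ FS1 nS2.
by exists n.
Qed.

(** The cluster point is compared with the sequence on a finite grid of times and frequencies;
    equicontinuity extends this to all times. [phi m] gives accuracy 1 / (m + 1) for |k| <= m, and
    [m <= phi m] replaces monotonicity. *)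
Lemma arzela_ascoli (u : nat -> R -> int -> C) (L B : int -> R) :
  (forall n k, lip (fun t => u n t k) (L k)) ->
  (forall n k t, 0 <= t <= T -> cabs (u n t k) <= B k) ->
  exists (phi : nat -> nat) (v : R -> int -> C), (forall m, (m <= phi m)%N) /\
    forall t k, 0 <= t <= T -> ccvg (fun m => u (phi m) t k) (v t k).
Proof.
move=> uL uB.
(* The product is indexed by all real times, whereas the bounds hold on [0, T] only. *)
pose clamp (t : R) := Num.max 0 (Num.min T t).
have clampT t : 0 <= clamp t <= T by rewrite /clamp le_max lexx/= ge_max T0 ge_min lexx.
have clampE t : 0 <= t <= T -> clamp t = t.
  by move=> /andP[t0 tT]; rewrite /clamp (min_idPr tT) (max_idPr t0).
pose x n (i : int * R * bool) := if i.2 then complex.Im (u n (clamp i.1.2) i.1.1)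
  else complex.Re (u n (clamp i.1.2) i.1.1).
have xB n i : `|x n i| <= B i.1.1.
  rewrite /x; case: i.2.
  - by apply: le_trans (cabs_Im _) _; exact: uB.
  - by apply: le_trans (cabs_Re _) _; exact: uB.
have [f Hf] := finite_approx xB.
pose v t k : C := f (k, t, false) +i* f (k, t, true).
have Hv (ks : seq int) (ts : seq R) e N : 0 < e -> (forall t, t \in ts -> 0 <= t <= T) ->
    exists2 n, (N <= n)%N & forall t k, t \in ts -> k \in ks -> cabs (u n t k - v t k) <= e.
  move=> e0 tsT; have e2 : 0 < e / 2 by rewrite divr_gt0.
  pose I3 := [seq (p, b) | p <- [seq (k, t) | k <- ks, t <- ts], b <- [:: false; true]].
  have mI k t b : k \in ks -> t \in ts -> (k, t, b) \in I3.
    move=> kk tt; apply/allpairsP; exists ((k, t), b); split=> //; last by case: b.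
    by apply/allpairsP; exists (k, t).
  have [n Nn Hn] := Hf I3 (e / 2) N e2.
  exists n => // t k tt kk; apply: le_trans (cabs_ReIm _) _.
  rewrite [leRHS](splitr e) ReD ImD ReN ImN; apply: lerD.
  - by have := Hn _ (mI k t false kk tt); rewrite /x clampE//; exact: tsT.
  - by have := Hn _ (mI k t true kk tt); rewrite /x clampE//; exact: tsT.
have vlip k : lip (fun t => v t k) (L k).
  move=> a b a0 ab bT; apply/ler_addgt0Pr => e e0.
  have e2 : 0 < e / 2 by rewrite divr_gt0.
  have aT : 0 <= a <= T by rewrite a0 (le_trans ab).
  have bT' : 0 <= b <= T by rewrite (le_trans a0 ab).
  have [|n _ Hn] := Hv [:: k] [:: a; b] (e / 2) 0%N e2.
    by move=> t; rewrite !inE => /orP[] /eqP ->.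
  have h1 := Hn a k (mem_head _ _) (mem_head _ _).
  have h2 := Hn b k; rewrite !inE !eqxx orbT in h2; have {}h2 := h2 isT isT.
  have -> : v b k - v a k = (u n b k - u n a k) - (u n b k - v b k) + (u n a k - v a k) by ring.
  apply: le_trans (cabsD _ _) _; have h3 := cabsB (u n b k - u n a k) (u n b k - v b k).
  have h4 := uL n k a b a0 ab bT.
  rewrite [in leRHS](splitr e); lra.
have L0 k : 0 <= L k.
  have := le_trans (cabs_ge0 _) (uL 0%N k 0 T (lexx _) T0 (lexx _)).
  by rewrite subr0 pmulr_lge0.
have unif m : exists n, (m <= n)%N /\ forall t k, 0 <= t <= T -> (absz k <= m)%N ->
    cabs (u n t k - v t k) <= m.+1%:R^-1.
  pose Lm := \sum_(k <- box m) L k.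
  have Lm0 : 0 <= Lm by rewrite sumr_ge0.
  (* The grid is fine enough that moving to a grid point costs 1 / (4 (m + 1)) for u and for v; the
     error 1 / (2 (m + 1)) at the grid point completes the sum. *)
  pose J := (Num.bound (4 * Lm * T * m.+1%:R)).+1.
  pose tj (j : nat) : R := T * j%:R / J%:R.
  have J0 : (0 : R) < J%:R by rewrite ltr0n.
  have tjT j : (j <= J)%N -> 0 <= tj j <= T.
    move=> jJ; rewrite /tj divr_ge0 ?mulr_ge0//=.
    by rewrite ler_pdivrMr// ler_wpM2l// ler_nat.
  have e0 : (0 : R) < m.+1%:R^-1 / 2 by rewrite divr_gt0.
  have [|n mn Hn] := Hv (box m) [seq tj j | j <- iota 0 J.+1] _ m e0.
    by move=> t /mapP[j]; rewrite mem_iota add0n ltnS => /andP[_ jJ] ->; exact: tjT.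
  exists n; split=> // t k tT km.
  have [j [jJ jt]] : exists j, (j <= J)%N /\ `|t - tj j| <= T / J%:R.
    case/andP: tT => t0 tT; pose j := Num.truncn (t * J%:R / T).
    have y0 : 0 <= t * J%:R / T by rewrite divr_ge0 ?mulr_ge0// ltW.
    have /andP[j1 j2] : (j%:R <= t * J%:R / T < j.+1%:R) by exact: truncn_itv.
    exists j; split.
      rewrite -(ler_nat R); apply: le_trans j1 _; rewrite ler_pdivrMr// mulrC.
      by rewrite ler_wpM2l// ltW.
    have q1 : tj j <= t.
      by rewrite /tj ler_pdivrMr// mulrC -ler_pdivlMr.
    have q2 : t <= tj j + T / J%:R.
      rewrite /tj -mulrDl -[X in _ + X]mulr1 -mulrDr natr1 ler_pdivlMr// [leRHS]mulrC.
      by rewrite -ler_pdivrMr// ltW.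
    by rewrite ger0_norm ?subr_ge0// lerBlDl.
  have tjt := tjT j jJ.
  have kb : k \in box m by rewrite mem_box.
  have h1 : cabs (u n (tj j) k - v (tj j) k) <= m.+1%:R^-1 / 2.
    by apply: Hn => //; apply/mapP; exists j => //; rewrite mem_iota add0n ltnS.
  have LL : L k <= Lm.
    by rewrite /Lm (bigD1_seq k kb (box_uniq m))/= lerDl sumr_ge0.
  have d1 : L k * `|t - tj j| <= m.+1%:R^-1 / 4.
    apply: (@le_trans _ _ (Lm * (T / J%:R))); first exact: ler_pM.
    have : 4 * Lm * T * m.+1%:R <= J%:R.
      apply: ltW; apply: lt_trans (archi_boundP _) _; first by rewrite !mulr_ge0.
      by rewrite ltr_nat.
    have : (0 : R) < m.+1%:R by rewrite ltr0n.
    move: J0; move: (m.+1%:R : R) (J%:R : R) => M K K0 M0 h.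
    rewrite -subr_ge0 (_ : _ - _ = (K - 4 * Lm * T * M) / (4 * M * K)); last first.
      by field; rewrite !gt_eqF.
    by rewrite divr_ge0 ?subr_ge0// !mulr_ge0// ltW.
  have h2 := lip_abs (uL n k) tT tjt; have h3 := lip_abs (vlip k) tT tjt.
  have -> : u n t k - v t k = (u n t k - u n (tj j) k) + (u n (tj j) k - v (tj j) k) - (v t k - v (tj j) k) by ring.
  apply: le_trans (cabsB _ _) _; have h4 := cabsD (u n t k - u n (tj j) k) (u n (tj j) k - v (tj j) k).
  move: h1 h2 h3 h4 d1; rewrite /=.
  move: (m.+1%:R^-1 : R) (L k * _) (cabs (u n t k - u n (tj j) k)) (cabs (v t k - v (tj j) k)) => e a b c; lra.
have /choice[phi Hphi] := unif.
exists phi, v; split=> [m|t k tT]; first by case: (Hphi m).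
apply: ccvgP => e e0; exists (maxn (absz k) (Num.bound e^-1)) => // m /=.
rewrite geq_max => /andP[km em].
apply: le_trans ((Hphi m).2 t k tT km) _.
rewrite invf_ple ?posrE ?ltr0n//.
apply: ltW; apply: lt_le_trans (archi_boundP _) _; first by rewrite invr_ge0 ltW.
by rewrite ler_nat ltnW.
Qed.

Lemma cprim_limit (F f : nat -> R -> C) (G g : R -> C) D :
  (forall n, cprim T (F n) (f n)) -> (forall n t, 0 <= t <= T -> cabs (f n t) <= D) ->
  (forall t, 0 <= t <= T -> ccvg (fun n => F n t) (G t)) ->
  (forall t, 0 <= t <= T -> ccvg (fun n => f n t) (g t)) -> cprim T G g.
Proof.
move=> Ff fD FG fg.
have [bg cg] := cdct (fun n => cprim_deriv_cbdmeas (Ff n)) fD fg.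
apply: (eq_cprim _ _ (cprimD (cprim_cst T (G 0)) (cprim_int bg))) => t tT; last by rewrite add0r.
apply: (ccvg_unique _ (FG t tT)).
have T00 : 0 <= (0 : R) <= T by apply/andP.
have := ccvgD (FG 0 T00) (cg t tT).
by congr (ccvg _ _); apply/funext => n; rewrite -(cprimE (Ff n) tT).
Qed.

(* Tonelli's scheme: with the delay h the equation is solved explicitly on successive intervals of
   length h, i.e. by finitely many Picard iterations. *)
Lemma peano (G : R -> (int -> C) -> int -> C) (D : int -> R) (V0 : int -> C) :
  (forall t x k, cabs (G t x k) <= D k) ->
  (forall x, (forall k, exists L, lip (fun t => x t k) L) -> forall k, cbdmeas T (fun t => G t (x t) k)) ->
  (forall t (xm : nat -> int -> C) x, 0 <= t <= T -> (forall k, ccvg (fun m => xm m k) (x k)) ->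
     forall k, ccvg (fun m => G t (xm m) k) (G t x k)) ->
  exists v : R -> int -> C, (forall k, cprim T (fun t => v t k) (fun t => G t (v t) k)) /\
    forall k, v 0 k = V0 k.
Proof.
move=> GD Gm Gc.
have D0 k : 0 <= D k by apply: le_trans (GD 0 V0 k); exact: cabs_ge0.
pose delay (h s : R) := Num.max 0 (s - h).
have delayT h s : 0 < h -> 0 <= s <= T -> 0 <= delay h s <= T.
  move=> h0 /andP[s0 sT]; rewrite /delay le_max lexx/= ge_max T0/=.
  by rewrite (le_trans _ sT)// gerBl ltW.
have delay_lip h a b : a <= b -> 0 <= delay h b - delay h a <= b - a.
  move=> ab; rewrite /delay; case: (leP 0 (a - h)) => h1; case: (leP 0 (b - h)) => h2; lra.
pose Gam h (u : R -> int -> C) t k := V0 k + cintegral t (fun s => G s (u (delay h s)) k).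
have approx (h : R) : 0 < h -> exists u : R -> int -> C,
    (forall k, lip (fun t => u t k) (2 * D k)) /\
    forall t k, 0 <= t <= T -> u t k = V0 k + cintegral t (fun s => G s (u (delay h s)) k).
  move=> h0; pose w i := iter i (Gam h) (fun _ => V0).
  have dl (u : R -> int -> C) : (forall k, lip (fun t => u t k) (2 * D k)) ->
      forall k, cbdmeas T (fun s => G s (u (delay h s)) k).
    move=> ul; apply: Gm => k; exists (2 * D k) => a b a0 ab bT.
    have aT : 0 <= a <= T by rewrite a0 (le_trans ab).
    have bT' : 0 <= b <= T by rewrite (le_trans a0 ab).
    have /andP[d1 d2] := delay_lip h a b ab.
    apply: le_trans (ul k _ _ _ _ _) _.
    - by case/andP: (delayT h a h0 aT).
    - by rewrite -subr_ge0.
    - by case/andP: (delayT h b h0 bT').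
    - by rewrite ler_wpM2l// mulr_ge0.
  have wl i k : lip (fun t => w i t k) (2 * D k).
    elim: i k => [|i IH] k.
      by move=> a b a0 ab bT; rewrite subrr cabs0 mulr_ge0 ?subr_ge0// mulr_ge0.
    have p := cprimD (cprim_cst T (V0 k)) (cprim_int (dl _ IH k)).
    apply: (cprim_lipschitz p) => t tT; rewrite add0r; exact: GD.
  (* The value at t only involves times up to t - h, or time 0, so each iteration settles one more
     interval of length h. *)
  have agree i : forall t, 0 <= t <= T -> t <= i%:R * h -> w i.+1 t = w i t.
    elim: i => [|i IH] t /andP[t0 tT] ti.
      have -> : t = 0 by apply/le_anti; rewrite t0 andbT; move: ti; rewrite mul0r.
      by apply/funext => k; rewrite /w /= /Gam cintegral0 addr0.
    apply/funext => k; rewrite [LHS]/= [RHS]/= /Gam -/(w i.+1) -/(w i); congr (_ + _).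
    apply: cintegral_eq => s /andP[s0 st]; congr (G s _ k); apply: IH.
      by apply: delayT => //; rewrite s0 (le_trans st).
    rewrite /delay ge_max mulr_ge0 ?(ltW h0)//=.
    by move: ti; rewrite -natr1 mulrDl mul1r; lra.
  pose J := Num.bound (T / h).
  exists (w J); split; first exact: wl.
  move=> t k /andP[t0 tT].
  have tJ : t <= J%:R * h.
    rewrite -ler_pdivrMr//; apply: ltW; apply: le_lt_trans (archi_boundP _).
      by rewrite ler_pM2r ?invr_gt0.
    by rewrite divr_ge0// ltW.
  have := agree J t; rewrite t0 tT tJ => /(_ isT isT) <-.
  by [].
have /choice[u Hu] : forall m : nat, exists u : R -> int -> C,
    (forall k, lip (fun t => u t k) (2 * D k)) /\
    forall t k, 0 <= t <= T -> u t k = V0 k + cintegral t (fun s => G s (u (delay m.+1%:R^-1 s)) k).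
  by move=> m; apply: approx; rewrite invr_gt0.
have ub m k t : 0 <= t <= T -> cabs (u m t k) <= cabs (V0 k) + 2 * D k * T.
  move=> tT; have [ul ue] := Hu m.
  have T00 : 0 <= (0 : R) <= T by apply/andP.
  have e0 : u m 0 k = V0 k by rewrite ue// cintegral0 addr0.
  have := lip_abs (ul k) tT T00; rewrite subr0 e0 => h.
  rewrite -[u m t k](subrK (V0 k)) addrC; apply: le_trans (cabsD _ _) _; rewrite lerD2l.
  apply: le_trans h _; case/andP: tT => t0 tT; rewrite ger0_norm// ler_wpM2l// mulr_ge0//.
have [phi [v [phim uv]]] := arzela_ascoli (fun n k => (Hu n).1 k) ub.
exists v; split; last first.
  move=> k; have T00 : 0 <= (0 : R) <= T by apply/andP.
  apply: (ccvg_unique (uv 0 k T00)); rewrite (_ : (fun m => _) = fun=> V0 k); first exact: ccvg_cst.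
  by apply/funext => m; rewrite (Hu (phi m)).2// cintegral0 addr0.
move=> k.
pose f m s := G s (u (phi m) (delay (phi m).+1%:R^-1 s)) k.
have bf m : cbdmeas T (f m).
  apply: Gm => j; have [ul _] := Hu (phi m); exists (2 * D j) => a b a0 ab bT.
  have h0 : (0 : R) < (phi m).+1%:R^-1 by rewrite invr_gt0.
  have aT : 0 <= a <= T by rewrite a0 (le_trans ab).
  have bT' : 0 <= b <= T by rewrite (le_trans a0 ab).
  have /andP[d1 d2] := delay_lip (phi m).+1%:R^-1 a b ab.
  apply: le_trans (ul j _ _ _ _ _) _.
  - by case/andP: (delayT _ a h0 aT).
  - by rewrite -subr_ge0.
  - by case/andP: (delayT _ b h0 bT').
  - by rewrite ler_wpM2l// mulr_ge0.
apply: (@cprim_limit (fun m t => u (phi m) t k) f _ _ (D k)).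
- move=> m; apply: (eq_cprim _ _ (cprimD (cprim_cst T (V0 k)) (cprim_int (bf m)))) => t tT.
    by rewrite (Hu (phi m)).2.
  by rewrite add0r.
- by move=> m t tT; exact: GD.
- by move=> t tT; exact: uv.
(* The delayed argument has the same limit: the delay is at most 1 / (m + 1) and the approximations
   are uniformly Lipschitz. *)
- move=> t tT; apply: (Gc t (fun m => u (phi m) (delay (phi m).+1%:R^-1 t))) => // j.
  apply: ccvgP => e e0; have e2 : 0 < e / 2 by rewrite divr_gt0.
  near=> m.
  have h1 : cabs (u (phi m) t j - v t j) <= e / 2.
    by near: m; exact: ccvg_eventually_cabs (uv t j tT) e2.
  have h0 : (0 : R) < (phi m).+1%:R^-1 by rewrite invr_gt0.
  have h2 := lip_abs ((Hu (phi m)).1 j) (delayT _ t h0 tT) tT.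
  have h3 : `|delay (phi m).+1%:R^-1 t - t| <= m.+1%:R^-1.
    have d1 : `|delay (phi m).+1%:R^-1 t - t| <= (phi m).+1%:R^-1.
      rewrite /delay; have /andP[t0 _] := tT; have := h0; move: (_%:R^-1) => z z0.
      by rewrite ler_norml; case: (leP 0 (t - z)) => h4; lra.
    by apply: le_trans d1 _; rewrite lef_pV2 ?posrE ?ltr0n// ler_nat ltnS.
  have h4 : 2 * D j * m.+1%:R^-1 <= e / 2.
    rewrite ler_pdivrMr ?ltr0n// [leRHS]mulrC -ler_pdivrMr//.
    near: m; exists (Num.bound (2 * D j / (e / 2))) => // m /= hm.
    apply: ltW; apply: lt_le_trans (archi_boundP _) _; first by rewrite divr_ge0 ?(ltW e2)// mulr_ge0.
    by rewrite ler_nat ltnW.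
  rewrite (splitr e).
  have -> : u (phi m) (delay (phi m).+1%:R^-1 t) j - v t j =
     (u (phi m) (delay (phi m).+1%:R^-1 t) j - u (phi m) t j) + (u (phi m) t j - v t j) by ring.
  apply: le_trans (cabsD _ _) _; apply: lerD => //.
  apply: le_trans h2 (le_trans _ h4); rewrite ler_wpM2l// mulr_ge0//.
Unshelve. all: by end_near. Qed.
End compactness.

(** * Galerkin approximations *)

Section galerkin.
Variables (R : realType) (T : R).
Hypothesis Tpos : 0 < T.
Let T0 : 0 <= T. Proof. exact: ltW. Qed.
Notation C := R[i].

(** The range s need not be stable under g; the terms that cross its boundary vanish on both
    sides. *)
Lemma sum_reindex_inv (V : nmodType) (s : seq int) (g : int -> int) (F : int -> V) :
  uniq s -> involutive g -> (forall j, j \in s -> g j \notin s -> F (g j) = 0) ->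
  (forall j, j \in s -> g j \notin s -> F j = 0) ->
  \sum_(j <- s) F (g j) = \sum_(j <- s) F j.
Proof.
move=> us gK F1 F2.
rewrite (bigID (fun j => g j \in s))/= [X in _ + X]big_seq_cond [X in _ + X]big1 ?addr0; last first.
  by move=> j /andP[js gj]; exact: F1.
rewrite [RHS](bigID (fun j => g j \in s))/= [X in _ + X]big_seq_cond [X in _ + X]big1 ?addr0; last first.
  by move=> j /andP[js gj]; exact: F2.
rewrite -big_filter -[RHS]big_filter.
rewrite (_ : \sum_(j <- [seq i <- s | g i \in s]) F (g j) = \sum_(j <- map g [seq i <- s | g i \in s]) F j); last first.
  by rewrite big_map.
apply: perm_big; apply: uniq_perm.
- by rewrite map_inj_uniq ?filter_uniq//; exact: inv_inj.
- exact: filter_uniq.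
- move=> j; rewrite mem_filter; apply/mapP/andP => [[k]|[gj js]].
    by rewrite mem_filter => /andP[gk ks] ->; rewrite gK.
  by exists (g j); rewrite ?gK// mem_filter gK js.
Qed.

Lemma box_oppr (V : nmodType) n (F : int -> V) : \sum_(j <- box n) F (- j) = \sum_(j <- box n) F j.
Proof.
apply: (sum_reindex_inv (box_uniq n) (@opprK int)) => j; rewrite !mem_box abszN => ->//.
Qed.

Section fixed_n.
Variable n : nat.

(* Reality is built into the truncation: negative frequencies are read off the positive ones. *)
Definition trunc_real (x : int -> C) (j : int) : C :=
  if (0 < j) && (absz j <= n)%N then x j
  else if (j < 0) && (absz j <= n)%N then conjc (x (- j)) else 0.

Lemma trunc_realN x j : trunc_real x (- j) = conjc (trunc_real x j).
Proof.
rewrite /trunc_real abszN oppr_gt0 oppr_lt0.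
have [jn|jn] := boolP (absz j <= n)%N; last by rewrite !andbF conjc0.
rewrite !andbT; case: ltgtP => [j0|j0|_] //=.
- by rewrite conjcK.
- by rewrite opprK.
- by rewrite oppr0.
Qed.

Lemma trunc_real_out x j : j \notin box n -> trunc_real x j = 0.
Proof. by rewrite mem_box /trunc_real => /negbTE ->; rewrite !andbF. Qed.

Lemma trunc_real0 x : trunc_real x 0 = 0.
Proof. by rewrite /trunc_real !ltxx. Qed.

Definition energy (x : int -> C) : R := \sum_(j <- box n) abs2 (trunc_real x j).

Lemma energy_ge0 x : 0 <= energy x. Proof. by rewrite sumr_ge0// => j _; exact: abs2_ge0. Qed.

Lemma trunc_L2 x : L2 (fun k => cabs (trunc_real x k)) (Num.sqrt (energy x)).
Proof.
split=> [k| |s us]; [exact: cabs_ge0|exact: sqrtr_ge0|].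
rewrite sqr_sqrtr ?energy_ge0//.
rewrite (bigID (fun j => j \in box n))/= [X in _ + X]big1 ?addr0; last first.
  by move=> j jn; rewrite trunc_real_out// cabs0 expr0n.
rewrite -big_filter /energy; under [leRHS]eq_bigr do rewrite -cabs_sq.
apply: sum_superset; rewrite ?filter_uniq//; first by move=> k; rewrite sqr_ge0.
by move=> j; rewrite mem_filter => /andP[].
Qed.

Definition kdv_gam (k : int) : C := if (k != 0) && (absz k <= n)%N then 1 else 0.

Lemma kdv_gam1 k : cabs (kdv_gam k) <= 1.
Proof. by rewrite /kdv_gam; case: ifP; rewrite ?cabs1 ?cabs0. Qed.

Lemma kdv_gamN k : kdv_gam (- k) = kdv_gam k.
Proof. by rewrite /kdv_gam oppr_eq0 abszN. Qed.

Let Q (t : R) (y : int -> C) k : C :=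
  kdv_gam k * half_ik R k * \sum_(j <- box n) expi (phase2 R k j * t) * (y j * y (k - j)).

Variable e0 : R.
Hypothesis e0_ge0 : 0 <= e0.

(* [rho] makes the truncated nonlinearity bounded, as [peano] requires; along a solution the energy
   keeps its initial value [e0], hence [rho = 1]. *)
Let rho (x : int -> C) : R := (1 + e0) / (1 + energy x).

Let G (t : R) (x : int -> C) k : C := (rho x)%:C * Q t (trunc_real x) k.

Let Q_le t x k : cabs (Q t (trunc_real x) k) <= (absz k)%:R / 2 * energy x.
Proof.
rewrite /Q cabsM [cabs (kdv_gam k * _)]cabsM cabs_half_ik.
have k0 : 0 <= (absz k)%:R / 2 :> R by rewrite divr_ge0.
have S1 : cabs (\sum_(j <- box n) expi (phase2 R k j * t) * (trunc_real x j * trunc_real x (k - j))) <= energy x.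
  apply: le_trans (cabs_sum _ _) _.
  rewrite (eq_bigr (fun j => cabs (trunc_real x j) * cabs (trunc_real x (k - j)))); last first.
    by move=> j _; rewrite cabsM cabs_expi mul1r cabsM.
  rewrite -(sqr_sqrtr (energy_ge0 x)) expr2.
  by apply: (L2_cs (box_uniq n) (trunc_L2 x)); exact: (L2_sub k (trunc_L2 x)).
by apply: ler_pM S1; rewrite ?mulr_ge0 ?cabs_ge0// ler_piMl// kdv_gam1.
Qed.

Let rho_ge0 x : 0 <= rho x.
Proof. by rewrite divr_ge0// addr_ge0// energy_ge0. Qed.

Let G_le t x k : cabs (G t x k) <= (absz k)%:R / 2 * (1 + e0).
Proof.
rewrite /G cabsM cabs_real ger0_norm//.
have k0 : 0 <= (absz k)%:R / 2 :> R by rewrite divr_ge0.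
apply: le_trans (ler_wpM2l (rho_ge0 x) (Q_le t x k)) _.
rewrite mulrCA ler_wpM2l// /rho mulrAC ler_pdivrMr ?ltr_wpDr ?energy_ge0//.
by rewrite ler_wpM2l ?addr_ge0// lerDr.
Qed.

Let trunc_cbdmeas (x : R -> int -> C) : (forall k, cbdmeas T (fun t => x t k)) ->
  forall j, cbdmeas T (fun t => trunc_real (x t) j).
Proof.
move=> bx j; rewrite /trunc_real; case: ((0 < j) && _); first exact: bx.
case: ((j < 0) && _); last exact: cbdmeas_cst.
have [b1 b2] := bx (- j); split.
  by have -> : (fun t => complex.Re (conjc (x t (- j)))) = (fun t => complex.Re (x t (- j)));
    [apply/funext => t; case: (x t _)|].
by have -> : (fun t => complex.Im (conjc (x t (- j)))) = (fun t => - complex.Im (x t (- j)));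
  [apply/funext => t; case: (x t _)|exact: rbdmeasN].
Qed.

Let G_cbdmeas (x : R -> int -> C) : (forall k, exists L, lip T (fun t => x t k) L) ->
  forall k, cbdmeas T (fun t => G t (x t) k).
Proof.
move=> xL k.
have bx j : cbdmeas T (fun t => x t j) by have [L] := xL j; exact: lip_cbdmeas.
have by_ := trunc_cbdmeas bx.
apply: cbdmeasM; last first.
  apply: cbdmeasM; first exact: cbdmeas_cst.
  apply: cbdmeas_sum => j; apply: cbdmeasM; first exact: (cprim_cbdmeas T0 (cprim_expi T0 _)).
  by apply: cbdmeasM; exact: by_.
split=> /=; last exact: rbdmeas_cst.
have be : rbdmeas T (fun t => 1 + energy (x t)).
  apply: rbdmeasD; first exact: rbdmeas_cst.
  rewrite /energy; elim: (box n) => [|j s IH].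
    by under eq_fun do rewrite big_nil; exact: rbdmeas_cst.
  under eq_fun do rewrite big_cons; apply: rbdmeasD => //.
  rewrite /abs2; have [b1 b2] := by_ j.
  by under eq_fun do rewrite !expr2; apply: rbdmeasD; exact: rbdmeasM.
rewrite /rho; apply: rbdmeasM; first exact: rbdmeas_cst.
split.
  (* Measurability of the inverse is read off that of the real power with exponent -1. *)
  have -> : (fun t => (1 + energy (x t))^-1) = (fun a => a `^ (-1)) \o (fun t => 1 + energy (x t)).
    by apply/funext => t /=; rewrite powR_inv1// addr_ge0// energy_ge0.
  by apply: measurableT_comp; [exact: measurable_powR|case: be].
exists 1 => t _; rewrite ger0_norm ?invr_ge0 ?addr_ge0 ?energy_ge0//.
by rewrite invf_le1 ?ltr_wpDr ?energy_ge0// lerDl energy_ge0.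
Qed.

Let conj_ccvg (u : nat -> C) l : ccvg u l -> ccvg (fun m => conjc (u m)) (conjc l).
Proof.
move=> [u1 u2]; split.
  have -> : (fun m => complex.Re (conjc (u m))) = (fun m => complex.Re (u m)) by apply/funext => m; case: (u m).
  by case: l u1 u2.
have -> : (fun m => complex.Im (conjc (u m))) = (fun m => - complex.Im (u m)) by apply/funext => m; case: (u m).
have -> : complex.Im (conjc l) = - complex.Im l by case: l {u1 u2}.
exact: cvgN.
Qed.

Let trunc_ccvg (xm : nat -> int -> C) x : (forall k, ccvg (fun m => xm m k) (x k)) ->
  forall j, ccvg (fun m => trunc_real (xm m) j) (trunc_real x j).
Proof.
move=> cx j; rewrite /trunc_real; case: ((0 < j) && _) => //; case: ((j < 0) && _); last exact: ccvg_cst.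
exact: conj_ccvg.
Qed.

Let Q_ccvg t (ym : nat -> int -> C) y : (forall k, ccvg (fun m => ym m k) (y k)) ->
  forall k, ccvg (fun m => Q t (ym m) k) (Q t y k).
Proof.
move=> cy k; apply: ccvgM; first exact: ccvg_cst.
apply: ccvg_sum => j; apply: ccvgM; first exact: ccvg_cst.
exact: ccvgM.
Qed.

Let G_ccvg t (xm : nat -> int -> C) x : 0 <= t <= T -> (forall k, ccvg (fun m => xm m k) (x k)) ->
  forall k, ccvg (fun m => G t (xm m) k) (G t x k).
Proof.
move=> _ cx k; have cy := trunc_ccvg cx.
apply: ccvgM; last exact: Q_ccvg.
split=> /=; last exact: cvg_cst.
have ce : (fun m => energy (xm m)) @ \oo --> energy x.
  rewrite /energy; elim: (box n) => [|j s IH].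
    by rewrite big_nil; under eq_fun do rewrite big_nil; exact: cvg_cst.
  rewrite big_cons; under eq_fun do rewrite big_cons; apply: cvgD => //.
  have [c1 c2] := cy j; rewrite /abs2 !expr2; under eq_fun do rewrite !expr2.
  by apply: cvgD; exact: cvgM.
apply: cvgM; first exact: cvg_cst.
apply: cvgV; first by rewrite gt_eqF// ltr_wpDr// energy_ge0.
by apply: cvgD; [exact: cvg_cst|].
Qed.

(* Symmetrising in the three frequencies, which sum to 0, replaces the factor k by their sum. *)
Let triple_cancel t (y : int -> C) : (forall j, j \notin box n -> y j = 0) ->
  \sum_(k <- box n) \sum_(j <- box n)
    (k%:~R : C) * (y (- k) * (expi (phase2 R k j * t) * (y j * y (k - j)))) = 0.
Proof.
move=> y0.
pose H (a b : int) : C := expi (- (3 * (a * b * (- a - b))%:~R) * t) * (y a * y b * y (- a - b)).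
have Hsw a b : H a b = H b a.
  rewrite /H [- b - a]addrC [b * a]mulrC.
  by rewrite [- a - b]addrC; ring.
have Hsh a b : H a (- a - b) = H a b.
  have E1 : - a - (- a - b) = b by ring.
  rewrite /H E1.
  rewrite (_ : a * (- a - b) * b = a * b * (- a - b)); last by ring.
  by ring.
pose S := \sum_(a <- box n) \sum_(b <- box n) (a%:~R : C) * H a b.
have -> : \sum_(k <- box n) \sum_(j <- box n)
    (k%:~R : C) * (y (- k) * (expi (phase2 R k j * t) * (y j * y (k - j)))) = - S.
  rewrite -box_oppr /S -sumrN; apply: eq_bigr => a _.
  rewrite -sumrN; apply: eq_bigr => b _.
  rewrite opprK intrN mulNr; congr (- (_ * _)); rewrite /H.
  have -> : phase2 R (- a) b = - (3 * (a * b * (- a - b))%:~R).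
    by rewrite /phase2 !mulNr intrN mulrN.
  by ring.
have S1 : S = \sum_(a <- box n) \sum_(b <- box n) (b%:~R : C) * H a b.
  by rewrite exchange_big; apply: eq_bigr => a _; apply: eq_bigr => b _; rewrite Hsw.
have S2 : S = \sum_(a <- box n) \sum_(b <- box n) ((- a - b)%:~R : C) * H a b.
  rewrite S1; apply: eq_bigr => a _.
  (* The reflection b -> - a - b may leave the box, but only where y vanishes. *)
  rewrite -(sum_reindex_inv (g := fun b => - a - b) (box_uniq n)).
  - by apply: eq_bigr => b _; rewrite Hsh.
  - by move=> b; ring.
  - by move=> b bn nb; rewrite /H (y0 _ nb) mulr0 !mul0r !mulr0.
  - by move=> b bn nb; rewrite /H (y0 _ nb) !mulr0.
have S3 : S = - S - S.
  rewrite {1}S2 {1}/S S1 -sumrN -sumrB; apply: eq_bigr => a _.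
  rewrite -sumrN -sumrB; apply: eq_bigr => b _.
  by rewrite intrD !intrN; ring.
have : (3 : C) * S = 0.
  have -> : (3 : C) * S = S - (- S - S) by ring.
  by rewrite -S3 subrr.
by move=> /eqP; rewrite mulf_eq0 pnatr_eq0/= => /eqP ->; rewrite oppr0.
Qed.

Let conjM (x y : C) : conjc (x * y) = conjc x * conjc y. Proof. exact: rmorphM. Qed.
Let conj_sum (s : seq int) (F : int -> C) : conjc (\sum_(j <- s) F j) = \sum_(j <- s) conjc (F j).
Proof. exact: rmorph_sum. Qed.

Let conj_expi_sum t (y : int -> C) k : (forall j, y (- j) = conjc (y j)) ->
  Q t y (- k) = conjc (Q t y k).
Proof.
move=> yr; rewrite /Q !conjM kdv_gamN. rewrite conj_sum; congr (_ * _ * _).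
- by rewrite /kdv_gam; case: ifP => _; rewrite ?rmorph1 ?rmorph0.
- apply: complex_eq; rewrite /half_ik ?ReM ?ImM /= ?intrN; ring.
- rewrite -box_oppr; apply: eq_bigr => j _; rewrite !conjM expi_conj yr.
  congr (expi _ * _); first by rewrite /phase2; rewrite -[RHS]mulNr -mulrN -intrN; congr (_ * _%:~R * _); ring.
  congr (_ * _); rewrite (_ : - k - - j = - (k - j)); first by rewrite yr.
  by ring.
Qed.

Lemma galerkin_ode (V0 : int -> C) : energy V0 = e0 ->
  exists u du : R -> int -> C, [/\ solves T kdv_gam u du (Num.sqrt e0),
    (forall t k, u t (- k) = conjc (u t k)), (forall k, u 0 k = trunc_real V0 k) &
    (forall t k, (n < absz k)%N -> u t k = 0)].
Proof.
move=> eV0.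
have [v [pv v0]] := peano Tpos V0 G_le G_cbdmeas G_ccvg.
pose u t := trunc_real (v t).
have ur t k : u t (- k) = conjc (u t k) by exact: trunc_realN.
have uout t k : k \notin box n -> u t k = 0 by exact: trunc_real_out.
have pu k : cprim T (fun t => u t k) (fun t => G t (v t) k).
  rewrite /u /trunc_real.
  have [kn|kn] := boolP (absz k <= n)%N; last first.
    rewrite !andbF; apply: (eq_cprim _ _ (cprim_cst T 0)) => // t _.
    by rewrite /G /Q /kdv_gam (negbTE kn) andbF !mul0r mulr0.
  rewrite !andbT; case: (ltgtP 0 k) => [k0|k0|<-] /=; first exact: pv.
    have pk := pv (- k).
    apply: (@eq_cprim _ _ (fun t => conjc (v t (- k))) _ (fun t => conjc (G t (v t) (- k)))) => //.
      move=> t _; rewrite /G conjM/= oppr0 -conj_expi_sum ?opprK// => j; exact: trunc_realN.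
    have [[b1 p1] [b2 p2]] := pk; split.
      apply: (eq_rprim _ _ pk.1) => t _; [by case: (v t _)|by case: (G _ _ _)].
    apply: (eq_rprim _ _ (rprimN pk.2)) => t _; [by case: (v t _)|by case: (G _ _ _)].
  apply: (eq_cprim _ _ (cprim_cst T 0)) => // t _.
  by rewrite /G /Q /kdv_gam eqxx/= !mul0r mulr0.
have econst t : 0 <= t <= T -> energy (v t) = e0.
  move=> tT.
  (* By reality this sum is the energy; its derivative is a multiple of the sum annihilated by
     [triple_cancel]. *)
  have pe : cprim T (fun t => \sum_(k <- box n) u t k * u t (- k)) (fun=> 0).
    apply: (eq_cprim _ _ (cprim_sum (box n) (fun k => cprimM T0 (pu k) (pu (- k))))) => // s _.
    rewrite big_split/=.
    have -> : \sum_(k <- box n) u s k * G s (v s) (- k) = \sum_(k <- box n) G s (v s) k * u s (- k).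
      by rewrite -box_oppr; apply: eq_bigr => k _; rewrite opprK mulrC.
    have z : \sum_(k <- box n) G s (v s) k * u s (- k) = 0.
      transitivity ((rho (v s))%:C * ('i * (2^-1 : R)%:C) * \sum_(k <- box n) \sum_(j <- box n)
        (k%:~R : C) * (u s (- k) * (expi (phase2 R k j * s) * (u s j * u s (k - j))))).
        rewrite mulr_sumr; apply: eq_bigr => k _.
        rewrite /G /Q -/(u s).
        have gk : kdv_gam k * u s (- k) = u s (- k).
          rewrite /kdv_gam; case: ifP => [_|/negbT]; first by rewrite mul1r.
          rewrite mul0r negb_and negbK => /orP[/eqP ->|kn]; first by rewrite oppr0 /u trunc_real0.
          by rewrite uout// mem_box abszN.
        have hk : half_ik R k = k%:~R * ('i * (2^-1 : R)%:C).
          have -> : (k%:~R : C) = (k%:~R : R)%:C by rewrite rmorph_int.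
          by rewrite /half_ik mulrCA -rmorphM.
        rewrite -[in RHS]mulr_sumr -[in RHS]mulr_sumr -[in RHS]gk hk.
        move: (\sum_(j <- _) _) (kdv_gam k) (u s (- k)) (k%:~R : C) => X g y K; ring.
      by rewrite (triple_cancel s (uout s)) mulr0.
    by rewrite z addr0.
  have E s : \sum_(k <- box n) u s k * u s (- k) = (energy (v s))%:C.
    rewrite /energy raddf_sum/=; apply: eq_bigr => k _; rewrite ur -/(u s).
    by case: (u s k) => x y; apply: complex_eq; rewrite /abs2 ?ReM ?ImM/=; ring.
  have := cprimE pe tT; rewrite !E.
  have -> : cintegral t (fun=> 0 : C) = 0.
    by have := cprimE (cprim_cst T (0 : C)) tT; rewrite add0r => <-.
  rewrite addr0 => /complexI ->.
  by rewrite -eV0 /energy; apply: eq_bigr => j _; congr (abs2 _); rewrite /trunc_real !v0.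
have rho1 t : 0 <= t <= T -> rho (v t) = 1.
  by move=> tT; rewrite /rho econst// divff// gt_eqF// ltr_wpDr.
exists u, (fun t k => G t (v t) k); split=> //.
- split=> //.
  + by move=> t tT; rewrite -(econst t tT); exact: trunc_L2.
  + move=> t tT k; rewrite /G rho1// mul1r -/(u t).
    (* The family is supported in [box n], so the partial sums are stationary from N = n on. *)
    apply: ccvgP => e ep; exists n => // N /= nN.
    rewrite (_ : Qpart _ _ _ _ _ _ _ _ = Q t (u t) k); first by rewrite subrr cabs0 ltW.
    rewrite /Qpart /Q; congr (_ * _).
    rewrite (bigID (fun j => j \in box n))/= [X in _ + X]big1 ?addr0; last first.
      by move=> j jn; rewrite (uout t j jn) /zfam !mul0r addr0 mulr0.
    rewrite -big_filter; under eq_bigr do rewrite /zfam mul0r addr0.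
    apply: perm_big; apply: uniq_perm; rewrite ?filter_uniq ?box_uniq//.
    by move=> j; rewrite mem_filter !mem_box andb_idr// => /leq_trans; apply.
- by move=> k; rewrite /u /trunc_real !v0.
- by move=> t k nk; apply: uout; rewrite mem_box -ltnNge.
Qed.
End fixed_n.
End galerkin.

(** * Uniqueness and existence *)

Section wellposed.
Variables (R : realType) (T : R).
Hypothesis Tpos : 0 < T.
Let T0 : 0 <= T. Proof. exact: ltW. Qed.
Notation C := R[i].
Notation one := (fun _ : int => 1 : C).
Notation norm_le s x M := (L2 (fun k => wfull s k * cabs (x k)) M).

Lemma L2_tail (f : int -> R) M e : L2 f M -> 0 < e ->
  exists m, L2 (fun k => if (absz k <= m)%N then 0 else f k) e.
Proof.
move=> [f0 M0 fM] e0.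
pose S m := \sum_(k <- box m) f k ^+ 2.
have nS m m' : (m <= m')%N -> S m <= S m'.
  move=> mm; apply: sum_superset; rewrite ?box_uniq//; first by move=> k; rewrite sqr_ge0.
  by move=> j; rewrite !mem_box => /leq_trans; apply.
have cS : cvgn S.
  apply: nondecreasing_is_cvgn; first by move=> m m' mm; exact: nS.
  by exists (M ^+ 2) => _ [m _ <-]; apply: fM; exact: box_uniq.
have ee : 0 < e ^+ 2 by rewrite exprn_gt0.
have /cvgrPdist_le/(_ _ ee) [m _ Hm] := cS.
have Sl m' : S m' <= limn S.
  by apply: nondecreasing_cvgn_le => // a b ab; exact: nS.
exists m; split=> [k| |s us]; [by case: ifP|exact: ltW|].
rewrite (bigID (fun k => (absz k <= m)%N))/= big1 ?add0r; last by move=> k ->; rewrite expr0n.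
rewrite (eq_bigr (fun k => f k ^+ 2)); last by move=> k /negbTE ->.
pose m' := maxn m (\max_(k <- s) absz k).
apply: (@le_trans _ _ (S m' - S m)); last first.
  have := Hm m (leqnn m); have := Sl m'; have := ler_norm (limn S - S m); rewrite /=; lra.
rewrite lerBrDl /S; have -> : \sum_(k <- box m) f k ^+ 2 = \sum_(k <- box m' | (absz k <= m)%N) f k ^+ 2.
  rewrite -[RHS]big_filter; apply: perm_big; apply: uniq_perm; rewrite ?filter_uniq ?box_uniq//.
  by move=> k; rewrite mem_filter !mem_box andb_idr// => /leq_trans; apply; rewrite leq_maxl.
rewrite [leRHS](bigID (fun k => (absz k <= m)%N))/= lerD2l -[leLHS]big_filter -[leRHS]big_filter.
apply: sum_superset; rewrite ?filter_uniq//; first by move=> k; rewrite sqr_ge0.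
move=> k; rewrite !mem_filter mem_box => /andP[-> ks] /=.
by rewrite leq_max; apply/orP; right; apply: leq_bigmax_seq.
Qed.

Lemma solves_le gam v dv M M' : M <= M' -> solves T gam v dv M -> solves T gam v dv M'.
Proof.
move=> MM [v0 pv vM Qv]; split=> // t tT.
by apply: (L2_le _ MM (vM t tT)) => k; rewrite cabs_ge0 lexx.
Qed.

Section fixed_s.
Variable s : R.
Hypothesis s01 : 0 < s <= 1.
Let s0 : 0 < s. Proof. by case/andP: s01. Qed.
Notation w := (wfull s).
Let w0 k : 0 <= w k. Proof. exact: wfull_ge0. Qed.
Let wD i j : w (i + j) <= w i + w j. Proof. exact: wfullD. Qed.

Lemma cabs_one k : cabs (one k) <= 1. Proof. by rewrite cabs1. Qed.

(** With the weight capped at N the norm is at most N^s M, hence finite; the constant K is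
    independent of N, so the cap can be removed. *)
Lemma apriori_full M : 0 <= M -> exists2 K : R, 0 <= K & forall v dv Z,
  solves T one v dv M -> norm_le s (v 0) Z ->
  forall t, 0 <= t <= T -> norm_le s (v t) (K * Z).
Proof.
move=> M0; have [K K0 HK] := apriori_growth T0 M0; exists K => // v dv Z sv vZ t tT.
apply: L2_wcap_wfull => //; first by move=> k; exact: cabs_ge0.
move=> N; apply: (HK (wcap s N) one v dv (N%:R `^ s * M) Z) => //.
- by move=> k; exact: wcap_ge0.
- by move=> i j; exact: wcapD.
- exact: cabs_one.
- move=> x xT; have [_ _ vM _] := sv; have [_ _ vMx] := vM x xT.
  split=> [k| |r ur]; [by rewrite mulr_ge0 ?wcap_ge0 ?cabs_ge0|by rewrite mulr_ge0// powR_ge0|].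
  apply: (@le_trans _ _ (\sum_(k <- r) (N%:R `^ s) ^+ 2 * cabs (v x k) ^+ 2)).
    apply: ler_sum => k _; rewrite exprMn ler_wpM2r ?sqr_ge0//.
    by rewrite lerXn2r ?nnegrE ?wcap_ge0 ?powR_ge0 ?wcap_bound.
  by rewrite -mulr_sumr exprMn ler_wpM2l ?sqr_ge0 ?vMx.
- apply: (L2_le _ (lexx Z) vZ) => k; rewrite mulr_ge0 ?wcap_ge0 ?cabs_ge0//=.
  by rewrite ler_wpM2r ?cabs_ge0 ?wcap_le.
Qed.

(** The a priori estimate puts the l^2 and weighted norms of both solutions below M + K Rad, the
    single bound that [lipschitz_growth] takes. *)
Lemma lipschitz_full M Rad : 0 <= M -> 0 <= Rad -> exists2 K : R, 0 <= K & forall v dv u du D,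
  solves T one v dv M -> solves T one u du M -> norm_le s (v 0) Rad -> norm_le s (u 0) Rad ->
  L2 (fun k => w k * cabs (v 0 k - u 0 k)) D ->
  forall t, 0 <= t <= T -> L2 (fun k => w k * cabs (v t k - u t k)) (K * D).
Proof.
move=> M0 Rad0; have [K K0 HK] := apriori_full M0.
have M0' : 0 <= M + K * Rad by rewrite addr_ge0// mulr_ge0.
have [K' K'0 HK'] := lipschitz_growth T0 M0'.
exists K' => // v dv u du D sv su vR uR zD t tT.
have MM : M <= M + K * Rad by rewrite lerDl mulr_ge0.
have KM : K * Rad <= M + K * Rad by rewrite lerDr.
have h v' dv' : solves T one v' dv' M -> norm_le s (v' 0) Rad ->
    forall t, 0 <= t <= T -> norm_le s (v' t) (M + K * Rad).
  move=> sv' vR' x xT; apply: (L2_le _ KM (HK v' dv' Rad sv' vR' x xT)) => k.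
  by rewrite mulr_ge0 ?cabs_ge0 ?lexx.
apply: (HK' w one v dv u du D w0 wD) => //.
- by move=> k k0; exact: wfull_ge1.
- exact: cabs_one.
- exact: solves_le sv.
- exact: solves_le su.
- exact: h sv vR.
- exact: h su uR.
Qed.

(** The competitor is only known to be bounded in l^2; having the same datum, it inherits a weighted
    bound from the a priori estimate inside [lipschitz_full]. *)
Lemma solves_unique v dv u du M M' Z : solves T one v dv M -> solves T one u du M' ->
  norm_le s (v 0) Z -> (forall k, u 0 k = v 0 k) ->
  forall t, 0 <= t <= T -> forall k, u t k = v t k.
Proof.
move=> sv su vZ uv t tT k.
have T00 : 0 <= (0 : R) <= T by apply/andP.
have M0 : 0 <= M by have [_ _ h _] := sv; exact: L2_ge0 (h 0 T00).
have M'0 : 0 <= M' by have [_ _ h _] := su; exact: L2_ge0 (h 0 T00).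
have [K K0 HK] := lipschitz_full (addr_ge0 M0 M'0) (L2_ge0 vZ).
have sv' : solves T one v dv (M + M') by apply: solves_le sv; rewrite lerDl.
have su' : solves T one u du (M + M') by apply: solves_le su; rewrite lerDr.
have uZ : norm_le s (u 0) Z by under eq_fun do rewrite uv.
have z0 : L2 (fun k => w k * cabs (u 0 k - v 0 k)) 0.
  by under eq_fun do rewrite uv subrr cabs0 mulr0; exact: L2_zero.
have := HK _ _ _ _ _ su' sv' uZ vZ z0 t tT; rewrite mulr0 => h.
have [k0|k0] := eqVneq k 0.
  by rewrite k0; have [-> _ _ _] := sv; have [-> _ _ _] := su.
apply/eqP; rewrite -subr_eq0; apply/eqP; apply: cabs_eq0; apply/le_anti; rewrite cabs_ge0 andbT.
apply: le_trans (L2_pt k h); rewrite ler_peMl ?cabs_ge0//; exact: wfull_ge1.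
Qed.

Lemma powR_unbounded X : 0 <= X -> exists N : nat, X <= N.+1%:R `^ s.
Proof.
move=> X0; exists (Num.bound (X `^ s^-1)).
rewrite [leLHS](_ : X = (X `^ s^-1) `^ s); last by rewrite -powRrM mulVf ?powRr1// gt_eqF.
apply: ge0_ler_powR; rewrite ?nnegrE ?powR_ge0 ?ler0n ?(ltW s0)//.
apply: ltW; apply: lt_trans (archi_boundP (powR_ge0 _ _)) _.
by rewrite ltr_nat.
Qed.

(** Outside [box N] the factor x_j has |j| >= N + 1, so replacing it by |j|^s x_j gains (N +
    1)^(-s), which tends to 0 because s > 0. The bound sees x only through M and W, hence is uniform
    over the approximations. *)
Lemma Qpart_tail gam (x : R -> int -> C) q t k M W N : (forall k, cabs (gam k) <= 1) ->
  0 <= t <= T -> Qlim T gam x x (@zfam R) (@zfam R) q ->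
  L2 (fun k => cabs (x t k)) M -> norm_le s (x t) W ->
  cabs (q t k - Qpart gam x x (@zfam R) (@zfam R) N t k) <=
    (absz k)%:R / 2 * ((N.+1%:R `^ s)^-1 * (W * M)).
Proof.
move=> gam1 tT Qx xM xW; apply/ler_addgt0Pr => e e0.
have [N' _ /(_ (maxn N N') (leq_maxr _ _)) h] := ccvg_eventually_cabs (Qx t tT k) e0.
pose m := maxn N N'; rewrite -/m /= in h.
have -> : q t k - Qpart gam x x (@zfam R) (@zfam R) N t k =
  (Qpart gam x x (@zfam R) (@zfam R) m t k - Qpart gam x x (@zfam R) (@zfam R) N t k) -
  (Qpart gam x x (@zfam R) (@zfam R) m t k - q t k) by ring.
apply: le_trans (cabsB _ _) _; apply: lerD => //.
rewrite /Qpart -mulrBr cabsM [cabs (gam k * _)]cabsM cabs_half_ik.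
have k0 : 0 <= (absz k)%:R / 2 :> R by rewrite divr_ge0.
have p0 : 0 < N.+1%:R `^ s by rewrite powR_gt0 ?ltr0n.
apply: ler_pM; rewrite ?mulr_ge0 ?cabs_ge0 ?ler_piMl//.
pose F j := expi (phase2 R k j * t) * (x t j * x t (k - j) + @zfam R t j * @zfam R t (k - j)).
have -> : \sum_(j <- box m) F j - \sum_(j <- box N) F j = \sum_(j <- box m | j \notin box N) F j.
  rewrite [X in X - _](bigID (fun j => j \in box N))/=.
  rewrite (_ : \sum_(j <- box m | j \in box N) F j = \sum_(j <- box N) F j); first by rewrite addrC addrK.
  rewrite -big_filter; apply: perm_big; apply: uniq_perm; rewrite ?filter_uniq ?box_uniq//.
  by move=> j; rewrite mem_filter !mem_box andb_idr// => /leq_trans; apply; rewrite leq_maxl.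
rewrite -big_filter; apply: le_trans (cabs_sum _ _) _.
rewrite mulrC ler_pdivlMr// mulr_suml.
have us : uniq [seq j <- box m | j \notin box N] by rewrite filter_uniq ?box_uniq.
apply: le_trans (L2_cs us xW (L2_sub k xM)).
rewrite !big_seq; apply: ler_sum => j; rewrite mem_filter => /andP[jN _].
rewrite /F /zfam mul0r addr0 cabsM cabs_expi mul1r cabsM mulrC mulrA ler_wpM2r ?cabs_ge0//.
rewrite ler_wpM2r ?cabs_ge0//; apply: ge0_ler_powR; rewrite ?nnegrE ?ler0n ?(ltW s0)//.
by rewrite ler_nat; move: jN; rewrite mem_box -ltnNge.
Qed.

Lemma existence (v0 : int -> C) M Z : v0 0 = 0 -> (forall k, v0 (- k) = conjc (v0 k)) ->
  L2 (fun k => cabs (v0 k)) M -> norm_le s v0 Z ->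
  exists v dv W, [/\ solves T one v dv M, (forall k, v 0 k = v0 k),
    (forall t k, 0 <= t <= T -> v t (- k) = conjc (v t k)) &
    (forall t, 0 <= t <= T -> norm_le s (v t) W)].
Proof.
move=> v00 v0r v0M v0Z.
have M0 := L2_ge0 v0M; have [K K0 HK] := apriori_growth T0 M0.
have T00 : 0 <= (0 : R) <= T by apply/andP.
have tr n k : trunc_real n v0 k = if (absz k <= n)%N then v0 k else 0.
  rewrite /trunc_real; have [kn|kn] := boolP (absz k <= n)%N; rewrite ?andbT ?andbF//.
  case: (ltgtP 0 k) => [k0|k0|<-] //=; by rewrite v0r conjcK.
have sols n : exists u : R -> int -> C, exists du, [/\ solves T (@kdv_gam R n) u du M,
    (forall t k, u t (- k) = conjc (u t k)), (forall k, u 0 k = if (absz k <= n)%N then v0 k else 0) &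
    (forall t, 0 <= t <= T -> norm_le s (u t) (K * Z))].
  have [u [du [su ur u0 uout]]] := galerkin_ode Tpos (energy_ge0 n v0) (erefl (energy n v0)).
  have eM : Num.sqrt (energy n v0) <= M.
    rewrite -(ger0_norm M0) -sqrtr_sqr ler_wsqrtr// /energy.
    have [_ _ /(_ _ (box_uniq n))] := v0M; apply: le_trans.
    apply: ler_sum => j _; rewrite -cabs_sq lerXn2r ?nnegrE ?cabs_ge0// tr.
    by case: ifP; rewrite ?cabs0 ?cabs_ge0.
  have {}su := solves_le eM su.
  have u0' k : u 0 k = if (absz k <= n)%N then v0 k else 0 by rewrite u0 tr.
  exists u, du; split=> // t tT.
  have [_ _ uM _] := su.
  apply: (HK w (@kdv_gam R n) u du (n%:R `^ s * M) Z) => //.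
  - by move=> k; exact: kdv_gam1.
  (* The approximation lives on |k| <= n, so its weighted norm is at most n^s M; this makes it
     finite and does not enter the bound [K * Z]. *)
  - move=> x xT; have [_ _ uMx] := uM x xT.
    split=> [k| |r ur']; [by rewrite mulr_ge0 ?cabs_ge0|by rewrite mulr_ge0// powR_ge0|].
    apply: (@le_trans _ _ (\sum_(k <- r) (n%:R `^ s) ^+ 2 * cabs (u x k) ^+ 2)).
      apply: ler_sum => k _; rewrite exprMn.
      have [kn|kn] := leqP (absz k) n; last by rewrite uout// cabs0 expr0n/= !mulr0.
      rewrite ler_wpM2r ?sqr_ge0// lerXn2r ?nnegrE ?powR_ge0 ?w0//.
      by apply: ge0_ler_powR; rewrite ?nnegrE ?ler0n ?(ltW s0)// ler_nat.
    by rewrite -mulr_sumr exprMn ler_wpM2l ?sqr_ge0 ?uMx.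
  - apply: (L2_le _ (lexx Z) v0Z) => k; rewrite mulr_ge0 ?cabs_ge0//= ler_wpM2l// u0'.
    by case: ifP; rewrite ?cabs0 ?cabs_ge0.
have /choice[u /choice[du Hu]] := sols.
have duB n t k : 0 <= t <= T -> cabs (du n t k) <= (absz k)%:R * (M * M / 2).
  move=> tT; have [[_ _ uM Qu] _ _ _] := Hu n.
  apply: (Qlim_cabs_le Qu tT) => N.
  have lz := L2_wcabs_zero t (lexx (0 : R)).
  have := Qpart_le N k (@kdv_gam1 R n) (uM t tT) (uM t tT) lz lz.
  by rewrite mulr0 addr0.
have ul n k : lip T (fun t => u n t k) (2 * ((absz k)%:R * (M * M / 2))).
  have [[_ pu _ _] _ _ _] := Hu n.
  by apply: (cprim_lipschitz (pu k)) => t; exact: duB.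
have ub n k t : 0 <= t <= T -> cabs (u n t k) <= M.
  by move=> tT; have [[_ _ uM _] _ _ _] := Hu n; exact: (L2_pt k (uM t tT)).
have [phi [v' [phim uv']]] := arzela_ascoli Tpos ul (B := fun=> M) ub.
(* Outside [0, T] nothing is known of v', while [solves] asks for a zero entry at index 0 for every
   real t. *)
pose v t := off0 (v' t).
have uv t k : 0 <= t <= T -> ccvg (fun m => u (phi m) t k) (v t k).
  move=> tT; rewrite /v /off0; case: eqVneq => [->|_]; last exact: uv'.
  rewrite (_ : (fun m => _) = fun=> 0); first exact: ccvg_cst.
  by apply/funext => m; have [[-> _ _ _] _ _ _] := Hu (phi m).
have vM t : 0 <= t <= T -> L2 (fun k => cabs (v t k)) M.
  move=> tT; have := @L2_ccvg R (fun=> 1) (fun m => u (phi m) t) (v t) M (fun=> ler01) (fun k => uv t k tT).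
  have e1 (x : int -> C) : (fun k => 1 * cabs (x k)) = fun k => cabs (x k).
    by apply/funext => k; rewrite mul1r.
  by rewrite e1; apply=> m; rewrite e1; have [[_ _ uM _] _ _ _] := Hu (phi m); exact: uM.
have vW t : 0 <= t <= T -> norm_le s (v t) (K * Z).
  move=> tT; apply: (L2_ccvg w0 (fun k => uv t k tT)) => m.
  by have [_ _ _ h] := Hu (phi m); exact: h.
pose dv t k := half_ik R k * Defs.conv (v t) k t.
have voff t : off0 (v t) = v t by apply/funext => k; rewrite /v /off0; case: (k == 0).
have Qv : Qlim T one v v (@zfam R) (@zfam R) dv.
  move=> t tT k.
  have lv : L2 (fun k => cabs (off0 (v t) k)) M by rewrite voff; exact: vM.
  have := ccvgM (ccvg_cst (half_ik R k)) (conv_ccvg k t lv).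
  congr (ccvg _ _); apply/funext => n.
  rewrite conv_partialE /Qpart mul1r voff; congr (_ * _); apply: eq_bigr => j _.
  by rewrite /zfam mul0r addr0.
have dulim t k : 0 <= t <= T -> ccvg (fun m => du (phi m) t k) (dv t k).
  move=> tT; apply: ccvgP => e e0.
  have [k0|k0] := eqVneq k 0.
    apply: nearW => m; have := duB (phi m) t k tT.
    rewrite /dv k0 absz0 mul0r /half_ik mul0r mulr0 mul0r subr0 => h.
    exact: le_trans h (ltW e0).
  pose A := (absz k)%:R / 2 * (K * Z * M).
  have A0 : 0 <= A by rewrite !mulr_ge0 ?invr_ge0// (L2_ge0 v0Z).
  (* N makes the tail of Q at most e / 3 for the approximations and the limit alike; the last e / 3
     pays for the convergence of the N-th partial sum. *)
  have [N HN] := powR_unbounded (divr_ge0 (mulr_ge0 (ler0n R 3) A0) (ltW e0)).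
  have p0 : 0 < N.+1%:R `^ s by rewrite powR_gt0 ?ltr0n.
  have Ae : (absz k)%:R / 2 * ((N.+1%:R `^ s)^-1 * (K * Z * M)) <= e / 3.
    rewrite mulrCA -/A mulrC ler_pdivrMr// mulrAC ler_pdivlMr// mulrC.
    by move: HN; rewrite ler_pdivrMr// [leRHS]mulrC.
  have cQ : ccvg (fun m => Qpart one (u (phi m)) (u (phi m)) (@zfam R) (@zfam R) N t k)
      (Qpart one v v (@zfam R) (@zfam R) N t k).
    apply: ccvgM; first exact: ccvg_cst.
    apply: ccvg_sum => j; apply: ccvgM; first exact: ccvg_cst.
    by apply: ccvgD; [apply: ccvgM; exact: uv|exact: ccvg_cst].
  have e3 : 0 < e / 3 by rewrite divr_gt0.
  near=> m.
  have h1 : cabs (Qpart one (u (phi m)) (u (phi m)) (@zfam R) (@zfam R) N t k -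
      Qpart one v v (@zfam R) (@zfam R) N t k) <= e / 3.
    by near: m; exact: ccvg_eventually_cabs cQ e3.
  have km : (absz k <= phi m)%N.
    by apply: leq_trans (phim m); near: m; exists (absz k).
  have [[_ _ uM Qu] _ _ uW] := Hu (phi m).
  have h2 := le_trans (Qpart_tail k N (@kdv_gam1 R (phi m)) tT Qu (uM t tT) (uW t tT)) Ae.
  have h3 := le_trans (Qpart_tail k N cabs_one tT Qv (vM t tT) (vW t tT)) Ae.
  have gk : Qpart (@kdv_gam R (phi m)) (u (phi m)) (u (phi m)) (@zfam R) (@zfam R) N t k =
     Qpart one (u (phi m)) (u (phi m)) (@zfam R) (@zfam R) N t k.
    by rewrite /Qpart /kdv_gam k0 km.
  rewrite gk in h2.
  set q1 := Qpart _ _ _ _ _ _ _ _ in h1 h2; set q2 := Qpart _ _ _ _ _ _ _ _ in h1 h3.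
  have -> : du (phi m) t k - dv t k = (du (phi m) t k - q1) + (q1 - q2) - (dv t k - q2) by ring.
  apply: le_trans (cabsB _ _) _; have h4 := cabsD (du (phi m) t k - q1) (q1 - q2).
  lra.
exists v, dv, (K * Z); split=> //.
- split=> //.
  move=> k; apply: (@cprim_limit _ T Tpos (fun m t => u (phi m) t k) (fun m t => du (phi m) t k) _ _ ((absz k)%:R * (M * M / 2))).
  + by move=> m; have [[_ pu _ _] _ _ _] := Hu (phi m).
  + by move=> m t; exact: duB.
  + by move=> t; exact: uv.
  + by move=> t; exact: dulim.
- move=> k; apply: (ccvg_unique (uv 0 k T00)); apply: ccvgP => e e0.
  exists (absz k) => // m /= km; have [_ _ -> _] := Hu (phi m).
  by rewrite (leq_trans km (phim m)) subrr cabs0 ltW.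
- move=> t k tT; apply: (ccvg_unique (uv t (- k) tT)).
  have [c1 c2] := uv t k tT; split.
  + rewrite (_ : (fun m => _) = fun m => complex.Re (u (phi m) t k)); first by case: (v t k) c1.
    by apply/funext => m; have [_ -> _ _] := Hu (phi m); case: (u _ _ _).
  + rewrite (_ : (fun m => _) = fun m => - complex.Im (u (phi m) t k)).
      by have -> : complex.Im (conjc (v t k)) = - complex.Im (v t k); [case: (v t k)|exact: cvgN].
    by apply/funext => m; have [_ -> _ _] := Hu (phi m); case: (u _ _ _).
Unshelve. all: by end_near. Qed.
End fixed_s.
End wellposed.

(** * Continuity in time *)

Section continuity.
Variables (R : realType) (T s : R).
Hypotheses (Tpos : 0 < T) (s12 : 0 < s <= 1 / 2).
Let T0 : 0 <= T. Proof. exact: ltW. Qed.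
Notation C := R[i].
Notation one := (fun _ : int => 1 : C).
Notation w := (wfull s).
Let s0 : 0 < s. Proof. by case/andP: s12. Qed.
Let s01 : 0 < s <= 1. Proof. by case/andP: s12 => a b; rewrite a /=; lra. Qed.
Let w0 k : 0 <= w k. Proof. exact: wfull_ge0. Qed.

Lemma wfull1 k : wfull 1 k = (absz k)%:R :> R.
Proof. by rewrite /wfull powRr1. Qed.

Lemma L2_cabs_drop (x : int -> C) Z : x 0 = 0 -> L2 (fun k => w k * cabs (x k)) Z -> L2 (fun k => cabs (x k)) Z.
Proof.
move=> x0; apply: L2_le => // k; rewrite cabs_ge0/=.
have [->|k0] := eqVneq k 0; first by rewrite x0 cabs0 mulr0.
by rewrite ler_peMl ?cabs_ge0//; exact: wfull_ge1.
Qed.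

(* [|k|^(2s) <= |k|], interpolated between the weights [|k|^2] and [|k|^(-2)]. *)
Lemma wfull_interp (A : nat) k (x B : R) : (0 < A)%N -> 0 <= x <= (absz k)%:R * B ->
  (w k * x) ^+ 2 <= A%:R^-1 * ((absz k)%:R * x) ^+ 2 + A%:R ^+ 5 * B ^+ 2 * inv_abs R k ^+ 2.
Proof.
move=> A0 /andP[x0 xB].
have [k0|k0] := eqVneq k 0.
  have -> : x = 0 by apply/le_anti; rewrite x0 andbT; move: xB; rewrite k0 mul0r.
  rewrite !mulr0 expr0n/= mulr0 add0r; apply: mulr_ge0; last exact: sqr_ge0.
  by apply: mulr_ge0; [exact: exprn_ge0|exact: sqr_ge0].
pose q : R := (absz k)%:R.
have q1 : 1 <= q by rewrite ler1n absz_gt0.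
have q0 : 0 < q by rewrite (lt_le_trans _ q1).
have w2 : w k ^+ 2 <= q.
  have -> : w k ^+ 2 = q `^ (s * 2) by rewrite powRrM powR_mulrn ?powR_ge0.
  rewrite -[leRHS](powRr1 (ltW q0)); apply: ler_powR => //.
  by case/andP: s12 => _; lra.
have AR : (0 : R) < A%:R by rewrite ltr0n.
rewrite exprMn; apply: (@le_trans _ _ (q * x ^+ 2)); first by rewrite ler_wpM2r ?sqr_ge0.
rewrite -/q /inv_abs -/q.
(* With q = |k|: for q >= A use q <= q^2 / A. For q < A, x <= q B gives q x^2 <= q^3 B^2 = q^5 B^2
   q^(-2), whence the fifth power of A. *)
have [Aq|qA] := leP A%:R q.
  apply: (@le_trans _ _ (A%:R^-1 * (q * x) ^+ 2)); last first.
    rewrite lerDl; apply: mulr_ge0; last exact: sqr_ge0.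
    by apply: mulr_ge0; [exact: exprn_ge0|exact: sqr_ge0].
  rewrite [leRHS](_ : _ = (q / A%:R) * (q * x ^+ 2)); last by ring.
  by rewrite ler_peMl ?mulr_ge0 ?sqr_ge0 ?(ltW q0)// ler_pdivlMr// mul1r.
apply: (@le_trans _ _ (A%:R ^+ 5 * B ^+ 2 * q^-1 ^+ 2)); last first.
  by rewrite lerDr; apply: mulr_ge0; [rewrite invr_ge0|exact: sqr_ge0].
apply: (@le_trans _ _ (q ^+ 5 * B ^+ 2 * q^-1 ^+ 2)).
  have -> : q ^+ 5 * B ^+ 2 * q^-1 ^+ 2 = q * (q * B) ^+ 2 by field; rewrite gt_eqF.
  by rewrite ler_wpM2l ?(ltW q0)// lerXn2r ?nnegrE ?(le_trans x0).
by rewrite !ler_wpM2r ?sqr_ge0// lerXn2r ?nnegrE ?(ltW q0) ?(ltW AR) ?(ltW qA).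
Qed.

(** The uniform H^1 bound controls the high frequencies, and the low ones move slowly since each
    coefficient is Lipschitz in time with constant M^2 |k|. *)
Lemma smooth_continuous y dy M W : solves T one y dy M ->
  (forall t, 0 <= t <= T -> L2 (fun k => wfull 1 k * cabs (y t k)) W) ->
  forall e, 0 < e -> exists2 d, 0 < d & forall t t', 0 <= t <= T -> 0 <= t' <= T -> `|t' - t| < d ->
    L2 (fun k => w k * cabs (y t' k - y t k)) e.
Proof.
move=> [_ py yM Qy] yW e e0.
have T00 : 0 <= (0 : R) <= T by apply/andP.
have W0 := L2_ge0 (yW 0 T00); have M0 := L2_ge0 (yM 0 T00).
have e2 : 0 < e ^+ 2 / 2 by rewrite divr_gt0// exprn_gt0.
pose A := (Num.bound ((W + W) ^+ 2 / (e ^+ 2 / 2))).+1.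
have AR : (0 : R) < A%:R by rewrite ltr0n.
have hA : A%:R^-1 * (W + W) ^+ 2 <= e ^+ 2 / 2.
  rewrite mulrC ler_pdivrMr// [leRHS]mulrC -ler_pdivrMr//.
  apply: ltW; apply: lt_trans (archi_boundP _) _; last by rewrite ltr_nat.
  by rewrite divr_ge0 ?sqr_ge0// ltW.
(* The 4 is the square of the l^2 bound for [inv_abs]; as d <= 1, the resulting d^2 is at most d. *)
pose X := 4 * (A%:R ^+ 5 * (M * M) ^+ 2).
have X0 : 0 <= X by rewrite !mulr_ge0 ?exprn_ge0 ?sqr_ge0.
pose d := Num.min 1 (e ^+ 2 / 2 / (X + 1)).
have X1 : 0 < X + 1 by rewrite ltr_wpDl.
have d0 : 0 < d by rewrite lt_min ltr01 divr_gt0.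
have d1 : d <= 1 by rewrite ge_min lexx.
have dX : d * (X + 1) <= e ^+ 2 / 2 by rewrite -ler_pdivlMr// ge_min lexx orbT.
exists d => // t t' tT t'T tt'.
have inc k : cabs (y t' k - y t k) <= (absz k)%:R * (M * M * d).
  have l : lip T (fun t => y t k) (2 * ((absz k)%:R * (M * M / 2))).
    apply: (cprim_lipschitz (py k)) => x xT; apply: (Qlim_cabs_le Qy xT) => n.
    have lz := L2_wcabs_zero x (lexx (0 : R)).
    by have := Qpart_le n k (@cabs_one R) (yM x xT) (yM x xT) lz lz; rewrite mulr0 addr0.
  apply: le_trans (lip_abs l t'T tT) _.
  rewrite [leRHS](_ : _ = 2 * ((absz k)%:R * (M * M / 2)) * d); last by field.
  by rewrite ler_wpM2l ?(ltW tt')// !mulr_ge0 ?invr_ge0.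
have zW := L2_cabs_add (@wfull_ge0 R 1) (yW t' t'T) (L2_cabs_opp (yW t tT)).
split=> [k||r ur]; [by rewrite mulr_ge0// cabs_ge0|exact: ltW|].
apply: (@le_trans _ _ (\sum_(k <- r) (A%:R^-1 * (wfull 1 k * cabs (y t' k - y t k)) ^+ 2 +
   A%:R ^+ 5 * (M * M * d) ^+ 2 * inv_abs R k ^+ 2))).
  by apply: ler_sum => k _; rewrite wfull1; apply: wfull_interp => //; rewrite cabs_ge0 inc.
rewrite big_split/= -!mulr_sumr.
have [_ _ /(_ r ur) h1] := zW; have [_ _ /(_ r ur) h2] := L2_inv_abs R.
rewrite (_ : e ^+ 2 = e ^+ 2 / 2 + e ^+ 2 / 2); last by field.
apply: lerD.
  by apply: le_trans hA; rewrite ler_wpM2l// invr_ge0.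
apply: (@le_trans _ _ (X * d ^+ 2)).
  rewrite [leRHS](_ : _ = A%:R ^+ 5 * (M * M * d) ^+ 2 * 2 ^+ 2); last by rewrite /X; ring.
  by rewrite ler_wpM2l// mulr_ge0 ?sqr_ge0 ?exprn_ge0.
apply: le_trans dX; rewrite mulrC ler_pM// ?sqr_ge0//; last by rewrite lerDl.
by rewrite expr2 ler_piMl// ltW.
Qed.

Lemma solves_continuous v dv M Z : solves T one v dv M ->
  (forall k, v 0 (- k) = conjc (v 0 k)) -> L2 (fun k => w k * cabs (v 0 k)) Z ->
  forall e, 0 < e -> exists2 d, 0 < d & forall t t', 0 <= t <= T -> 0 <= t' <= T -> `|t' - t| < d ->
    L2 (fun k => w k * cabs (v t' k - v t k)) e.
Proof.
move=> sv vr vZ e e0; have [v00 _ vM _] := sv.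
have T00 : 0 <= (0 : R) <= T by apply/andP.
have M0 := L2_ge0 (vM 0 T00); have Z0 := L2_ge0 vZ.
have [K K0 HK] := lipschitz_full Tpos s01 M0 Z0.
have K1 : 0 < K + 1 by rewrite ltr_wpDl.
have e3 : 0 < e / 3 by rewrite divr_gt0.
(* The Lipschitz estimate turns this initial tail into at most e / 3 at all times; K + 1 in place of
   K avoids dividing by 0. *)
have [m Hm] := L2_tail vZ (divr_gt0 e3 K1).
pose y0 k := if (absz k <= m)%N then v 0 k else 0.
have ley k : cabs (y0 k) <= cabs (v 0 k) by rewrite /y0; case: ifP; rewrite ?cabs0 ?cabs_ge0.
have y0M : L2 (fun k => cabs (y0 k)) M.
  by apply: (L2_le _ (lexx M) (vM 0 T00)) => k; rewrite cabs_ge0 ley.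
have y0Z : L2 (fun k => w k * cabs (y0 k)) Z.
  by apply: (L2_le _ (lexx Z) vZ) => k; rewrite mulr_ge0 ?cabs_ge0//= ler_wpM2l.
have y01 : L2 (fun k => wfull 1 k * cabs (y0 k)) (m%:R * M).
  have [_ _ hM] := y0M.
  split=> [k||r ur]; [by rewrite mulr_ge0 ?cabs_ge0 ?wfull_ge0|by rewrite mulr_ge0|].
  apply: (@le_trans _ _ (\sum_(k <- r) m%:R ^+ 2 * cabs (y0 k) ^+ 2)).
    apply: ler_sum => k _; rewrite exprMn wfull1.
    have [km|km] := leqP (absz k) m; last by rewrite /y0 leqNgt km/= cabs0 expr0n/= !mulr0.
    by rewrite ler_wpM2r ?sqr_ge0// lerXn2r ?nnegrE ?ler0n// ler_nat.
  by rewrite -mulr_sumr exprMn ler_wpM2l ?sqr_ge0 ?hM.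
have y00 : y0 0 = 0 by rewrite /y0 /= v00.
have y0r k : y0 (- k) = conjc (y0 k).
  by rewrite /y0 abszN; case: ifP => _; rewrite ?vr ?conjc0.
have one01 : 0 < (1 : R) <= 1 by rewrite ltr01 lexx.
have [y [dy [W [sy yi _ yW]]]] := existence Tpos one01 y00 y0r y0M y01.
have [d d0 Hd] := smooth_continuous sy yW e3.
exists d => // t t' tT t'T tt'.
have yZ : L2 (fun k => w k * cabs (y 0 k)) Z by under eq_fun do rewrite yi.
have z0 : L2 (fun k => w k * cabs (v 0 k - y 0 k)) (e / 3 / (K + 1)).
  apply: (L2_le _ (lexx _) Hm) => k; rewrite mulr_ge0 ?cabs_ge0//= yi /y0.
  by case: ifP => _; rewrite ?subrr ?subr0 ?cabs0 ?mulr0.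
have close x : 0 <= x <= T -> L2 (fun k => w k * cabs (v x k - y x k)) (e / 3).
  move=> xT; apply: (L2_le _ _ (HK _ _ _ _ _ sv sy vZ yZ z0 x xT)).
    by move=> k; rewrite mulr_ge0 ?cabs_ge0 ?lexx.
  by rewrite mulrA ler_pdivrMr// mulrC ler_pM2l// lerDl.
have h := L2_cabs_add w0 (L2_cabs_add w0 (close t' t'T) (Hd t t' tT t'T tt')) (L2_cabs_opp (close t tT)).
rewrite (_ : e = e / 3 + e / 3 + e / 3); last by field.
move: h; congr (L2 _ _); apply/funext => k; congr (_ * cabs _).
by ring.
Qed.
End continuity.

(** * Well-posedness for data in H^s *)

Theorem theorem6p5 (R : realType) (s T : R) :
  0 < s <= 1 / 2 -> 0 < T ->
  (forall v0 : seqC R, in_Hs s v0 ->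
     exists v : R -> seqC R,
       [/\ is_solution T v0 v,
           (forall w : R -> seqC R, is_solution T v0 w ->
              forall t : R, 0 <= t <= T -> forall k : int, k != 0 -> w t k = v t k) &
           cont_Hs s T v])
  /\
  (forall Rad : R, 0 < Rad ->
     exists C : R,
       forall (v0 w0 : seqC R) (v w : R -> seqC R),
         in_Hs s v0 -> in_Hs s w0 ->
         (hs_norm s v0 <= Rad%:E)%E -> (hs_norm s w0 <= Rad%:E)%E ->
         is_solution T v0 v -> is_solution T w0 w ->
         forall t : R, 0 <= t <= T ->
           (hs_norm s (seqC_sub (v t) (w t)) <= C%:E * hs_norm s (seqC_sub v0 w0))%E).
Proof.
move=> s12 Tpos.
have s0 : 0 < s by case/andP: s12.
have s01 : 0 < s <= 1 by case/andP: s12 => a b; rewrite a /=; lra.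
have T00 : 0 <= (0 : R) <= T by rewrite lexx ltW.
have ex (v0 : seqC R) Z : in_Hs s v0 -> 0 <= Z -> (hs_norm s v0 <= Z%:E)%E ->
    L2 (fun k => wfull s k * cabs (off0 v0 k)) Z /\
    exists v dv W, [/\ solves T (fun=> 1) v dv Z, (forall k, v 0 k = off0 v0 k),
      (forall t k, 0 <= t <= T -> v t (- k) = conjc (v t k)) &
      (forall t, 0 <= t <= T -> L2 (fun k => wfull s k * cabs (v t k)) W)].
  move=> [v0r _] Z0 /(hs_normP s v0 Z0) lZ; split=> //.
  have o0 : off0 v0 0 = 0 by rewrite /off0 eqxx.
  apply: (existence Tpos s01 o0 _ (L2_cabs_drop s12 o0 lZ) lZ).
  move=> k; rewrite /off0 oppr_eq0; case: ifPn => [_|k0]; first by rewrite conjc0.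
  exact: v0r.
have uniq_sol (v0 : seqC R) Z v dv w : L2 (fun k => wfull s k * cabs (off0 v0 k)) Z ->
    solves T (fun=> 1) v dv Z -> (forall k, v 0 k = off0 v0 k) -> is_solution T v0 w ->
    forall t, 0 <= t <= T -> forall k, off0 (w t) k = v t k.
  move=> lZ sv vi /(solves_of_solution Tpos)[M M0 [dw sw wi]] t tT k.
  have vZ : L2 (fun k => wfull s k * cabs (v 0 k)) Z by under eq_fun do rewrite vi.
  apply: (solves_unique Tpos s01 sv sw vZ _ tT) => j.
  by rewrite vi /off0; case: ifPn => // /wi.
split.
- move=> v0 v0s; have [v0r v0f] := v0s.
  have [Z Z0 vZ] := hs_norm2_fin v0f.
  have [lZ [v [dv [W [sv vi vr vW]]]]] : _ := ex v0 Z v0s Z0 (eq_ind_r (fun x => (x <= Z%:E)%E) (lexx _) vZ).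
  have [vz _ _ _] := sv.
  have voff t : off0 (v t) = v t.
    by apply/funext => k; rewrite /off0; case: eqVneq => // ->; rewrite vz.
  exists v; split.
  + exact: (solution_of_solves Tpos sv).
  + move=> w sw t tT k k0.
    by rewrite -(uniq_sol v0 Z v dv w lZ sv vi sw t tT k) /off0 (negbTE k0).
  + move=> t tT; split.
      split; first by move=> k _; exact: vr.
      have W0 := L2_ge0 (vW t tT).
      by apply: (@hs_norm_fin _ _ _ W); apply/hs_normP => //; rewrite voff; exact: vW.
    move=> e e0; have e2 : 0 < e / 2 by rewrite divr_gt0.
    have vZ0 : L2 (fun k => wfull s k * cabs (v 0 k)) Z by under eq_fun do rewrite vi.
    have [d d0 Hd] := solves_continuous Tpos s12 sv (fun k => vr 0 k T00) vZ0 e2.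
    exists d => // t' t'T tt'.
    apply: (@le_lt_trans _ _ (e / 2)%:E); last by rewrite lte_fin; lra.
    apply/hs_normP; first exact: ltW.
    move: (Hd t t' tT t'T tt'); congr (L2 _ _); apply/funext => k; congr (_ * cabs _).
    by rewrite /off0 /seqC_sub; case: eqVneq => // ->; rewrite !vz subrr.
- move=> Rad Rad0.
  have [K K0 HK] := lipschitz_full Tpos s01 (ltW Rad0) (ltW Rad0).
  (* A positive constant keeps the right-hand side equal to +oo should the distance of the data be
     infinite. *)
  exists (K + 1) => v0 w0 v w v0s w0s vR wR sv sw t tT.
  have K1 : 0 < K + 1 by rewrite ltr_wpDl.
  (* Given solutions come with l^2 bounds that are not uniform. By uniqueness they coincide with the
     constructed ones, bounded by Rad in l^2, so that K depends on s, T and Rad only. *)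
  have [lv [v' [dv [_ [sv' vi _ _]]]]] := ex v0 Rad v0s (ltW Rad0) vR.
  have [lw [w' [dw [_ [sw' wi _ _]]]]] := ex w0 Rad w0s (ltW Rad0) wR.
  have Ev := uniq_sol v0 Rad v' dv v lv sv' vi sv t tT.
  have Ew := uniq_sol w0 Rad w' dw w lw sw' wi sw t tT.
  have subE (x y : seqC R) k : off0 (seqC_sub x y) k = off0 x k - off0 y k.
    by rewrite /off0 /seqC_sub; case: ifP; rewrite ?subrr.
  case E : (hs_norm s (seqC_sub v0 w0)) => [D| |].
  + have D0 : 0 <= D by rewrite -lee_fin -E; exact: hs_norm_ge0.
    have lD : L2 (fun k => wfull s k * cabs (v' 0 k - w' 0 k)) D.
      have /(hs_normP s _ D0) : (hs_norm s (seqC_sub v0 w0) <= D%:E)%E by rewrite E.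
      by congr (L2 _ _); apply/funext => k; rewrite subE vi wi.
    have vR' : L2 (fun k => wfull s k * cabs (v' 0 k)) Rad by under eq_fun do rewrite vi.
    have wR' : L2 (fun k => wfull s k * cabs (w' 0 k)) Rad by under eq_fun do rewrite wi.
    have KD : 0 <= (K + 1) * D by rewrite mulr_ge0// ltW.
    rewrite -EFinM; apply/(hs_normP s _ KD).
    have h := HK _ _ _ _ _ sv' sw' vR' wR' lD t tT.
    apply: (L2_le _ _ h); last by rewrite ler_wpM2r// lerDl.
    by move=> k; rewrite subE Ev Ew mulr_ge0 ?wfull_ge0 ?cabs_ge0 ?lexx.
  + by rewrite gt0_muley ?lte_fin// leey.
  + by have := hs_norm_ge0 s (seqC_sub v0 w0); rewrite E.
Qed.
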